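(* Let $r\in\{0,1\}$, and let $(W_{i,j})_{i,j\ge 1}$ be a family of random variables satisfying the assumptions of the real case (if $r=1$) or of the complex case (if $r=0$) described in the context, with parameters $\sigma^2>0$, $s^2\ge 0$ and $\alpha$. For $n\ge 1$ let $X^{(n)}$ be the $n\times n$ matrix with entries $X^{(n)}_{i,j}=\frac{1}{\sqrt n\,\sigma}W_{i,j}$, let $\mu_n=\frac1n\sum_{\lambda\in \mathrm{Sp}(X^{(n)})}\delta_\lambda$ be its spectral measure (eigenvalues counted with multiplicity), and let $m_k(n)=\mathbb{E}\left[\int x^k\,d\mu_n(x)\right]$. Let $\mathrm{sc}$ be the semi-circle measure on $\mathbb{R}$ with density $\frac{1}{2\pi}\sqrt{4-x^2}\,\mathbf 1_{\{x\in[-2,2]\}}$, and let $\nu$ be the signed measure on $\mathbb{R}$ given by $$ \nu=\frac r2\left(\frac12\left(\delta_{2}+\delta_{-2}\right)-\frac{\mathbf 1_{\{x\in[-2,2]\}}\,dx}{\pi\sqrt{4-x^2}}\right) +\frac12\left(\left(\frac{\alpha}{\sigma^4}-(2+r)\right)x^4+\left(\frac{s^2}{\sigma^2}-4\frac{\alpha}{\sigma^4}+7+3r\right)x^2+2\left(\frac{\alpha}{\sigma^4}-\frac{s^2}{\sigma^2}-1\right)\right)\frac{\mathbf 1_{\{x\in[-2,2]\}}\,dx}{\pi\sqrt{4-x^2}} . $$ Then $\nu$ has total mass $0$, and for every integer $k\ge 0$, as $n\to\infty$, $$ m_k(n)=\int x^k\,d\mathrm{sc}(x)+\frac1n\int x^k\,d\nu(x)+o\left(\frac1n\right).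 $$
   Context: The random variables $(W_{i,j})_{i\ge j\ge 1}$ are independent, have mean $0$, and have moments of all orders. Let $\sigma>0$ (with $\sigma^2$ the square of $\sigma$), $s^2\ge 0$ and $\alpha$ be real numbers not depending on $i,j$. One of the following two cases holds. Real case ($r=1$): the $W_{i,j}$ are real-valued, $W_{j,i}=W_{i,j}$, $\mathbb{E}[W_{i,j}]=0$, $\mathbb{E}[W_{i,j}^2]=\sigma^2$ if $i\ne j$, $\mathbb{E}[W_{i,i}^2]=s^2$, and $\mathbb{E}[W_{i,j}^4]=\alpha$ if $i\neq j$. Complex case ($r=0$): the $W_{i,j}$ are complex-valued, $W_{j,i}=\overline{W_{i,j}}$ (so $W_{i,i}$ is real), $\mathbb{E}[W_{i,j}]=0$ for all $i,j$, $\mathbb{E}[W_{i,j}^2]=0$ if $i\ne j$, $\mathbb{E}[|W_{i,j}|^2]=\sigma^2$ if $i\neq j$, $\mathbb{E}[|W_{i,i}|^2]=s^2$, and $\mathbb{E}[|W_{i,j}|^4]=\alpha$ if $i\ne j$.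
   Formalization: ''Have moments of all orders'' is taken uniformly: for each p, the p-th absolute moments of the W_{i,j} are bounded by a constant not depending on i,j; without uniformity, moments of order 6 could grow with i,j and make m_6(n) diverge. *)

(* Defs.v *)
From HB Require Import structures.
From mathcomp Require Import all_boot all_order all_algebra finmap ring lra.
From mathcomp Require Import all_classical all_reals all_analysis.
From mathcomp Require Import measurable_realfun.
From mathcomp.real_closed Require Import complex.
Set Implicit Arguments.
Unset Strict Implicit.
Unset Printing Implicit Defensive.
Import Order.TTheory GRing.Theory Num.Theory.
Import numFieldNormedType.Exports.
Local Open Scope classical_set_scope.
Local Open Scope ring_scope.

Section complex_random_variables.
Context d (T : measurableType d) (R : realType) (P : probability T R).

(* R[i] carries no measurable structure in the library: a complex random
   variable is handled through the pair (real part, imaginary part). *)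
Definition Re_Im (Z : T -> R[i]) (w : T) : R * R :=
  (complex.Re (Z w), complex.Im (Z w)).

Definition complex_expectation (Z : T -> R[i]) : R[i] :=
  Complex (fine 'E_P[fun w => complex.Re (Z w)])
          (fine 'E_P[fun w => complex.Im (Z w)]).

Definition abs_moment (p : nat) (Z : T -> R[i]) : \bar R :=
  'E_P[fun w => Normc.normc (Z w) ^+ p].

(* Mutual independence of the subfamily of X indexed by D. *)
Definition mutually_independent d' (T' : measurableType d') (I : choiceType)
    (D : set I) (X : I -> T -> T') : Prop :=
  forall (J : {fset I}) (B : I -> set T'),
    (forall i, i \in J -> D i) ->
    (forall i, i \in J -> measurable (B i)) ->
    P (\bigcap_(i in [set` J]) (X i @^-1` B i)) =
    (\prod_(i <- J) fine (P (X i @^-1` B i)))%:E.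

End complex_random_variables.

Section wigner_entries.
Context d (T : measurableType d) (R : realType) (P : probability T R).

(* Indices start at 0 instead of 1.  The moment bounds are uniform in (i, j):
   the entries are not assumed identically distributed, and without uniformity
   the moments of order > 4 could grow with (i, j) and destroy the expansion. *)
Record independent_centered_entries (W : nat -> nat -> T -> R[i]) : Prop := {
  entries_measurable : forall i j, measurable_fun setT (Re_Im (W i j)) ;
  entries_independent :
    mutually_independent P [set p : nat * nat | (p.2 <= p.1)%N]
      (fun p => Re_Im (W p.1 p.2)) ;
  entries_centered : forall i j, complex_expectation P (W i j) = 0 ;
  entries_moments : forall p, exists C : R,
    forall i j, (abs_moment P p (W i j) <= C%:E)%E }.

(* The real entries are viewed in R[i], with vanishing imaginary parts. *)
Record real_case (sigma s2 alpha : R) (W : nat -> nat -> T -> R[i]) : Prop := {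
  real_entries : independent_centered_entries W ;
  real_valued : forall i j w, complex.Im (W i j w) = 0 ;
  real_symmetric : forall i j w, W j i w = W i j w ;
  real_variance : forall i j, i != j ->
    complex_expectation P (fun w => W i j w ^+ 2) = (sigma ^+ 2)%:C%C ;
  real_diag_variance : forall i,
    complex_expectation P (fun w => W i i w ^+ 2) = s2%:C%C ;
  real_fourth_moment : forall i j, i != j ->
    complex_expectation P (fun w => W i j w ^+ 4) = alpha%:C%C }.

Record complex_case (sigma s2 alpha : R) (W : nat -> nat -> T -> R[i]) : Prop := {
  complex_entries : independent_centered_entries W ;
  complex_hermitian : forall i j w, W j i w = ((W i j w)^*)%C ;
  complex_square : forall i j, i != j ->
    complex_expectation P (fun w => W i j w ^+ 2) = 0 ;
  complex_variance : forall i j, i != j ->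
    abs_moment P 2 (W i j) = (sigma ^+ 2)%:E ;
  complex_diag_variance : forall i, abs_moment P 2 (W i i) = s2%:E ;
  complex_fourth_moment : forall i j, i != j ->
    abs_moment P 4 (W i j) = alpha%:E }.

End wigner_entries.

Section spectral_measure.
Context (R : realType).

(* The eigenvalues of A, with algebraic multiplicity. *)
Definition eigenvalues n (A : 'M[R[i]]_n) : seq R[i] :=
  sval (closed_field_poly_normal (char_poly A)).

(* For Hermitian A, whose eigenvalues are real, this is the spectral measure:
   complex.Re only transports the eigenvalues from R[i] to R. *)
Definition spectral_measure n (A : 'M[R[i]]_n) :
    {measure set (measurableTypeR R) -> \bar R} :=
  mscale (n%:R^-1)%:nng
    (msum (fun k => \d_(complex.Re (eigenvalues A)`_k : measurableTypeR R)) n).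

Definition wigner_matrix T (sigma : R) (W : nat -> nat -> T -> R[i]) n (w : T) :
    'M[R[i]]_n :=
  \matrix_(i < n, j < n) (((Num.sqrt n%:R * sigma)^-1)%:C%C * W i j w).

Definition mean_moment d (T : measurableType d) (P : probability T R)
    (sigma : R) (W : nat -> nat -> T -> R[i]) (k n : nat) : \bar R :=
  'E_P[fun w => \int[spectral_measure (wigner_matrix sigma W n w)]_x (x ^+ k)].

End spectral_measure.

Section semicircle.
Context (R : realType).

Definition semicircle_pdf (x : R) : R :=
  if x \in `[(-2), 2] then (2 * pi)^-1 * Num.sqrt (4 - x ^+ 2) else 0.

Lemma semicircle_pdf_ge0 x : 0 <= semicircle_pdf x.
Proof.
rewrite /semicircle_pdf; case: ifP => // _.
by rewrite mulr_ge0// ?sqrtr_ge0// invr_ge0 mulr_ge0// pi_ge0.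
Qed.

Lemma measurable_semicircle_pdf : measurable_fun setT semicircle_pdf.
Proof.
rewrite (_ : semicircle_pdf =
  (fun x => (2 * pi)^-1 * Num.sqrt (4 - x ^+ 2)) \_ `[(-2), 2]%classic); last first.
  by apply/funext => x; rewrite patchE mem_setE.
apply/(measurable_restrictT _ _).1; first exact: measurable_itv.
apply: measurable_funTS; apply: measurable_funM => //.
apply: continuous_measurable_fun => x.
apply: (@continuous_comp _ _ _ (fun x : R => 4 - x ^+ 2) Num.sqrt).
  by apply: continuousB; [exact: cst_continuous|exact: exprn_continuous].
exact: sqrt_continuous.
Qed.

Definition semicircle (A : set (measurableTypeR R)) : \bar R :=
  (\int[lebesgue_measure]_(x in A) (semicircle_pdf x)%:E)%E.

Let semicircle0 : semicircle set0 = 0%E.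
Proof. by rewrite /semicircle integral_set0. Qed.

Let semicircle_ge0 A : (0 <= semicircle A)%E.
Proof. by apply: integral_ge0 => x _; rewrite lee_fin semicircle_pdf_ge0. Qed.

Let semicircle_sigma_additive : semi_sigma_additive semicircle.
Proof.
apply: semi_sigma_additive_nng_induced.
- by apply/measurable_EFinP; exact: measurable_semicircle_pdf.
- by move=> x; rewrite lee_fin semicircle_pdf_ge0.
Qed.

HB.instance Definition _ := isMeasure.Build _ _ _ semicircle
  semicircle0 semicircle_ge0 semicircle_sigma_additive.

End semicircle.

Section arcsine.
Context (R : realType).

Definition arcsine_pdf (x : R) : R :=
  if x \in `[(-2), 2] then (pi * Num.sqrt (4 - x ^+ 2))^-1 else 0.

Lemma arcsine_pdf_ge0 x : 0 <= arcsine_pdf x.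
Proof.
rewrite /arcsine_pdf; case: ifP => // _.
by rewrite invr_ge0 mulr_ge0// ?sqrtr_ge0// pi_ge0.
Qed.

Lemma arcsine_pdfE x : x \in `](-2), 2[ ->
  arcsine_pdf x = (pi * Num.sqrt (4 - x ^+ 2))^-1.
Proof.
by move=> xI; rewrite /arcsine_pdf (subset_itv_oo_cc xI).
Qed.

Lemma arcsine_pdf_out x : x \notin `](-2), 2[ -> arcsine_pdf x = 0.
Proof.
move=> xI; rewrite /arcsine_pdf; case: ifPn => // xJ.
rewrite (_ : 4 - x ^+ 2 = 0) ?sqrtr0 ?mulr0 ?invr0//.
move: xI xJ; rewrite !in_itv/= negb_and -!leNgt => + /andP[x1 x2].
by move=> /orP[] x3; have [->|->] : x = 2 \/ x = -2; try ring; [right|left]; lra.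
Qed.

Let sqrt4_gt0 (x : R) : x \in `](-2), 2[ -> 0 < Num.sqrt (4 - x ^+ 2).
Proof. by rewrite in_itv/= => /andP[x1 x2]; rewrite sqrtr_gt0; nra. Qed.

Let sqrt4_continuous : continuous (fun x : R => Num.sqrt (4 - x ^+ 2)).
Proof.
move=> x; apply: (@continuous_comp _ _ _ (fun x : R => 4 - x ^+ 2) Num.sqrt).
  by apply: continuousB; [exact: cst_continuous|exact: exprn_continuous].
exact: sqrt_continuous.
Qed.

Let arcsine_continuous (x : R) : x \in `](-2), 2[ ->
  {for x, continuous (fun x : R => (pi * Num.sqrt (4 - x ^+ 2))^-1)}.
Proof.
move=> xI; apply: continuousV.
  by rewrite mulf_neq0// gt_eqF// ?pi_gt0// sqrt4_gt0.
by apply: continuousM; [exact: cst_continuous|exact: sqrt4_continuous].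
Qed.

Lemma measurable_arcsine_pdf : measurable_fun setT arcsine_pdf.
Proof.
rewrite (_ : arcsine_pdf =
  (fun x : R => (pi * Num.sqrt (4 - x ^+ 2))^-1) \_ `](-2), 2[%classic); last first.
  apply/funext => x; rewrite patchE mem_setE.
  by case: ifPn => [/arcsine_pdfE|/arcsine_pdf_out].
apply/(measurable_restrictT _ _).1; first exact: measurable_itv.
apply: open_continuous_measurable_fun; first exact: interval_open.
by move=> x; rewrite mem_setE; exact: arcsine_continuous.
Qed.

Let is_derive_asin2 (x : R) : x \in `](-2), 2[ ->
  is_derive x 1 (fun y => asin (y / 2) / pi) ((pi * Num.sqrt (4 - x ^+ 2))^-1).
Proof.
move=> xI; have s0 := sqrt4_gt0 xI.
have x1 : -1 < x / 2 < 1 by move: xI; rewrite in_itv/= => /andP[? ?]; lra.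
have D1 := is_derive1_asin x1.
have D2 : is_derive x 1 (fun y : R => y / 2) 2^-1.
  rewrite (_ : (fun y => y / 2) = 2^-1 \*: (id : R -> R)); last first.
    by apply/funext => y /=; rewrite mulrC.
  by apply: is_derive_eq; rewrite /GRing.scale/= mulr1.
have D3 := @is_derive1_comp R (@asin R) (fun y : R => y / 2) x _ _ D1 D2.
rewrite (_ : (fun y => _) = pi^-1 \*: (@asin R \o (fun y : R => y / 2))); last first.
  by apply/funext => y /=; rewrite mulrC.
apply: is_derive_eq; rewrite /GRing.scale/= invfM; congr (_ * _).
rewrite -invfM; congr (_^-1).
rewrite -{2}(@ger0_norm _ 2)// -sqrtr_sqr -sqrtrM; last nra.
by congr Num.sqrt; field.
Qed.

Let asin2_continuous (x : R) : x \in `](-2), 2[ ->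
  {for x, continuous (fun y : R => asin (y / 2) / pi)}.
Proof.
move=> xI; apply: differentiable_continuous; apply/derivable1_diffP.
by case: (is_derive_asin2 xI).
Qed.

Let integral_arcsine_lt (a : R) : 0 < a < 2 ->
  (\int[lebesgue_measure]_(x in `[(- a)%R, a]) (arcsine_pdf x)%:E <= 1)%E.
Proof.
move=> /andP[a0 a2].
have aI x : x \in `[(- a), a] -> x \in `](-2), 2[.
  by rewrite !in_itv/= => /andP[? ?]; lra.
rewrite (eq_integral (fun x : measurableTypeR R => ((pi * Num.sqrt (4 - x ^+ 2))^-1)%:E)); last first.
  by move=> x; rewrite mem_setE => /aI /arcsine_pdfE ->.
rewrite (@continuous_FTC2 _ _ (fun y => asin (y / 2) / pi)) ?gtrN//.
- rewrite -EFinB lee_fin -mulrBl ler_pdivrMr ?pi_gt0// mul1r.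
  have : asin (a / 2) <= pi / 2 by apply: asin_lepi2; lra.
  have : - (pi / 2) <= asin (- a / 2) by apply: asin_geNpi2; lra.
  lra.
- apply: continuous_in_subspaceT => x; rewrite mem_setE => /aI.
  exact: arcsine_continuous.
- split.
  + move=> x /subset_itv_oo_cc /aI xI; by case: (is_derive_asin2 xI).
  + apply: cvg_at_right_filter; apply: asin2_continuous; apply: aI.
    by rewrite in_itv/= lexx/=; lra.
  + apply: cvg_at_left_filter; apply: asin2_continuous; apply: aI.
    by rewrite in_itv/= lexx/=; lra.
- move=> x /subset_itv_oo_cc /aI xI; rewrite derive1E.
  by have D := is_derive_asin2 xI; rewrite derive_val.
Qed.

Lemma integrable_arcsine_pdf :
  (@lebesgue_measure R).-integrable setT (EFin \o arcsine_pdf).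
Proof.
have mA : measurable_fun setT (EFin \o arcsine_pdf).
  by apply/measurable_EFinP; exact: measurable_arcsine_pdf.
apply/integrableP; split => //.
have -> : (\int[lebesgue_measure]_x `|(EFin \o arcsine_pdf) x| =
    \int[lebesgue_measure]_(x in `](-2)%R, 2%R[) (arcsine_pdf x)%:E)%E.
  rewrite [RHS]integral_mkcond; apply: eq_integral => x _.
  rewrite gee0_abs/= ?lee_fin ?arcsine_pdf_ge0// patchE mem_setE.
  by case: ifPn => [//|/arcsine_pdf_out ->].
pose a n : R := 2 - n.+1%:R^-1.
have a02 n : 0 < a n < 2.
  have n0 : 0 < n.+1%:R^-1 :> R by rewrite invr_gt0.
  have n1 : n.+1%:R^-1 <= 1 :> R by rewrite invf_le1// ler1n.
  by rewrite /a; move: n0 n1; set e := _^-1 => n0 n1; apply/andP; split; lra.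
pose F n := `[(- a n)%R, a n]%classic.
have ndF : {homo F : n m / (n <= m)%N >-> (n <= m)%O}.
  move=> n m nm; apply/subsetPset => x; rewrite /F/= !in_itv/=.
  have : a n <= a m.
    by rewrite /a lerD2l lerN2 lef_pV2 ?posrE// ler_nat.
  by move=> anm /andP[? ?]; lra.
have -> : `](-2), 2[%classic = \bigcup_n F n.
  apply/seteqP; split => x; last first.
    move=> [n _]; rewrite /F/= !in_itv/= => /andP[? ?].
    by have := a02 n => /andP[? ?]; lra.
  rewrite /= in_itv/= => /andP[x1 x2].
  have e0 : 0 < Num.min (2 - x) (x + 2) by rewrite lt_min; apply/andP; split; lra.
  have [n ne] : exists n, n.+1%:R^-1 < Num.min (2 - x) (x + 2).
    have [n _ /(_ n (leqnn n))/= h] := near_infty_natSinv_lt (PosNum e0).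
    by exists n.
  exists n => //; rewrite /F/= in_itv/= /a.
  move: ne; rewrite lt_min; set e := _^-1 => /andP[? ?].
  by apply/andP; split; lra.
have cF := @ge0_nondecreasing_set_cvg_integral _ (measurableTypeR R) R F (EFin \o arcsine_pdf)
  lebesgue_measure ndF.
apply: (@le_lt_trans _ _ 1%E); last exact: ltry.
apply: (@cvge_le _ \oo _ _ _ _ _ _ (cF _ _ _)).
- by apply: nearW => n; exact: integral_arcsine_lt.
- by move=> n; exact: measurable_itv.
- by move=> n; exact: measurable_funTS.
- by move=> n x _; rewrite lee_fin arcsine_pdf_ge0.
Qed.

Lemma integrable_quartic_arcsine_pdf (a b c : R) :
  (@lebesgue_measure R).-integrable setT
    (fun x : R => ((a * x ^+ 4 + b * x ^+ 2 + c) * arcsine_pdf x)%:E).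
Proof.
pose C : R := `|a| * 16 + `|b| * 4 + `|c|.
have C0 : 0 <= C by rewrite !addr_ge0 ?mulr_ge0.
apply: (@le_integrable _ (measurableTypeR R) _ _ _ _ _
  (fun x : measurableTypeR R => C%:E * (arcsine_pdf x)%:E)%E) => //.
- apply/measurable_EFinP; apply: measurable_funM; last first.
    exact: measurable_arcsine_pdf.
  apply: measurable_funD => //; apply: measurable_funD.
    by apply: measurable_funM => //; exact: exprn_measurable.
  by apply: measurable_funM => //; exact: exprn_measurable.
- move=> x _; rewrite -EFinM !abse_EFin lee_fin !normrM (ger0_norm C0).
  rewrite /arcsine_pdf; case: ifPn => [xI|_]; last by rewrite normr0 !mulr0.
  rewrite ler_wpM2r//; have x2 : x ^+ 2 <= 4.
    by move: xI; rewrite in_itv/= => /andP[? ?]; nra.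
  have x4 : x ^+ 4 <= 16.
    by rewrite (_ : x ^+ 4 = (x ^+ 2) ^+ 2) ?exprM//; have := sqr_ge0 x; nra.
  rewrite (le_trans (ler_normD _ _))// lerD// (le_trans (ler_normD _ _))//.
  by rewrite lerD// normrM ler_wpM2l// ger0_norm// exprn_even_ge0.
- by apply: integrableZl => //; exact: integrable_arcsine_pdf.
Qed.

End arcsine.

Section charge_integral.
Context d (T : measurableType d) (R : realType).
Variable nu : {charge set T -> \bar R}.

Let hahnP := projT1 (cid (Hahn_decomposition nu)).
Let hahnN := projT1 (cid (projT2 (cid (Hahn_decomposition nu)))).
Let hahnPN : hahn_decomposition nu hahnP hahnN :=
  projT2 (cid (projT2 (cid (Hahn_decomposition nu)))).

(* The integral of f against a signed measure, through its Jordan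
   decomposition.  The Hahn decomposition chosen is irrelevant: see
   Hahn_decomposition_uniq. *)
Definition charge_integral (f : T -> R) : \bar R :=
  (\int[jordan_pos hahnPN]_x (f x)%:E - \int[jordan_neg hahnPN]_x (f x)%:E)%E.

End charge_integral.

Section correction.
Context (R : realType).

Definition dirac_charge (a : R) : {charge set (measurableTypeR R) -> \bar R} :=
  charge_of_finite_measure (\d_(a : measurableTypeR R)).

Definition arcsine_charge : {charge set (measurableTypeR R) -> \bar R} :=
  induced_charge (@integrable_arcsine_pdf R).

(* The signed measure (a x^4 + b x^2 + c) 1_[-2, 2](x) dx / (pi sqrt(4 - x^2)). *)
Definition quartic_arcsine_charge (a b c : R) :
    {charge set (measurableTypeR R) -> \bar R} :=
  induced_charge (integrable_quartic_arcsine_pdf a b c).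

Definition nu (r : nat) (sigma s2 alpha : R) :
    {charge set (measurableTypeR R) -> \bar R} :=
  cadd
    (cscale (r%:R / 2)
      (cadd (cscale (1 / 2) (cadd (dirac_charge 2) (dirac_charge (-2))))
            (copp arcsine_charge)))
    (cscale (1 / 2)
      (quartic_arcsine_charge
        (alpha / sigma ^+ 4 - (2 + r%:R))
        (s2 / sigma ^+ 2 - 4 * (alpha / sigma ^+ 4) + 7 + 3 * r%:R)
        (2 * (alpha / sigma ^+ 4 - s2 / sigma ^+ 2 - 1)))).

End correction.

(* Main.v *)
From HB Require Import structures.
Require Import Defs.
From mathcomp Require Import all_boot all_order all_algebra finmap ring lra zify.
From mathcomp Require Import all_classical all_reals all_analysis.
From mathcomp Require Import measurable_realfun.
From mathcomp.real_closed Require Import complex.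
Import Order.TTheory GRing.Theory Num.Theory.
Import numFieldNormedType.Exports.
Local Open Scope classical_set_scope.
Local Open Scope ring_scope.
Set Implicit Arguments.
Unset Strict Implicit.
Unset Printing Implicit Defensive.


(** Fix a vertex i of an index set S and let h be the generating series, in a formal variable t, of
    the diagonal entries at i of the powers of the matrix. Cutting closed walks at their first
    return to i gives h = 1 + e h, where e collects the excursions ([loops_renewal]); this is the
    Schur complement formula for the resolvent, read as an identity of formal power series. The
    coefficient of t in e is the diagonal entry at i, and that of t^(j+2) is a quadratic form in the
    row of i whose matrix is the j-th power of the matrix with i removed. It splits into the
    normalised trace [tau] of that power and a fluctuation [fluct], which is orthogonal to every
    polynomial in the entries of the smaller matrix ([exc_fluct], [Ec_fluct0]).

    Let c be the series with c = 1 + t^2 c^2, whose coefficients are the semicircle moments, and put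
    d = e - t^2 c ([excess]). Then h = c + c d h, and iteration gives h = c + c^2 d + c^3 d^2 + c^3
    d^3 h ([hloops_expand3]). The series d is of order N^(-1/2) in every L^p, so the last term is
    O(N^(-3/2)). The mean of d is t^2 times the bias of the normalised trace with one vertex less.
    The mean of d^2 is found at order 1/N from the second and fourth moments of the entries
    ([Ob_excess_cov]); here sigma, s2, alpha and r come in. Averaging over i yields a recursion for
    the coefficient of 1/N in the mean trace ([Ob_mean]). It is run for all submatrices with N - e
    vertices and unchanged normalisation N, because removing i raises e by one.

    The size estimates rest on a Burkholder-type inequality ([bdd_chain]): N martingale increments
    bounded in all L^p have a sum of order sqrt N in all L^p. Revealing a row entry by entry makes
    [fluct] such a sum. A joint induction on the length bounds the diagonal entries of powers by
    O(1) and the others by O(N^(-1/2)) ([walks_ok]); normalised traces then concentrate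
    ([trace_ok_all]), and their covariances are O(N^(-3/2)), hence negligible ([Ob_Ec_utau2]).

    The recursion is solved with A = (1 - 4 t^2)^(-1/2), the generating series of the arcsine
    moments, in terms of which both c and the moments of nu are written: [correction_eq] is the
    recursion for the moments of nu, and [correction_family] extends the solution to all e. On the
    analytic side, the arcsine moments come from integrating the derivative of x^(k+1) sqrt(4 - x^2)
    ([arcsine_moment]); the semicircle law and nu are made of atoms and polynomial multiples of the
    arcsine density ([semicircle_moment], [charge_integral_nu]), and the total mass of nu is
    computed from the arcsine moments of order 0, 2 and 4. Finally the spectral theorem identifies
    m_k(n) with a mean normalised trace ([mean_moment_tau]), and an error O(n^(-3/2)) is o(1/n)
    ([littleo_inv]). *)

(** * Independence and expectations of products *)

Section product_rule.
Context d (T : measurableType d) (R : realType) (P : probability T R).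
Context d' (T' : measurableType d').
Import HBNNSimple.

(** Linearity passes from indicators to simple functions of [X], and monotone convergence to all
    non-negative functions. In the application [H] is the product of the other factors and [K] the
    product of their integrals. *)
Lemma ge0_integral_comp_mul (X : T -> T') (H : T -> R) (K : \bar R) :
  measurable_fun setT X -> measurable_fun setT H -> (forall w, 0 <= H w) ->
  (0 <= K)%E -> K \is a fin_num ->
  (forall B, measurable B ->
     (\int[P]_w (\1_B (X w) * H w)%:E = P (X @^-1` B) * K)%E) ->
  forall g : T' -> R, measurable_fun setT g -> (forall y, 0 <= g y) ->
    (\int[P]_w (g (X w) * H w)%:E = \int[P]_w (g (X w))%:E * K)%E.
Proof.
move=> mX mH H0 K0 Kfin HB.
have mpre B : measurable B -> measurable (X @^-1` B).
  by move=> mB; rewrite -[X in measurable X]setTI; exact: mX.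
have indic_comp B : (fun w => \1_B (X w)) = \1_(X @^-1` B) :> (T -> R).
  by apply/funext => w; rewrite !indicE.
have snn (s : {nnsfun T' >-> R}) :
    (\int[P]_w (s (X w) * H w)%:E = \int[P]_w (s (X w))%:E * K)%E.
  have sE y : (s y)%:E = (\sum_(r \in range s) (r * \1_(s @^-1` [set r]) y)%:E)%E.
    by rewrite fimfunE -fsumEFin.
  have mB r : measurable (s @^-1` [set r]) by [].
  have m1 r : measurable_fun setT (fun w => \1_(s @^-1` [set r]) (X w) : R).
    by rewrite indic_comp; apply: measurable_indic; exact: mpre.
  have r0 r w : (0 <= (r * \1_(s @^-1` [set r]) (X w))%:E)%E.
    have := nnfun_muleindic_ge0 s r (X w); by rewrite -EFinM.
  have sP r w : 0 <= (r * \1_(s @^-1` [set r]) (X w)) by have := r0 r w; rewrite lee_fin.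
  transitivity (\int[P]_w (\sum_(r \in range s) ((r * \1_(s @^-1` [set r]) (X w))%:E * (H w)%:E)))%E.
    apply: eq_integral => w _; rewrite EFinM sE.
    rewrite [LHS]muleC ge0_mule_fsumr; last by move=> r; apply: r0.
    by apply: eq_fsbigr => r _; rewrite muleC.
  rewrite ge0_integral_fsum//; last 2 first.
  - move=> r; apply: emeasurable_funM; last exact/measurable_EFinP.
    by apply/measurable_EFinP; apply: measurable_funM => //; exact: m1.
  - by move=> r w _; rewrite mule_ge0// lee_fin.
  under [in RHS]eq_integral do rewrite sE.
  rewrite ge0_integral_fsum//; last first.
    by move=> r; apply/measurable_EFinP; apply: measurable_funM => //; exact: m1.
  rewrite muleC ge0_mule_fsumr; last by move=> r; apply: integral_ge0.
  apply: eq_fsbigr => r _.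
  have [r_ge0|r_lt0] := leP 0 r; last first.
    have -> : s @^-1` [set r] = set0 by exact: preimage_nnfun0.
    by rewrite !integral0_eq ?mule0// => w _; rewrite indicE in_set0 mulr0 ?mul0e.
  under eq_integral do rewrite -EFinM -mulrA EFinM.
  rewrite ge0_integralZl//; last 2 first.
  - by apply/measurable_EFinP; apply: measurable_funM => //; exact: m1.
  - by move=> w _; rewrite lee_fin mulr_ge0.
  rewrite HB//; under [in RHS]eq_integral do rewrite EFinM.
  rewrite ge0_integralZl//; last by apply/measurable_EFinP; exact: m1.
  have -> : (\int[P]_x (\1_(s @^-1` [set r]) (X x))%:E = P (X @^-1` (s @^-1` [set r])))%E.
    have := @integral_indic _ _ _ P setT measurableT (X @^-1` (s @^-1` [set r])) (mpre _ (mB r)).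
    by rewrite setIT => <-; apply: eq_integral => w _; rewrite !indicE.
  by rewrite [RHS]muleC muleA.
move=> g mg g0.
have mgE : measurable_fun setT (EFin \o g) by apply/measurable_EFinP.
pose s_ := nnsfun_approx measurableT mgE.
have sg y : EFin \o s_^~ y @ \oo --> (g y)%:E by apply: cvg_nnsfun_approx => // z _; rewrite lee_fin.
have nd := @nd_nnsfun_approx _ _ _ _ measurableT _ mgE.
have ms n : measurable_fun setT (fun w => s_ n (X w)).
  by apply: (measurableT_comp (f := s_ n)).
transitivity (limn (fun n => \int[P]_w (s_ n (X w) * H w)%:E)%E).
  rewrite -monotone_convergence//=.
  - apply: eq_integral => w _; apply/esym/cvg_lim => //=.
    rewrite EFinM; under eq_fun do rewrite EFinM.
    by apply: cvgeZr => //; exact: sg.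
  - by move=> n; apply/measurable_EFinP; apply: measurable_funM.
  - by move=> n w _; rewrite lee_fin mulr_ge0.
  - by move=> w _ a b ab; rewrite lee_fin ler_wpM2r//; exact/lefP/nd.
rewrite (_ : (\int[P]_w (g (X w))%:E)%E = limn (fun n => \int[P]_w (s_ n (X w))%:E)%E); last first.
  rewrite -monotone_convergence//=.
  - by apply: eq_integral => w _; apply/esym/cvg_lim => //=; exact: sg.
  - by move=> n; apply/measurable_EFinP.
  - by move=> n w _; rewrite lee_fin.
  - by move=> w _ a b ab; rewrite lee_fin//; exact/lefP/nd.
rewrite muleC -limeMl//.
- by congr (limn _); apply/funext => n /=; rewrite snn muleC.
- apply/ereal_nondecreasing_is_cvgn => a b ab; apply: ge0_le_integral => //.
  + by move=> w _; rewrite lee_fin.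
  + by apply/measurable_EFinP.
  + by apply/measurable_EFinP.
  + by move=> w _; rewrite lee_fin; exact/lefP/nd.
Qed.

End product_rule.

Section independent_products.
Context d (T : measurableType d) (R : realType) (P : probability T R).
Context d' (T' : measurableType d') (I : choiceType) (D : set I).
Context (X : I -> T -> T') (indX : mutually_independent P D X).
Context (mX : forall i, measurable_fun setT (X i)).

Lemma measurable_prod_comp (l : seq I) (f : I -> T' -> R) :
  (forall i, measurable_fun setT (f i)) ->
  measurable_fun setT (fun w => \prod_(i <- l) f i (X i w)).
Proof.
move=> mf; elim: l => [|i l IH].
  by rewrite (_ : (fun _ => _) = cst 1)//; apply/funext => w; rewrite big_nil.
rewrite (_ : (fun _ => _) = (fun w => f i (X i w) * \prod_(j <- l) f j (X j w))).
  by apply: measurable_funM => //; exact: measurableT_comp.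
by apply/funext => w; rewrite big_cons.
Qed.

(** Factors are freed one at a time. [l2] holds those that are still indicators, and for empty [l1]
    the claim is the definition of independence. By [ge0_integral_comp_mul] the head of [l1] may be
    taken to be an indicator, hence moved to [l2]. *)
Lemma indep_prod_ge0 (l1 l2 : seq I) (f : I -> T' -> R) (B : I -> set T') :
  uniq (l1 ++ l2) -> (forall i, i \in l1 ++ l2 -> D i) ->
  (forall i, measurable_fun setT (f i)) -> (forall i y, 0 <= f i y) ->
  (forall i, i \in l1 -> (\int[P]_w (f i (X i w))%:E)%E \is a fin_num) ->
  (forall i, i \in l2 -> measurable (B i) /\ f i = \1_(B i)) ->
  (\int[P]_w (\prod_(i <- l1 ++ l2) f i (X i w))%:E)%E =
   (\prod_(i <- l1 ++ l2) fine (\int[P]_w (f i (X i w))%:E)%E)%:E.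
Proof.
have mpre i A : measurable A -> measurable (X i @^-1` A).
  by move=> mA; rewrite -[X in measurable X]setTI; exact: mX.
elim: l1 l2 f B => [|i l1 IH] l2 f B /= ul Dl mf f0 ffin fB.
  pose J := [fset j in l2]%fset.
  have uJ : perm_eq l2 J.
    by apply: uniq_perm => // j; rewrite in_fset.
  have := indX (J := J) (B := B).
  rewrite -(perm_big _ uJ)/=.
  have h1 j : j \in J -> D j by rewrite in_fset/= => /Dl.
  have h2 j : j \in J -> measurable (B j) by rewrite in_fset/= => /fB[].
  move=> /(_ h1 h2) h.
  have E1 : \prod_(j <- l2) fine (\int[P]_w (f j (X j w))%:E)%E =
             \prod_(j <- l2) fine (P (X j @^-1` B j)).
    rewrite !big_seq; apply: eq_bigr => j /fB[mBj ->]; congr fine.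
    have := @integral_indic _ _ _ P setT measurableT _ (mpre j _ mBj).
    by rewrite setIT => <-; apply: eq_integral => w _; rewrite !indicE.
  rewrite E1 -h.
  have mC : measurable (\bigcap_(j in [set` J]) (X j @^-1` B j)).
    by apply: fin_bigcap_measurable => // j /h2 mBj; exact: mpre.
  have := @integral_indic _ _ _ P setT measurableT _ mC; rewrite setIT => <-.
  apply: eq_integral => w _; congr EFin; rewrite indicE.
  have [win|wout] := boolP (w \in _).
    rewrite big_seq big1// => j jl; have [_ ->] := fB _ jl; rewrite indicE.
    by rewrite mem_set//; move: win; rewrite inE => /(_ j); apply; rewrite /= in_fset.
  have [j jl Bj] : exists2 j, j \in l2 & ~ B j (X j w).
    apply/not_exists2P => hh; move/negP: wout; apply; rewrite inE => j/=.
    by rewrite in_fset/= => jl; have := hh j; case=> // /contrapT.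
  rewrite (perm_big _ (perm_to_rem jl)) big_cons /=.
  by have [_ ->] := fB _ jl; rewrite indicE (memNset Bj) mulr0n mul0r.
move: ul => /andP[il ul].
pose H w := \prod_(j <- l1 ++ l2) f j (X j w).
have HE w : \prod_(j <- i :: l1 ++ l2) f j (X j w) = f i (X i w) * H w.
  by rewrite big_cons.
rewrite [RHS](_ : _ = (fine (\int[P]_w (f i (X i w))%:E)%E)%:E *
   (\prod_(j <- l1 ++ l2) fine (\int[P]_w (f j (X j w))%:E)%E)%:E)%E; last first.
  by rewrite big_cons EFinM.
rewrite fineK; last by apply: ffin; rewrite mem_head.
under eq_integral do rewrite HE.
apply: (ge0_integral_comp_mul (X := X i)) => //.
- exact: measurable_prod_comp.
- by move=> w; rewrite /H prodr_ge0.
- by rewrite lee_fin prodr_ge0// => j _; rewrite fine_ge0// integral_ge0// => w _; rewrite lee_fin.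
move=> A mA.
(* The factor at [i] is replaced by the indicator of [A], so that the induction hypothesis applies
   with [i] in the second list. *)
pose f' j := if j == i then \1_A else f j.
pose B' j := if j == i then A else B j.
have pe : perm_eq (l1 ++ i :: l2) (i :: l1 ++ l2) by rewrite -cat1s perm_catCA.
have ne j : j \in l1 ++ l2 -> (j == i) = false.
  by move=> jl; apply: contraNF il => /eqP <-.
have := IH (i :: l2) f' B'.
rewrite (perm_uniq pe) /= il ul => /(_ isT).
have h1 j : j \in l1 ++ i :: l2 -> D j by rewrite (perm_mem pe) => /Dl.
have h2 j : measurable_fun setT (f' j).
  by rewrite /f'; case: ifP => // _; exact: measurable_indic.
have h3 j y : 0 <= f' j y by rewrite /f'; case: ifP => // _; rewrite indicE.
have h4 j : j \in l1 -> (\int[P]_w (f' j (X j w))%:E)%E \is a fin_num.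
  by move=> jl; rewrite /f' ne ?mem_cat ?jl//; apply: ffin; rewrite inE jl orbT.
have h5 j : j \in i :: l2 -> measurable (B' j) /\ f' j = \1_(B' j).
  rewrite /f' /B' inE; case: ifP => //= ji /fB [//].
move=> /(_ h1 h2 h3 h4 h5).
rewrite (perm_big _ pe)/= big_cons EFinM.
under eq_integral do rewrite (perm_big _ pe)/= big_cons.
rewrite /f' eqxx.
under eq_integral => w _.
  rewrite big_seq (eq_bigr (fun j => f j (X j w))); last by move=> j jl; rewrite ne.
  rewrite -big_seq; over.
move=> ->; congr (_ * _)%E.
  have PE : (\int[P]_w (\1_A (X i w))%:E = P (X i @^-1` A))%E.
    have := @integral_indic _ _ _ P setT measurableT _ (mpre i _ mA).
    by rewrite setIT => <-; apply: eq_integral => w _; rewrite !indicE.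
  rewrite fineK ?PE// fin_num_measure//; exact: mpre.
congr EFin; rewrite big_seq [RHS]big_seq; apply: eq_bigr => j jl.
by congr fine; apply: eq_integral => w _; rewrite ne.
Qed.

End independent_products.

Section independent_products.
Context d (T : measurableType d) (R : realType) (P : probability T R).
Context d' (T' : measurableType d') (I : choiceType) (D : set I).
Context (X : I -> T -> T') (indX : mutually_independent P D X).
Context (mX : forall i, measurable_fun setT (X i)).
Let int_ (f : T -> R) := P.-integrable setT (EFin \o f).

(** The product formula for the absolute values has a finite right-hand side. *)
Lemma integrable_prod_comp (l : seq I) (f : I -> T' -> R) :
  uniq l -> (forall i, i \in l -> D i) ->
  (forall i, measurable_fun setT (f i)) ->
  (forall i, i \in l -> int_ (fun w => f i (X i w))) ->
  int_ (fun w => \prod_(i <- l) f i (X i w)).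
Proof.
move=> ul Dl mf If; apply/integrableP; split.
  by apply/measurable_EFinP; exact: measurable_prod_comp.
have H := @indep_prod_ge0 _ _ _ P _ _ _ _ _ indX mX l [::] (fun i y => `|f i y|) (fun _ => set0).
rewrite cats0 in H.
rewrite (_ : (\int[P]_x _)%E = (\int[P]_w (\prod_(i <- l) `|f i (X i w)|)%:E)%E); last first.
  by apply: eq_integral => w _; rewrite /= normr_prod.
rewrite H ?ltry//.
- by move=> i; exact: measurableT_comp.
- move=> i il; rewrite ge0_fin_numE; last by apply: integral_ge0 => w _; rewrite lee_fin.
  by have /integrableP[_] := If _ il.
Qed.

(** The same induction, one level up: [l2] now holds the factors known to be non-negative, and the
    head of [l1] is split into its positive and negative parts. *)
Lemma indep_prod (l1 l2 : seq I) (f : I -> T' -> R) :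
  uniq (l1 ++ l2) -> (forall i, i \in l1 ++ l2 -> D i) ->
  (forall i, measurable_fun setT (f i)) ->
  (forall i, i \in l1 ++ l2 -> int_ (fun w => f i (X i w))) ->
  (forall i y, i \in l2 -> 0 <= f i y) ->
  \int[P]_w (\prod_(i <- l1 ++ l2) f i (X i w)) =
  \prod_(i <- l1 ++ l2) \int[P]_w (f i (X i w)).
Proof.
elim: l1 l2 f => [|i l1 IH] l2 f /= ul Dl mf If f0.
  (* [indep_prod_ge0] asks for non-negativity at every index, so the family is set to 0 outside
     [l2]. *)
  pose g i y := if i \in l2 then f i y else 0.
  have gf i y : i \in l2 -> g i y = f i y by rewrite /g => ->.
  have H := @indep_prod_ge0 _ _ _ P _ _ _ _ _ indX mX l2 [::] g (fun _ => set0).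
  rewrite cats0 in H.
  transitivity (fine (\int[P]_w (\prod_(i <- l2) g i (X i w))%:E)%E).
    congr fine; apply: eq_integral => w _; congr EFin.
    by rewrite big_seq [RHS]big_seq; apply: eq_bigr => i il; rewrite gf.
  rewrite H//=.
  - rewrite big_seq [RHS]big_seq; apply: eq_bigr => i il.
    by congr fine; apply: eq_integral => w _; rewrite gf.
  - by move=> i; rewrite /g; case: (i \in l2) => //; exact: measurable_cst.
  - by move=> i y; rewrite /g; case: ifP => // /f0.
  - move=> i il; rewrite (eq_integral (fun w => (f i (X i w))%:E)); last by move=> w _; rewrite gf.
    exact: (integrable_fin_num measurableT (If i il)).
pose fp j y := if j == i then Num.max (f j y) 0 else f j y.
pose fm j y := if j == i then Num.max (- f j y) 0 else f j y.
have fmn j : j != i -> fm j = f j by move=> /negbTE ji; apply/funext => y; rewrite /fm ji.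
move: (ul) => /andP[il ul'].
have pe : perm_eq (l1 ++ i :: l2) (i :: l1 ++ l2) by rewrite -cat1s perm_catCA.
have ne j : j \in l1 ++ l2 -> (j == i) = false.
  by move=> jl; apply: contraNF il => /eqP <-.
have mfp j : measurable_fun setT (fp j).
  by rewrite /fp; case: (j == i) => //; exact: measurable_funrpos.
have mfm j : measurable_fun setT (fm j).
  by rewrite /fm; case: (j == i) => //; exact: measurable_funrneg.
have domi (g : I -> T' -> R) j : j \in i :: l1 ++ l2 ->
    (forall j, measurable_fun setT (g j)) ->
    (forall y, `|g j y| <= `|f j y|) -> int_ (fun w => g j (X j w)).
  move=> jl mg gf; apply: le_integrable (If j jl) => //.
    by apply/measurable_EFinP; exact: measurableT_comp.
  by move=> w _; rewrite /= lee_fin.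
have fpf j y : `|fp j y| <= `|f j y|.
  rewrite /fp; case: ifP => // _; rewrite /Num.max; case: ifP => // _.
  by rewrite normr0.
have fmf j y : `|fm j y| <= `|f j y|.
  rewrite /fm; case: ifP => // _; rewrite /Num.max; case: ifP => // _.
    by rewrite normr0.
  by rewrite normrN.
have fE y : f i y = fp i y - fm i y.
  rewrite /fp /fm eqxx /Num.max oppr_lt0; case: ltgtP => [h|h|->]; lra.
(* A non-negative head factor joins [l2], where the induction hypothesis handles it; this is used
   with both [fp] and [fm]. *)
have step (g : I -> T' -> R) : (forall j, measurable_fun setT (g j)) ->
    (forall j y, `|g j y| <= `|f j y|) -> (forall y, 0 <= g i y) ->
    (forall j, j != i -> g j = f j) ->
    int_ (fun w => g i (X i w) * \prod_(j <- l1 ++ l2) f j (X j w)) /\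
    \int[P]_w (g i (X i w) * \prod_(j <- l1 ++ l2) f j (X j w)) =
    (\int[P]_w g i (X i w)) * \prod_(j <- l1 ++ l2) \int[P]_w f j (X j w).
  move=> mg gf g0 gne.
  have Ig j : j \in i :: l1 ++ l2 -> int_ (fun w => g j (X j w)).
    by move=> jl; exact: domi.
  have E w : \prod_(j <- i :: l1 ++ l2) g j (X j w) =
      g i (X i w) * \prod_(j <- l1 ++ l2) f j (X j w).
    rewrite big_cons; congr (_ * _); rewrite big_seq [RHS]big_seq.
    by apply: eq_bigr => j jl; rewrite gne ?ne.
  split.
    have := @integrable_prod_comp (i :: l1 ++ l2) g ul Dl mg Ig.
    by congr (P.-integrable _ _); apply/funext => w /=; rewrite E.
  have h1 : uniq (l1 ++ i :: l2) by rewrite (perm_uniq pe).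
  have h2 j : j \in l1 ++ i :: l2 -> D j by rewrite (perm_mem pe) => /Dl.
  have h3 j : j \in l1 ++ i :: l2 -> int_ (fun w => g j (X j w)).
    by rewrite (perm_mem pe); exact: Ig.
  have h4 j y : j \in i :: l2 -> 0 <= g j y.
    rewrite inE; case: (eqVneq j i) => [-> _|ji /= jl]; first exact: g0.
    by rewrite gne//; exact: f0.
  have := IH (i :: l2) g h1 h2 mg h3 h4.
  rewrite (perm_big _ pe)/= big_cons.
  under [X in fine X = _ -> _]eq_integral do rewrite (perm_big _ pe)/= E.
  move=> H; rewrite [LHS]H; congr (_ * _); rewrite big_seq [RHS]big_seq.
  by apply: eq_bigr => j jl; rewrite gne ?ne.
have fp0 y : 0 <= fp i y by rewrite /fp eqxx le_max lexx orbT.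
have fm0 y : 0 <= fm i y by rewrite /fm eqxx le_max lexx orbT.
have fpn j : j != i -> fp j = f j by move=> /negbTE ji; apply/funext => y; rewrite /fp ji.
have [Ip Ep] := step fp mfp fpf fp0 fpn.
have [Im Em] := step fm mfm fmf fm0 fmn.
rewrite big_cons.
transitivity (\int[P]_w (fp i (X i w) * \prod_(j <- l1 ++ l2) f j (X j w) -
                         fm i (X i w) * \prod_(j <- l1 ++ l2) f j (X j w))).
  by congr fine; apply: eq_integral => w _; rewrite big_cons fE mulrBl.
rewrite RintegralB// Ep Em -mulrBl; congr (_ * _).
rewrite -RintegralB//; last 2 first.
- by apply: domi => //; rewrite mem_head.
- by apply: domi => //; rewrite mem_head.
by congr fine; apply: eq_integral => w _; rewrite fE.
Qed.

End independent_products.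

Lemma ReM (R : rcfType) (x y : R[i]) :
  complex.Re (x * y) = complex.Re x * complex.Re y - complex.Im x * complex.Im y.
Proof. by case: x; case: y. Qed.

Lemma ImM (R : rcfType) (x y : R[i]) :
  complex.Im (x * y) = complex.Re x * complex.Im y + complex.Im x * complex.Re y.
Proof. by case: x; case: y. Qed.

Lemma ReD (R : rcfType) (x y : R[i]) :
  complex.Re (x + y) = complex.Re x + complex.Re y.
Proof. by case: x; case: y. Qed.

Lemma ImD (R : rcfType) (x y : R[i]) :
  complex.Im (x + y) = complex.Im x + complex.Im y.
Proof. by case: x; case: y. Qed.

Lemma complex_ext (R : rcfType) (x y : R[i]) :
  complex.Re x = complex.Re y -> complex.Im x = complex.Im y -> x = y.
Proof. by case: x => a b; case: y => c e /= -> ->. Qed.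

Section complex_integrable.
Context d (T : measurableType d) (R : realType) (P : probability T R).
Local Notation C := R[i].
Local Notation int_ f := (P.-integrable setT (EFin \o f)).

Definition cintegrable (f : T -> C) :=
  int_ (fun w => complex.Re (f w)) /\ int_ (fun w => complex.Im (f w)).

Local Notation Ec := (complex_expectation P).

Lemma complex_expectationE (f : T -> C) :
  Ec f = Complex (\int[P]_w complex.Re (f w)) (\int[P]_w complex.Im (f w)).
Proof. by rewrite /complex_expectation unlock. Qed.

Lemma eq_int (f g : T -> R) : f =1 g -> int_ f -> int_ g.
Proof. by move=> fg; congr (P.-integrable _ _); apply/funext => w /=; rewrite fg. Qed.

Lemma intD (f g : T -> R) : int_ f -> int_ g -> int_ (fun w => f w + g w).
Proof.
move=> If Ig; have := integrableD measurableT If Ig.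
by congr (P.-integrable _ _); apply/funext => w.
Qed.

Lemma intZ (a : R) (f : T -> R) : int_ f -> int_ (fun w => a * f w).
Proof.
move=> If; have := integrableZl measurableT a If.
by congr (P.-integrable _ _); apply/funext => w.
Qed.

Lemma cintegrableD (f g : T -> C) : cintegrable f -> cintegrable g ->
  cintegrable (fun w => f w + g w).
Proof.
move=> [fR fI] [gR gI]; split.
  by apply: eq_int (intD fR gR) => w; rewrite ReD.
by apply: eq_int (intD fI gI) => w; rewrite ImD.
Qed.

Lemma cintegrableZ (a : C) (f : T -> C) : cintegrable f ->
  cintegrable (fun w => a * f w).
Proof.
move=> [fR fI]; split.
  apply: eq_int (intD (intZ (complex.Re a) fR) (intZ (- complex.Im a) fI)) => w.
  by rewrite ReM mulNr.
apply: eq_int (intD (intZ (complex.Re a) fI) (intZ (complex.Im a) fR)) => w.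
by rewrite ImM.
Qed.

Lemma cintegrable_cst (a : C) : cintegrable (fun _ => a).
Proof. by split; apply/finite_measure_integrable_cst. Qed.

Lemma complex_expectation_cst (a : C) : Ec (fun _ => a) = a.
Proof.
have PT : fine (P setT) = 1 by rewrite probability_setT.
by rewrite complex_expectationE !Rintegral_cst//; case: a => a b /=; rewrite PT !mulr1.
Qed.

Lemma complex_expectationD (f g : T -> C) : cintegrable f -> cintegrable g ->
  Ec (fun w => f w + g w) = Ec f + Ec g.
Proof.
move=> [fR fI] [gR gI]; rewrite !complex_expectationE; apply: complex_ext => /=.
  by under eq_Rintegral do rewrite ReD; rewrite RintegralD.
by under eq_Rintegral do rewrite ImD; rewrite RintegralD.
Qed.

Lemma complex_expectationZ (a : C) (f : T -> C) : cintegrable f ->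
  Ec (fun w => a * f w) = a * Ec f.
Proof.
move=> [fR fI]; rewrite !complex_expectationE; apply: complex_ext; rewrite ?ReM ?ImM/=.
  under eq_Rintegral do rewrite ReM -mulNr.
  by rewrite RintegralD//; [rewrite !RintegralZl// mulNr | exact: intZ | exact: intZ].
under eq_Rintegral do rewrite ImM.
by rewrite RintegralD//; [rewrite !RintegralZl// | exact: intZ | exact: intZ].
Qed.

Lemma cintegrable_real (f : T -> R) : int_ f -> cintegrable (fun w => (f w)%:C%C).
Proof.
move=> If; split => //.
have := cintegrable_cst 0 => -[_]; exact: eq_int.
Qed.

Lemma complex_expectation_real (f : T -> R) :
  Ec (fun w => (f w)%:C%C) = (\int[P]_w f w)%:C%C.
Proof.
rewrite complex_expectationE; apply: complex_ext => //=.
by rewrite Rintegral_cst// mul0r.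
Qed.

Context d' (T' : measurableType d') (I : choiceType) (D : set I).
Context (X : I -> T -> T') (indX : mutually_independent P D X).
Context (mX : forall i, measurable_fun setT (X i)).

Definition cmeasurable (g : T' -> C) :=
  measurable_fun setT (fun y => complex.Re (g y)) /\
  measurable_fun setT (fun y => complex.Im (g y)).

(** Again the same induction: [l2] holds the real-valued factors, and the head of [l1] is its real
    part plus i times its imaginary part. *)
Lemma complex_indep_prod (l1 l2 : seq I) (g : I -> T' -> C) :
  uniq (l1 ++ l2) -> (forall i, i \in l1 ++ l2 -> D i) ->
  (forall i, cmeasurable (g i)) ->
  (forall i, i \in l1 ++ l2 -> cintegrable (fun w => g i (X i w))) ->
  (forall i y, i \in l2 -> complex.Im (g i y) = 0) ->
  cintegrable (fun w => \prod_(i <- l1 ++ l2) g i (X i w)) /\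
  Ec (fun w => \prod_(i <- l1 ++ l2) g i (X i w)) =
  \prod_(i <- l1 ++ l2) Ec (fun w => g i (X i w)).
Proof.
elim: l1 l2 g => [|i l1 IH] l2 g /= ul Dl mg Ig gI.
  have gE i y : i \in l2 -> g i y = (complex.Re (g i y))%:C%C.
    by move=> il; apply: complex_ext => //=; exact: gI.
  have E : (fun w => \prod_(i <- l2) g i (X i w)) =
           (fun w => (\prod_(i <- l2) complex.Re (g i (X i w)))%:C%C).
    apply/funext => w; rewrite rmorph_prod/= big_seq [RHS]big_seq.
    by apply: eq_bigr => i /gE ->.
  rewrite E; split.
    apply: cintegrable_real.
    apply: (integrable_prod_comp indX mX (f := fun i y => complex.Re (g i y))) => //.
      by move=> i; have [] := mg i.
    by move=> i /Ig[].
  rewrite complex_expectation_real.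
  have := indep_prod indX mX (l1 := l2) (l2 := [::]) (f := fun i y => complex.Re (g i y)).
  rewrite cats0 => -> //; last 2 first.
  - by move=> i; have [] := mg i.
  - by move=> i /Ig[].
  rewrite rmorph_prod/= big_seq [RHS]big_seq; apply: eq_bigr => i il.
  rewrite -complex_expectation_real; congr (Ec _); apply/funext => w.
  by rewrite [RHS]gE.
pose gr j y := if j == i then (complex.Re (g i y))%:C%C else g j y.
pose gi j y := if j == i then (complex.Im (g i y))%:C%C else g j y.
move: (ul) => /andP[il ul'].
have pe : perm_eq (l1 ++ i :: l2) (i :: l1 ++ l2) by rewrite -cat1s perm_catCA.
have ne j : j \in l1 ++ l2 -> (j == i) = false.
  by move=> jl; apply: contraNF il => /eqP <-.
have [iR iI] := Ig i (mem_head _ _).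
have step (h : T' -> R) : measurable_fun setT h -> int_ (fun w => h (X i w)) ->
    cintegrable (fun w => (h (X i w))%:C%C * \prod_(j <- l1 ++ l2) g j (X j w)) /\
    Ec (fun w => (h (X i w))%:C%C * \prod_(j <- l1 ++ l2) g j (X j w)) =
    Ec (fun w => (h (X i w))%:C%C) * \prod_(j <- l1 ++ l2) Ec (fun w => g j (X j w)).
  move=> mh Ih.
  pose g' j y := if j == i then (h y)%:C%C else g j y.
  have E w : \prod_(j <- l1 ++ i :: l2) g' j (X j w) =
      (h (X i w))%:C%C * \prod_(j <- l1 ++ l2) g j (X j w).
    rewrite (perm_big _ pe)/= big_cons /g' eqxx; congr (_ * _).
    rewrite big_seq [RHS]big_seq; by apply: eq_bigr => j jl; rewrite ne.
  have h1 : uniq (l1 ++ i :: l2) by rewrite (perm_uniq pe).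
  have h2 j : j \in l1 ++ i :: l2 -> D j by rewrite (perm_mem pe) => /Dl.
  have h3 j : cmeasurable (g' j).
    rewrite /g'; case: (j == i); last exact: mg.
    by split => //=; exact: measurable_cst.
  have h4 j : j \in l1 ++ i :: l2 -> cintegrable (fun w => g' j (X j w)).
    rewrite (perm_mem pe) /g' inE; case: (eqVneq j i) => [-> _|ji /= jl].
      exact: cintegrable_real.
    by apply: Ig; rewrite inE jl orbT.
  have h5 j y : j \in i :: l2 -> complex.Im (g' j y) = 0.
    rewrite inE /g'; case: (eqVneq j i) => // ji /= jl; exact: gI.
  have [A B] := IH (i :: l2) g' h1 h2 h3 h4 h5.
  have FE : (fun w => \prod_(j <- l1 ++ i :: l2) g' j (X j w)) =
    (fun w => (h (X i w))%:C%C * \prod_(j <- l1 ++ l2) g j (X j w)).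
    exact/funext.
  rewrite -FE; split => //; rewrite B (perm_big _ pe)/= big_cons {1}/g' eqxx.
  congr (_ * _); rewrite big_seq [RHS]big_seq.
  by apply: eq_bigr => j jl; rewrite /g' ne.
have [mR mI] := mg i.
have [cR eR] := step _ mR iR.
have [cI eI] := step _ mI iI.
have FE : (fun w => \prod_(j <- i :: l1 ++ l2) g j (X j w)) =
  (fun w => (complex.Re (g i (X i w)))%:C%C * \prod_(j <- l1 ++ l2) g j (X j w) +
            'i%C * ((complex.Im (g i (X i w)))%:C%C * \prod_(j <- l1 ++ l2) g j (X j w))).
  by apply/funext => w; rewrite big_cons mulrA -mulrDl -complexE.
rewrite FE; split.
  by apply: cintegrableD => //; exact: cintegrableZ.
rewrite complex_expectationD//; last exact: cintegrableZ.
rewrite complex_expectationZ// eR eI mulrA -mulrDl big_cons; congr (_ * _).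
rewrite -complex_expectationZ; last exact: cintegrable_real.
rewrite -complex_expectationD; last 2 first.
- exact: cintegrable_real.
- exact/cintegrableZ/cintegrable_real.
by congr (Ec _); apply/funext => w; rewrite -complexE.
Qed.

End complex_integrable.

(** * Monomials and polynomials in the matrix entries *)

Lemma normc_conj (R : rcfType) (x : R[i]) : Normc.normc (x^*)%C = Normc.normc x.
Proof. by case: x => a b /=; rewrite sqrrN. Qed.

Lemma normr_Re_le (R : rcfType) (x : R[i]) : `|complex.Re x| <= Normc.normc x.
Proof.
by case: x => a b /=; rewrite -sqrtr_sqr ler_wsqrtr// lerDl sqr_ge0.
Qed.

Lemma normr_Im_le (R : rcfType) (x : R[i]) : `|complex.Im x| <= Normc.normc x.
Proof.
by case: x => a b /=; rewrite -sqrtr_sqr ler_wsqrtr// lerDr sqr_ge0.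
Qed.

Section entry_algebra.
Context d (T : measurableType d) (R : realType) (P : probability T R).
Local Notation C := R[i].
Local Notation int_ f := (P.-integrable setT (EFin \o f)).
Local Notation Ec := (complex_expectation P).
Context (W : nat -> nat -> T -> C).
Context (entW : independent_centered_entries P W).
Context (hermW : forall i j w, W j i w = ((W i j w)^*)%C).

(** Independence is assumed on the lower triangle; this is the representative there of the unordered
    pair [e]. *)
Definition key (e : nat * nat) : nat * nat :=
  if (e.2 <= e.1)%N then e else (e.2, e.1).

(** Recovers the entry at [e] from the real and imaginary parts of the entry at [key e]: above the
    diagonal, Hermitian symmetry flips the imaginary part. *)
Definition entry_of (e : nat * nat) (y : R * R) : C :=
  if (e.2 <= e.1)%N then Complex y.1 y.2 else Complex y.1 (- y.2).

Let X (e : nat * nat) := Re_Im (W e.1 e.2).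

Lemma entry_ofE e w : W e.1 e.2 w = entry_of e (X (key e) w).
Proof.
rewrite /entry_of /X /key /Re_Im; case: (e.2 <= e.1)%N => /=; first by case: (W _ _ _).
by rewrite hermW; case: (W _ _ _).
Qed.

Lemma normc_entry_of e w : Normc.normc (entry_of e (X (key e) w)) =
  Normc.normc (W (key e).1 (key e).2 w).
Proof.
rewrite -entry_ofE /key; case: ifP => //= _.
by rewrite hermW normc_conj.
Qed.

Lemma integrable_normcX i j p : int_ (fun w => Normc.normc (W i j w) ^+ p).
Proof.
have mW := entries_measurable entW i j.
have mR : measurable_fun setT (fun w => complex.Re (W i j w)).
  exact: (measurableT_comp measurable_fst mW).
have mI : measurable_fun setT (fun w => complex.Im (W i j w)).
  exact: (measurableT_comp measurable_snd mW).
apply/integrableP; split.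
  apply/measurable_EFinP; apply: measurable_funX.
  rewrite (_ : (fun w => _) = (fun w => Num.sqrt (complex.Re (W i j w) ^+ 2 + complex.Im (W i j w) ^+ 2))); last first.
    by apply/funext => w; case: (W i j w).
  apply: (measurableT_comp (f := @Num.sqrt R)); last first.
    by apply: measurable_funD; apply: measurable_funX.
  by apply: continuous_measurable_fun; exact: sqrt_continuous.
have [c Hc] := entries_moments entW p.
have := Hc i j; rewrite /abs_moment unlock => h.
rewrite (_ : (\int[P]_x _)%E = (\int[P]_w (Normc.normc (W i j w) ^+ p)%:E)%E).
  by apply: le_lt_trans h _; exact: ltry.
apply: eq_integral => w _ /=; rewrite ger0_norm// exprn_ge0//.
by case: (W i j w) => a b; rewrite /= sqrtr_ge0.
Qed.

Definition monomial (s : seq (nat * nat)) (w : T) : C :=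
  \prod_(e <- s) W e.1 e.2 w.

Let g s (e : nat * nat) (y : R * R) : C :=
  \prod_(e' <- s | key e' == e) entry_of e' y.

Let gE s e w : g s e (X e w) = \prod_(e' <- s | key e' == e) W e'.1 e'.2 w.
Proof. by apply: eq_bigr => e' /eqP <-; rewrite entry_ofE. Qed.

Lemma big_key (J : seq (nat * nat)) s (F : nat * nat -> C) : uniq J ->
  (forall e, e \in s -> key e \in J) ->
  \prod_(e <- s) F e = \prod_(e <- J) \prod_(e' <- s | key e' == e) F e'.
Proof.
move=> uJ; elim: s => [|e s IH] sJ.
  by rewrite big_nil big1// => e _; rewrite big_nil.
rewrite big_cons IH; last by move=> e' e's; apply: sJ; rewrite inE e's orbT.
have eJ : key e \in J by apply: sJ; rewrite mem_head.
rewrite (bigD1_seq (key e))//= [RHS](bigD1_seq (key e))//= mulrA.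
congr (_ * _); first by rewrite big_cons eqxx.
by apply: eq_bigr => e' /negbTE ne; rewrite big_cons eq_sym ne.
Qed.

Lemma cmeasurable_g s e : cmeasurable (g s e).
Proof.
rewrite /g; elim: s => [|e' s [IR II]].
  by split; under eq_fun do rewrite big_nil; exact: measurable_cst.
have mR : measurable_fun setT (fun y : R * R => complex.Re (entry_of e' y)).
  rewrite /entry_of; case: (e'.2 <= e'.1)%N => /=; exact: measurable_fst.
have mI : measurable_fun setT (fun y : R * R => complex.Im (entry_of e' y)).
  rewrite /entry_of; case: (e'.2 <= e'.1)%N => /=; first exact: measurable_snd.
  by apply: measurableT_comp => //; exact: measurable_snd.
have [h|h] := boolP (key e' == e); last first.
  by split; under eq_fun do rewrite big_cons (negbTE h).
split.
  under eq_fun do rewrite big_cons h ReM.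
  by apply: measurable_funB; apply: measurable_funM.
under eq_fun do rewrite big_cons h ImM.
by apply: measurable_funD; apply: measurable_funM.
Qed.

Let mX e : measurable_fun setT (X e).
Proof. exact: (entries_measurable entW e.1 e.2). Qed.

Lemma cintegrable_g s e : cintegrable P (fun w => g s e (X e w)).
Proof.
have nE w : Normc.normc (g s e (X e w)) =
    Normc.normc (W e.1 e.2 w) ^+ count (fun e' => key e' == e) s.
  rewrite /g; elim: s => [|e' s IH]; first by rewrite big_nil Normc.normc1.
  rewrite big_cons /=; case: eqP => [h|h]; last by rewrite IH.
  by rewrite Normc.normcM IH add1n exprS -h normc_entry_of.
have [mR mI] := cmeasurable_g s e.
have H := integrable_normcX e.1 e.2 (count (fun e' => key e' == e) s).
split; apply: le_integrable H => //.
- by apply/measurable_EFinP; exact: (measurableT_comp mR (mX e)).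
- move=> w _; rewrite /= lee_fin -nE [leRHS]ger0_norm ?normr_Re_le//.
  by case: (g _ _ _) => ? ?; rewrite /= sqrtr_ge0.
- by apply/measurable_EFinP; exact: (measurableT_comp mI (mX e)).
- move=> w _; rewrite /= lee_fin -nE [leRHS]ger0_norm ?normr_Im_le//.
  by case: (g _ _ _) => ? ?; rewrite /= sqrtr_ge0.
Qed.

Let key_lower e : ((key e).2 <= (key e).1)%N.
Proof. by rewrite /key; case: ifP => //= /negbT; rewrite -ltnNge => /ltnW. Qed.

Let indX := entries_independent entW.

(** Grouping the factors of the monomial by [key] turns it into a product of functions of distinct
    independent entries. *)
Lemma monomial_prod s (J : seq (nat * nat)) : uniq J ->
  (forall e, e \in J -> (e.2 <= e.1)%N) -> (forall e, e \in s -> key e \in J) ->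
  cintegrable P (monomial s) /\
  Ec (monomial s) = \prod_(e <- J) Ec (fun w => g s e (X e w)).
Proof.
move=> uJ lJ sJ.
have E : monomial s = (fun w => \prod_(e <- J) g s e (X e w)).
  apply/funext => w; rewrite /monomial (big_key _ uJ sJ).
  by apply: eq_bigr => e _; rewrite gE.
have := complex_indep_prod indX mX (l1 := J) (l2 := [::]) (g := g s).
rewrite cats0 -E => -[] //.
- by move=> e; exact: cmeasurable_g.
- by move=> e _; exact: cintegrable_g.
Qed.

Lemma cintegrable_monomial s : cintegrable P (monomial s).
Proof.
have [] := @monomial_prod s (undup (map key s)) (undup_uniq _) => //.
- by move=> e; rewrite mem_undup => /mapP[e' _ ->].
- by move=> e es; rewrite mem_undup map_f.
Qed.

Lemma monomial_split s1 s2 :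
  (forall e1 e2, e1 \in s1 -> e2 \in s2 -> key e1 != key e2) ->
  Ec (fun w => monomial s1 w * monomial s2 w) = Ec (monomial s1) * Ec (monomial s2).
Proof.
move=> dis.
pose J1 := undup (map key s1); pose J2 := undup (map key s2).
have J1P e : e \in s1 -> key e \in J1 by move=> es; rewrite mem_undup map_f.
have J2P e : e \in s2 -> key e \in J2 by move=> es; rewrite mem_undup map_f.
have J1l e : e \in J1 -> (e.2 <= e.1)%N by rewrite mem_undup => /mapP[e' _ ->].
have J2l e : e \in J2 -> (e.2 <= e.1)%N by rewrite mem_undup => /mapP[e' _ ->].
have uJ : uniq (J1 ++ J2).
  rewrite cat_uniq !undup_uniq andbT/=; apply/hasPn => e.
  rewrite !mem_undup => /mapP[e2 e2s ->]; apply/negP => /mapP[e1 e1s] /esym/eqP.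
  by apply/negP; exact: dis.
have E : (fun w => monomial s1 w * monomial s2 w) = monomial (s1 ++ s2).
  by apply/funext => w; rewrite /monomial big_cat.
have [_ ->] := @monomial_prod s1 J1 (undup_uniq _) J1l J1P.
have [_ ->] := @monomial_prod s2 J2 (undup_uniq _) J2l J2P.
rewrite E; have [||_ ->] := @monomial_prod (s1 ++ s2) (J1 ++ J2) uJ.
- by move=> e; rewrite mem_cat => /orP[/J1l|/J2l].
- by move=> e; rewrite !mem_cat => /orP[/J1P ->|/J2P ->]; rewrite ?orbT.
rewrite big_cat/=; congr (_ * _); rewrite big_seq [RHS]big_seq; apply: eq_bigr => e.
  rewrite mem_undup => /mapP[e1 e1s ->]; congr (Ec _); apply/funext => w.
  rewrite /g big_cat/= [X in _ * X]big_seq_cond [X in _ * X]big1 ?mulr1// => e2 /andP[e2s].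
  by rewrite eq_sym => /eqP h; have := dis _ _ e1s e2s; rewrite h eqxx.
rewrite mem_undup => /mapP[e2 e2s ->]; congr (Ec _); apply/funext => w.
rewrite /g big_cat/= [X in X * _]big_seq_cond [X in X * _]big1 ?mul1r// => e1 /andP[e1s].
by move=> /eqP h; have := dis _ _ e1s e2s; rewrite h eqxx.
Qed.

End entry_algebra.

Section nsq.
Context (R : rcfType).
Implicit Types z : R[i].

(** The squared modulus with values in [R]. Its powers are polynomials in the entries whenever [z]
    is one, so even absolute moments stay within the algebra below. *)
Definition nsq z : R := complex.Re z ^+ 2 + complex.Im z ^+ 2.

Lemma nsq_ge0 z : 0 <= nsq z.
Proof. by rewrite addr_ge0// sqr_ge0. Qed.

Lemma nsqE z : (nsq z)%:C%C = z * (z^*)%C.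
Proof. by case: z => a b; apply: complex_ext; rewrite ?ReM ?ImM /nsq/=; ring. Qed.

Lemma nsqM z1 z2 : nsq (z1 * z2) = nsq z1 * nsq z2.
Proof. by rewrite /nsq ReM ImM; ring. Qed.

Lemma nsqX z n : nsq (z ^+ n) = nsq z ^+ n.
Proof.
elim: n => [|n IH]; last by rewrite !exprS nsqM IH.
by rewrite !expr0 /nsq/= expr1n expr0n addr0.
Qed.

Lemma nsq_conj z : nsq (z^*)%C = nsq z.
Proof. by case: z => a b; rewrite /nsq/= sqrrN. Qed.

Lemma nsqN z : nsq (- z) = nsq z.
Proof. by case: z => a b; rewrite /nsq/= !sqrrN. Qed.

Lemma nsqD z1 z2 : nsq (z1 + z2) <= 2 * (nsq z1 + nsq z2).
Proof.
rewrite -subr_ge0 /nsq ReD ImD.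
rewrite [leRHS](_ : _ = (complex.Re z1 - complex.Re z2) ^+ 2 + (complex.Im z1 - complex.Im z2) ^+ 2); last by ring.
by rewrite addr_ge0// sqr_ge0.
Qed.

Lemma nsq_real (x : R) : nsq (x%:C%C) = x ^+ 2.
Proof. by rewrite /nsq/= expr0n addr0. Qed.

Lemma nsq_normc z : nsq z = Normc.normc z ^+ 2.
Proof. by case: z => a b; rewrite /nsq/= sqr_sqrtr// addr_ge0// sqr_ge0. Qed.

Lemma exprD_le (x y : R) p : 0 <= x -> 0 <= y ->
  (x + y) ^+ p <= 2 ^+ p * (x ^+ p + y ^+ p).
Proof.
move=> x0 y0; have [xy|yx] := leP x y.
  apply: (@le_trans _ _ ((2 * y) ^+ p)).
    by rewrite lerXn2r ?nnegrE//; nra.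
  by rewrite exprMn ler_wpM2l ?exprn_ge0// lerDr exprn_ge0.
apply: (@le_trans _ _ ((2 * x) ^+ p)).
  by rewrite lerXn2r ?nnegrE//; nra.
by rewrite exprMn ler_wpM2l ?exprn_ge0// lerDl exprn_ge0.
Qed.

End nsq.

Section algebra.
Context d (T : measurableType d) (R : realType) (P : probability T R).
Local Notation C := R[i].
Local Notation int_ f := (P.-integrable setT (EFin \o f)).
Local Notation Ec := (complex_expectation P).
Context (W : nat -> nat -> T -> C).
Context (entW : independent_centered_entries P W).
Context (hermW : forall i j w, W j i w = ((W i j w)^*)%C).
Implicit Types (A B : nat -> nat -> Prop) (f g : T -> C).

(** The polynomials in the entries whose index pair satisfies [A]. They are closed under products
    and integrable, and disjoint sets of pairs give uncorrelated polynomials ([Ec_indep]); this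
    stands in for sigma-algebras and conditional expectations. *)
Definition alg A f := exists2 l : seq (C * seq (nat * nat)),
  (forall m e, m \in l -> e \in m.2 -> A e.1 e.2) &
  f = (fun w => \sum_(m <- l) m.1 * monomial W m.2 w).

Lemma alg_sub A B f : (forall i j, A i j -> B i j) -> alg A f -> alg B f.
Proof. by move=> AB [l lA ->]; exists l => // m e ml /(lA _ _ ml) /AB. Qed.

Lemma alg_cst A (c : C) : alg A (fun _ => c).
Proof.
exists [:: (c, [::])]; first by move=> m e; rewrite inE => /eqP ->.
by apply/funext => w; rewrite big_seq1 /monomial big_nil mulr1.
Qed.

Lemma alg_entry A i j : A i j -> alg A (W i j).
Proof.
move=> Aij; exists [:: (1, [:: (i, j)])].
  by move=> m e; rewrite inE => /eqP ->; rewrite inE => /eqP ->.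
by apply/funext => w; rewrite big_seq1 /monomial big_seq1 mul1r.
Qed.

Lemma algD A f g : alg A f -> alg A g -> alg A (fun w => f w + g w).
Proof.
move=> [l lA ->] [k kA ->]; exists (l ++ k).
  by move=> m e; rewrite mem_cat => /orP[/lA|/kA]; apply.
by apply/funext => w; rewrite big_cat.
Qed.

Lemma algM A f g : alg A f -> alg A g -> alg A (fun w => f w * g w).
Proof.
move=> [l lA ->] [k kA ->].
exists [seq (m.1 * m'.1, m.2 ++ m'.2) | m <- l, m' <- k].
  move=> _ e /allpairsP[[m m'] /= [ml mk ->]] /=.
  by rewrite mem_cat => /orP[/(lA _ _ ml)|/(kA _ _ mk)].
apply/funext => w; rewrite big_allpairs_dep/= mulr_suml; apply: eq_bigr => m _.
rewrite mulr_sumr; apply: eq_bigr => m' _.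
by rewrite /monomial big_cat/=; ring.
Qed.

Lemma algZ A (c : C) f : alg A f -> alg A (fun w => c * f w).
Proof. by move=> Af; apply: algM => //; exact: alg_cst. Qed.

Lemma algN A f : alg A f -> alg A (fun w => - f w).
Proof. by move=> /(algZ (-1)); congr alg; apply/funext => w; rewrite mulN1r. Qed.

Lemma algB A f g : alg A f -> alg A g -> alg A (fun w => f w - g w).
Proof. by move=> Af Ag; apply: algD => //; exact: algN. Qed.

Lemma alg_sum A (I : eqType) (s : seq I) (F : I -> T -> C) :
  (forall i, i \in s -> alg A (F i)) -> alg A (fun w => \sum_(i <- s) F i w).
Proof.
elim: s => [|i s IH] h.
  by rewrite (_ : (fun w => _) = fun=> 0); [exact: alg_cst|
     apply/funext => w; rewrite big_nil].
rewrite (_ : (fun w => _) = (fun w => F i w + \sum_(j <- s) F j w)).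
  apply: algD; first by apply: h; rewrite mem_head.
  by apply: IH => j js; apply: h; rewrite inE js orbT.
by apply/funext => w; rewrite big_cons.
Qed.

Lemma alg_sum_ord A n (F : 'I_n -> T -> C) :
  (forall i, alg A (F i)) -> alg A (fun w => \sum_(i < n) F i w).
Proof.
move=> h; rewrite (_ : (fun w => _) = (fun w => \sum_(i <- enum 'I_n) F i w)).
  exact: alg_sum.
by apply/funext => w; rewrite big_enum.
Qed.

Lemma algX A f n : alg A f -> alg A (fun w => f w ^+ n).
Proof.
move=> Af; elim: n => [|n IH].
  by under eq_fun do rewrite expr0; exact: alg_cst.
by under eq_fun do rewrite exprS; exact: algM.
Qed.

Lemma alg_conj A f : (forall i j, A i j -> A j i) -> alg A f ->
  alg A (fun w => ((f w)^*)%C).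
Proof.
move=> sA [l lA ->].
rewrite (_ : (fun w => _) =
  (fun w => \sum_(m <- l) ((m.1)^*)%C * \prod_(e <- m.2) W e.2 e.1 w)).
  apply: alg_sum => -[c s] /= ml; apply: algZ.
  have := lA _ _ ml; move: {ml} s; elim=> [|e s IH] h /=.
    by under eq_fun do rewrite big_nil; exact: alg_cst.
  under eq_fun do rewrite big_cons; apply: algM.
    by apply/alg_entry/sA/h; rewrite mem_head.
  by apply: IH => e' e's; apply: h; rewrite inE e's orbT.
apply/funext => w; rewrite rmorph_sum/=; apply: eq_bigr => m _.
by rewrite rmorphM rmorph_prod; congr (_ * _); apply: eq_bigr => e _; rewrite [RHS]hermW.
Qed.

Lemma alg_cintegrable A f : alg A f -> cintegrable P f.
Proof.
move=> [l _ ->]; elim: l => [|m l IH].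
  by under eq_fun do rewrite big_nil; exact: cintegrable_cst.
under eq_fun do rewrite big_cons; apply: cintegrableD => //.
exact/cintegrableZ/cintegrable_monomial.
Qed.

Lemma EcD A f g : alg A f -> alg A g -> Ec (fun w => f w + g w) = Ec f + Ec g.
Proof. by move=> Af Ag; rewrite complex_expectationD//; [exact: alg_cintegrable Af|exact: alg_cintegrable Ag]. Qed.

Lemma EcZ A (c : C) f : alg A f -> Ec (fun w => c * f w) = c * Ec f.
Proof. by move=> Af; rewrite complex_expectationZ//; exact: alg_cintegrable Af. Qed.

Lemma EcB A f g : alg A f -> alg A g -> Ec (fun w => f w - g w) = Ec f - Ec g.
Proof.
move=> Af Ag; under [in LHS]eq_fun do rewrite -mulN1r.
by rewrite (EcD Af (algZ (-1) Ag)) (EcZ _ Ag) mulN1r.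
Qed.

Lemma Ec_sum A (I : eqType) (s : seq I) (F : I -> T -> C) :
  (forall i, i \in s -> alg A (F i)) ->
  Ec (fun w => \sum_(i <- s) F i w) = \sum_(i <- s) Ec (F i).
Proof.
elim: s => [|i s IH] h.
  by under eq_fun do rewrite big_nil; rewrite complex_expectation_cst big_nil.
have h' j : j \in s -> alg A (F j) by move=> js; apply: h; rewrite inE js orbT.
under eq_fun do rewrite big_cons.
rewrite (EcD (A := A)) ?IH ?big_cons//; last exact: alg_sum.
by apply: h; rewrite mem_head.
Qed.

Lemma Ec_sum_ord A n (F : 'I_n -> T -> C) : (forall i, alg A (F i)) ->
  Ec (fun w => \sum_(i < n) F i w) = \sum_(i < n) Ec (F i).
Proof.
move=> h; under eq_fun do rewrite -big_enum; rewrite (Ec_sum (A := A))//.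
by rewrite big_enum.
Qed.

(** By bilinearity this is [monomial_split]. Disjointness is asked in both orientations because
    [W i j] and [W j i] are conjugate. *)
Lemma Ec_indep A B f g : alg A f -> alg B g ->
  (forall i j, A i j -> ~ B i j /\ ~ B j i) ->
  Ec (fun w => f w * g w) = Ec f * Ec g.
Proof.
move=> [l lA ->] [k kB ->] AB.
pose U : nat -> nat -> Prop := fun _ _ => True.
have Um s : alg U (monomial W s).
  exists [:: (1, s)]; first by [].
  by apply/funext => w; rewrite big_seq1 mul1r.
have kU : alg U (fun w => \sum_(m <- k) m.1 * monomial W m.2 w) by exists k.
under eq_fun do rewrite mulr_suml.
rewrite (Ec_sum (A := U)); last first.
  by move=> m _; apply: algM => //; apply: algZ; exact: Um.
rewrite (Ec_sum (A := U)); last by move=> m _; apply: algZ; exact: Um.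
rewrite mulr_suml big_seq [RHS]big_seq; apply: eq_bigr => m ml.
under eq_fun do rewrite mulr_sumr.
rewrite (Ec_sum (A := U)); last first.
  by move=> m' _; apply: algM => //; apply: algZ; exact: Um.
rewrite [in RHS](Ec_sum (A := U)); last by move=> m' _; apply: algZ; exact: Um.
rewrite mulr_sumr big_seq [RHS]big_seq; apply: eq_bigr => m' mk.
rewrite (_ : (fun w => _) =
  (fun w => (m.1 * m'.1) * (monomial W m.2 w * monomial W m'.2 w))); last first.
  by apply/funext => w; ring.
rewrite (EcZ (A := U)); last exact: algM.
rewrite (EcZ (A := U))// (EcZ (A := U))// monomial_split//; first by ring.
move=> e1 e2 e1m e2m; apply/eqP => kE.
have A1 := lA _ _ ml e1m; have B2 := kB _ _ mk e2m.
have [n1 n2] := AB _ _ A1.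
move: kE B2 n1 n2; rewrite /key; case: e1 {A1 e1m} => a b; case: e2 {e2m} => a' b' /=.
by do 2 case: ifP => _; move=> -[-> ->].
Qed.

Lemma Ec_conj A f : alg A f -> Ec (fun w => ((f w)^*)%C) = ((Ec f)^*)%C.
Proof.
move=> /alg_cintegrable[fR fI]; rewrite !complex_expectationE; apply: complex_ext => /=.
  by apply: eq_Rintegral => w _; case: (f w).
under eq_Rintegral => w _.
  rewrite (_ : complex.Im _ = -1 * complex.Im (f w)); last by case: (f w) => a b /=; ring.
  over.
by rewrite RintegralZl// mulN1r.
Qed.

Lemma alg_nsqX A f p : (forall i j, A i j -> A j i) -> alg A f ->
  alg A (fun w => (nsq (f w) ^+ p)%:C%C).
Proof.
move=> sA Af; under eq_fun do rewrite rmorphXn/= nsqE.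
by apply/algX/algM => //; exact: alg_conj.
Qed.

Lemma alg_Re A f : (forall i j, A i j -> A j i) -> alg A f ->
  alg A (fun w => (complex.Re (f w))%:C%C).
Proof.
move=> sA Af; under eq_fun do rewrite ReJ_add mulrC.
by apply/algZ/algD => //; exact: alg_conj.
Qed.

Lemma alg_Im A f : (forall i j, A i j -> A j i) -> alg A f ->
  alg A (fun w => (complex.Im (f w))%:C%C).
Proof.
move=> sA Af; under eq_fun do rewrite ImJ_sub -mulrA mulrC.
by apply/algZ/algB => //; exact: alg_conj.
Qed.

Lemma alg_real_integrable A (f : T -> R) : alg A (fun w => (f w)%:C%C) -> int_ f.
Proof. by move=> /alg_cintegrable[]. Qed.

End algebra.

(** * Inequalities between powers of real numbers *)

Section power_inequalities.
Context (R : realFieldType).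
Implicit Types x y z : R.

(** The difference of the two sides is the product of [x - y] and [x ^+ p - y ^+ p], which have the
    same sign. *)
Lemma mul_expr_le x y p : 0 <= x -> 0 <= y ->
  x * y ^+ p + y * x ^+ p <= x ^+ p.+1 + y ^+ p.+1.
Proof.
move=> x0 y0; rewrite -subr_ge0 !exprS.
rewrite (_ : _ - _ = (x - y) * (x ^+ p - y ^+ p)); last by ring.
have [xy|yx] := leP y x.
  by rewrite mulr_ge0// subr_ge0// lerXn2r// nnegrE.
by rewrite mulr_le0// subr_le0 ?lerXn2r ?nnegrE// ltW.
Qed.

(** Chebyshev's sum inequality; the induction step sums [mul_expr_le] over the pairs formed with the
    new element. *)
Lemma chebyshev_sum_le (s : seq R) p : (forall x, x \in s -> 0 <= x) ->
  (\sum_(x <- s) x) * (\sum_(x <- s) x ^+ p) <= (size s)%:R * \sum_(x <- s) x ^+ p.+1.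
Proof.
elim: s => [|x s IH] s0; first by rewrite !big_nil !mulr0.
have x0 : 0 <= x by apply: s0; rewrite mem_head.
have s0' y : y \in s -> 0 <= y by move=> ys; apply: s0; rewrite inE ys orbT.
have {}IH := IH s0'.
rewrite !big_cons /=.
have h : x * (\sum_(y <- s) y ^+ p) + x ^+ p * (\sum_(y <- s) y) <=
         (size s)%:R * x ^+ p.+1 + \sum_(y <- s) y ^+ p.+1.
  rewrite !mulr_sumr -big_split/=.
  rewrite [leRHS](_ : _ = \sum_(y <- s) (x ^+ p.+1 + y ^+ p.+1)); last first.
    by rewrite big_split/= big_const_seq count_predT iter_addr_0 mulr_natl.
  rewrite big_seq [leRHS]big_seq; apply: ler_sum => y ys.
  by rewrite [x ^+ p * y]mulrC mul_expr_le// s0'.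
move: IH h; rewrite -natr1 exprS.
set S1 := \sum_(y <- s) y; set Sp := \sum_(y <- s) y ^+ p.
set Sq := \sum_(y <- s) y ^+ p.+1; set m := (size s)%:R; set xp := x ^+ p.
lra.
Qed.

Lemma power_mean_le (s : seq R) p : (forall x, x \in s -> 0 <= x) ->
  (\sum_(x <- s) x) ^+ p.+1 <= (size s)%:R ^+ p * \sum_(x <- s) x ^+ p.+1.
Proof.
move=> s0; elim: p => [|p IH]; first by rewrite mul1r.
have S0 : 0 <= \sum_(x <- s) x by rewrite big_seq sumr_ge0.
rewrite exprS; apply: (le_trans (ler_wpM2l S0 IH)).
rewrite mulrCA exprSr -[leRHS]mulrA ler_wpM2l ?exprn_ge0//.
exact: chebyshev_sum_le.
Qed.

(** A second-order Taylor bound. Multiplying the remainder by [z + x] produces one extra term with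
    coefficient [m.+2], and the squares in the constant grow fast enough to absorb it. *)
Lemma expr_taylor2_le z x m :
  `|(z + x) ^+ m.+2 - z ^+ m.+2 - m.+2%:R * z ^+ m.+1 * x| <=
  (m.+2 ^ 2)%:R * (`|z| + `|x|) ^+ m * x ^+ 2.
Proof.
have S0 : 0 <= `|z| + `|x| by rewrite addr_ge0.
elim: m => [|m IH].
  rewrite (_ : _ - _ = x ^+ 2); last by ring.
  by rewrite ger0_norm ?sqr_ge0// mulr1 ler_peMl ?sqr_ge0// ler1n.
rewrite (_ : _ - _ = (z + x) * ((z + x) ^+ m.+2 - z ^+ m.+2 - m.+2%:R * z ^+ m.+1 * x)
   + m.+2%:R * z ^+ m.+1 * x ^+ 2); last first.
  by rewrite !exprS -!(natr1 m.+1) -!(natr1 m); ring.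
apply: le_trans (ler_normD _ _) _; have nE : `|m.+2%:R * z ^+ m.+1 * x ^+ 2| = m.+2%:R * `|z| ^+ m.+1 * x ^+ 2.
  by rewrite normrM (ger0_norm (sqr_ge0 x)) normrM normrX normr_nat.
rewrite nE normrM.
have h1 : `|z + x| <= `|z| + `|x| by exact: ler_normD.
have h2 : `|z + x| * `|(z + x) ^+ m.+2 - z ^+ m.+2 - m.+2%:R * z ^+ m.+1 * x| <=
  (m.+2 ^ 2)%:R * (`|z| + `|x|) ^+ m.+1 * x ^+ 2.
  apply: le_trans (ler_pM _ _ h1 IH) _ => //.
  by rewrite [(_ + _) ^+ m.+1]exprS le_eqVlt; apply/orP; left; apply/eqP; ring.
have h3 : m.+2%:R * `|z| ^+ m.+1 * x ^+ 2 <= m.+2%:R * (`|z| + `|x|) ^+ m.+1 * x ^+ 2.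
  by rewrite ler_wpM2r ?sqr_ge0// ler_wpM2l// lerXn2r ?nnegrE// lerDl.
apply: le_trans (lerD h2 h3) _; rewrite -!mulrDl ler_wpM2r ?sqr_ge0//.
rewrite ler_wpM2r ?exprn_ge0// -natrD ler_nat; nia.
Qed.

(** If [z ^+ 2] is at most [M] times [x ^+ 2], everything is bounded by the power of [x]; otherwise
    [x ^+ 2] is at most [z ^+ 2 / M]. A large [M] makes the coefficient of the power of [z]
    small. *)
Lemma expr_split_le (z x M : R) p : 1 <= M ->
  (`|z| + `|x|) ^+ p.*2 * x ^+ 2 <=
  4 ^+ p * M^-1 * z ^+ p.+1.*2 + 4 ^+ p * M ^+ p * x ^+ p.+1.*2.
Proof.
move=> M1; have M0 : 0 < M by exact: lt_le_trans M1.
have ev (y : R) q : y ^+ q.*2 = (y ^+ 2) ^+ q by rewrite -exprM mul2n.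
have pow q (y : R) : 0 <= y ^+ q.*2 by rewrite ev exprn_ge0// sqr_ge0.
have evS (y : R) : y ^+ p.+1.*2 = (y ^+ 2) ^+ p * y ^+ 2 by rewrite ev exprSr.
rewrite [_ ^+ p.*2]ev !evS.
have zx := sqr_ge0 z; have xx := sqr_ge0 x.
have cauchy : (`|z| + `|x|) ^+ 2 <= 2 * (z ^+ 2 + x ^+ 2).
  have := sqr_ge0 (`|z| - `|x|).
  rewrite -[z ^+ 2]ger0_norm// -[x ^+ 2]ger0_norm// !normrX; nra.
set a := z ^+ 2 in zx cauchy *; set b := x ^+ 2 in xx cauchy *.
clearbody a b.
have [h|h] := leP a (M * b).
  apply: (@le_trans _ _ (4 ^+ p * M ^+ p * (b ^+ p * b))); last first.
    by rewrite lerDr !mulr_ge0 ?exprn_ge0 ?invr_ge0// ltW.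
  rewrite mulrA ler_wpM2r// -!exprMn lerXn2r// ?nnegrE ?sqr_ge0//.
    by rewrite !mulr_ge0 ?exprn_ge0// ltW.
  apply: le_trans cauchy _.
  have : b <= M * b by rewrite ler_peMl.
  lra.
apply: (@le_trans _ _ (4 ^+ p * M^-1 * (a ^+ p * a))); last first.
  by rewrite lerDl !mulr_ge0 ?exprn_ge0// ltW.
have hb : b <= M^-1 * a by rewrite ler_pdivlMl// ltW.
rewrite [leRHS](_ : _ = (4 * a) ^+ p * (M^-1 * a)); last by rewrite exprMn; ring.
apply: ler_pM => //.
rewrite lerXn2r ?nnegrE ?sqr_ge0// ?mulr_ge0//.
apply: le_trans cauchy _.
have : b <= M * b by rewrite ler_peMl.
lra.
Qed.

Definition burkholder_cst p : R :=
  ((p.+1.*2 ^ 2)%:R * 4 ^+ p) ^+ p.+1.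

(** One step of the moment recursion for a martingale with value [z] and increment [x]: the middle
    term has mean 0, and the factor 1 + 1/n stays bounded when iterated n times. *)
Lemma expr_add_le (z x : R) n p : (0 < n)%N ->
  (z + x) ^+ p.+1.*2 <= (1 + n%:R^-1) * z ^+ p.+1.*2 +
    p.+1.*2%:R * (z ^+ p.*2.+1 * x) + burkholder_cst p * n%:R ^+ p * x ^+ p.+1.*2.
Proof.
move=> n0; have n1 : 1 <= n%:R :> R by rewrite ler1n.
pose c : R := (p.+1.*2 ^ 2)%:R.
have c1 : 1 <= c by rewrite ler1n expn_gt0.
have q1 : 1 <= 4 ^+ p :> R by rewrite exprn_ege1// ler1n.
have ev0 (y : R) q : 0 <= y ^+ q.*2 by rewrite -mul2n exprM exprn_ge0// sqr_ge0.
(* With this [M] the power of [z] in the Taylor remainder receives the coefficient 1/n exactly. *)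
pose M : R := c * 4 ^+ p * n%:R.
have M1 : 1 <= M by rewrite /M !mulr_ege1.
have T := expr_taylor2_le z x p.*2.
have S := expr_split_le z x p M1.
have := le_trans (ler_norm _) T; rewrite -doubleS -/c => {}T.
have cS : c * (`|z| + `|x|) ^+ p.*2 * x ^+ 2 <=
   n%:R^-1 * z ^+ p.+1.*2 + burkholder_cst p * n%:R ^+ p * x ^+ p.+1.*2.
  rewrite -mulrA; apply: le_trans (ler_wpM2l _ S) _; first by rewrite (le_trans _ c1).
  rewrite mulrDr lerD//.
    rewrite mulrA; apply: ler_wpM2r; first exact: ev0.
    rewrite /M invfM mulrA mulrA mulfV ?mul1r//.
    by rewrite mulf_neq0 ?gt_eqF// (lt_le_trans _ q1)// (lt_le_trans _ c1).
  rewrite mulrA; apply: ler_wpM2r; first exact: ev0.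
  by rewrite /M exprMn /burkholder_cst -/c exprS !mulrA.
rewrite mulrDl mul1r.
move: T cS; rewrite -!mulrA.
set A := (z + x) ^+ _; set B := z ^+ p.+1.*2; set D := p.+1.*2%:R * _.
move=> T cS; lra.
Qed.

End power_inequalities.

(** * Uniform bounds in every L^p *)

Lemma real_sqr_normr (R : realDomainType) (x : R) : `|x| ^+ 2 = x ^+ 2.
Proof. by rewrite real_normK// num_real. Qed.

Section moment_calculus.
Context d (T : measurableType d) (R : realType) (P : probability T R).
Local Notation C := R[i].
Local Notation int_ f := (P.-integrable setT (EFin \o f)).
Local Notation Ec := (complex_expectation P).
Context (W : nat -> nat -> T -> C).
Context (entW : independent_centered_entries P W).
Context (hermW : forall i j w, W j i w = ((W i j w)^*)%C).

Definition all_edges (i j : nat) : Prop := True.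
Local Notation algT := (alg W all_edges).

Definition moment (f : T -> C) (p : nat) : R := \int[P]_w (nsq (f w) ^+ p).

Lemma algT_alg A f : alg W A f -> algT f.
Proof. exact: alg_sub. Qed.

Lemma int_nsqX f p : algT f -> int_ (fun w => nsq (f w) ^+ p).
Proof. by move=> Af; apply: (alg_real_integrable (A := all_edges) entW hermW); exact: alg_nsqX. Qed.

Lemma le_int (f g : T -> R) : int_ f -> int_ g -> (forall w, f w <= g w) ->
  \int[P]_w f w <= \int[P]_w g w.
Proof. by move=> If Ig fg; apply: le_Rintegral => // w _; exact: fg. Qed.

Lemma moment_ge0 f p : 0 <= moment f p.
Proof. by apply: Rintegral_ge0 => w _; rewrite exprn_ge0// nsq_ge0. Qed.

Lemma Rint_cst (a : R) : \int[P]_(w in setT) a = a.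
Proof.
have PT : fine (P setT) = 1 by rewrite probability_setT.
by rewrite Rintegral_cst// PT mulr1.
Qed.

(** A family bounded in every L^p, uniformly over the indices in [D]. Asking for all orders at once
    makes the notion stable under products ([bddM]). *)
Definition bdd (J : Type) (D : J -> Prop) (F : J -> T -> C) : Prop :=
  (forall j, D j -> algT (F j)) /\
  forall p, exists K : R, forall j, D j -> moment (F j) p <= K.

Section families.
Context (J : Type) (D : J -> Prop).
Implicit Types F G : J -> T -> C.

Lemma bdd_ext F G : (forall j w, D j -> F j w = G j w) -> bdd D F -> bdd D G.
Proof.
move=> FG [aF bF].
have E j : D j -> F j = G j by move=> Dj; apply/funext => w; exact: FG.
split; first by move=> j Dj; rewrite -E//; exact: aF.
by move=> p; have [K HK] := bF p; exists K => j Dj; rewrite -E//; exact: HK.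
Qed.

Lemma bdd_cst (a : J -> C) (K : R) : (forall j, D j -> nsq (a j) <= K) ->
  bdd D (fun j _ => a j).
Proof.
move=> aK; split; first by move=> j _; exact: alg_cst.
move=> p; exists (K ^+ p) => j Dj; rewrite /moment Rint_cst.
by rewrite lerXn2r ?nnegrE ?nsq_ge0 ?aK// (le_trans _ (aK j Dj))// nsq_ge0.
Qed.

Lemma bddD F G : bdd D F -> bdd D G -> bdd D (fun j w => F j w + G j w).
Proof.
move=> [aF bF] [aG bG]; split; first by move=> j Dj; apply: algD; [exact: aF|exact: aG].
move=> p; have [K1 H1] := bF p; have [K2 H2] := bG p.
exists (2 ^+ p * (2 ^+ p * (K1 + K2))) => j Dj.
have IF := int_nsqX p (aF j Dj); have IG := int_nsqX p (aG j Dj).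
apply: (@le_trans _ _ (\int[P]_w (2 ^+ p * (2 ^+ p * (nsq (F j w) ^+ p + nsq (G j w) ^+ p))))).
  apply: le_int.
  - by apply: int_nsqX; apply: algD; [exact: aF|exact: aG].
  - by apply/intZ/intZ/intD.
  move=> w; rewrite -[leLHS]mulr1 mulr1.
  apply: (@le_trans _ _ ((2 * (nsq (F j w) + nsq (G j w))) ^+ p)).
    by rewrite lerXn2r ?nnegrE ?nsq_ge0 ?nsqD// mulr_ge0// addr_ge0// nsq_ge0.
  by rewrite exprMn ler_wpM2l ?exprn_ge0// exprD_le// nsq_ge0.
rewrite RintegralZl//; last by apply/intZ/intD.
rewrite RintegralZl//; last exact/intD.
rewrite RintegralD// ler_wpM2l ?exprn_ge0// ler_wpM2l ?exprn_ge0// lerD//.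
  exact: H1.
exact: H2.
Qed.

Lemma bddM F G : bdd D F -> bdd D G -> bdd D (fun j w => F j w * G j w).
Proof.
move=> [aF bF] [aG bG]; split; first by move=> j Dj; apply: algM; [exact: aF|exact: aG].
move=> p; have [K1 H1] := bF p.*2; have [K2 H2] := bG p.*2.
exists (K1 + K2) => j Dj.
have IF := int_nsqX p.*2 (aF j Dj); have IG := int_nsqX p.*2 (aG j Dj).
apply: (@le_trans _ _ (\int[P]_w (nsq (F j w) ^+ p.*2 + nsq (G j w) ^+ p.*2))).
  apply: le_int.
  - by apply: int_nsqX; apply: algM; [exact: aF|exact: aG].
  - exact: intD.
  move=> w; rewrite nsqM exprMn -!mul2n !exprM ![_ ^+ 2 ^+ p]exprAC.
  have := nsq_ge0 (F j w); have := nsq_ge0 (G j w).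
  move=> /(exprn_ge0 p); set b := _ ^+ p => b0 /(exprn_ge0 p); set a := _ ^+ p => a0.
  nra.
by rewrite RintegralD// lerD//; [exact: H1|exact: H2].
Qed.

Lemma bddZ (a : J -> C) (K : R) F : (forall j, D j -> nsq (a j) <= K) ->
  bdd D F -> bdd D (fun j w => a j * F j w).
Proof. by move=> aK bF; apply: bddM => //; exact: bdd_cst aK. Qed.

Lemma bddN F : bdd D F -> bdd D (fun j w => - F j w).
Proof.
move=> bF; apply: bdd_ext (bddZ (a := fun=> -1) (K := 1) _ bF).
  by move=> j w _; rewrite mulN1r.
by move=> j _; rewrite nsqN /nsq/= expr1n expr0n addr0.
Qed.

Lemma bddB F G : bdd D F -> bdd D G -> bdd D (fun j w => F j w - G j w).
Proof. by move=> bF bG; apply: bddD => //; exact: bddN. Qed.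

Lemma bdd_conj F : bdd D F -> bdd D (fun j w => ((F j w)^*)%C).
Proof.
move=> [aF bF]; split; first by move=> j /aF; exact: alg_conj.
move=> p; have [K HK] := bF p; exists K => j Dj.
by rewrite /moment; under eq_Rintegral do rewrite nsq_conj; exact: HK.
Qed.

Lemma bdd_sum_ord n (F : 'I_n -> J -> T -> C) : (forall i, bdd D (F i)) ->
  bdd D (fun j w => \sum_(i < n) F i j w).
Proof.
elim: n F => [|n IH] F bF.
  apply: bdd_ext (bdd_cst (a := fun=> 0) (K := 0) _).
    by move=> j w _; rewrite big_ord0.
  by move=> j _; rewrite /nsq/= expr0n addr0.
apply: bdd_ext (bddD (IH _ (fun i => bF (widen_ord (leqnSn n) i))) (bF ord_max)).
by move=> j w _; rewrite big_ord_recr.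
Qed.

Lemma bdd_expectation F : bdd D F ->
  exists K : R, forall j, D j -> nsq (Ec (F j)) <= K.
Proof.
move=> [aF bF]; have [K HK] := bF 1; exists (2 * (1 + K) ^+ 2) => j Dj.
have [IR II] := alg_cintegrable entW hermW (aF j Dj).
have I1 := int_nsqX 1 (aF j Dj).
have Kj : 0 <= 1 + moment (F j) 1 by rewrite addr_ge0// moment_ge0.
have bound (g : T -> R) : int_ g -> (forall w, `|g w| <= 1 + nsq (F j w) ^+ 1) ->
    (\int[P]_w g w) ^+ 2 <= (1 + K) ^+ 2.
  move=> Ig gF.
  have h : `|\int[P]_w g w| <= 1 + moment (F j) 1.
    apply: le_trans (le_normr_Rintegral measurableT Ig) _.
    rewrite -[X in X + _](Rint_cst 1) -RintegralD//; last first.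
      exact: finite_measure_integrable_cst.
    apply: le_int => //.
      by have := integrable_norm Ig; congr (P.-integrable _ _); apply/funext.
    by apply: intD => //; exact: finite_measure_integrable_cst.
  rewrite -(real_sqr_normr (\int[P]_w g w)) lerXn2r ?nnegrE//.
    by rewrite (le_trans Kj)// lerD2l HK.
  by apply: le_trans h _; rewrite lerD2l HK.
rewrite complex_expectationE /nsq/= mulr_natl mulr2n lerD// bound// => w.
  rewrite expr1 /nsq -subr_ge0.
  have := sqr_ge0 (complex.Im (F j w)); have := sqr_ge0 (`|complex.Re (F j w)| - 1).
  by rewrite sqrrB real_sqr_normr => *; nra.
rewrite expr1 /nsq -subr_ge0.
have := sqr_ge0 (complex.Re (F j w)); have := sqr_ge0 (`|complex.Im (F j w)| - 1).
by rewrite sqrrB real_sqr_normr => *; nra.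
Qed.

End families.

Lemma bdd_reindex (J J' : Type) (D : J -> Prop) (D' : J' -> Prop) (g : J' -> J)
  (F : J -> T -> C) : (forall j, D' j -> D (g j)) -> bdd D F -> bdd D' (fun j => F (g j)).
Proof.
move=> DD [aF bF]; split; first by move=> j /DD /aF.
by move=> p; have [K HK] := bF p; exists K => j /DD /HK.
Qed.

Lemma nsq_sum_le (s : seq C) : nsq (\sum_(z <- s) z) <= (size s)%:R * \sum_(z <- s) nsq z.
Proof.
have h (g : C -> R) : (\sum_(z <- s) g z) ^+ 2 <= (size s)%:R * \sum_(z <- s) g z ^+ 2.
  have := @power_mean_le _ [seq `|g z| | z <- s] 1.
  rewrite !big_map size_map expr1 => H.
  apply: (@le_trans _ _ ((\sum_(z <- s) `|g z|) ^+ 2)).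
    rewrite -(real_sqr_normr (\sum_(z <- s) g z)) lerXn2r ?nnegrE// ?ler_norm_sum//.
    by rewrite sumr_ge0.
  apply: le_trans (H _) _; first by move=> x /mapP[z _ ->].
  by rewrite ler_wpM2l//; apply: ler_sum => z _; rewrite real_sqr_normr.
have := lerD (h (@complex.Re R)) (h (@complex.Im R)).
rewrite -mulrDr -big_split/=; congr (_ <= _).
congr (_ ^+ 2 + _ ^+ 2).
  by elim: s {h} => [|z s IH]; rewrite ?big_nil// !big_cons ReD IH.
by elim: s {h} => [|z s IH]; rewrite ?big_nil// !big_cons ImD IH.
Qed.

Lemma int_sum (I : Type) (s : seq I) (F : I -> T -> R) :
  (forall i, int_ (F i)) -> int_ (fun w => \sum_(i <- s) F i w) /\
  \int[P]_w (\sum_(i <- s) F i w) = \sum_(i <- s) \int[P]_w F i w.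
Proof.
move=> IF; elim: s => [|i s [I1 E1]].
  split; last by rewrite big_nil; under eq_Rintegral do rewrite big_nil; rewrite Rint_cst.
  by have [h _] := @cintegrable_cst _ _ _ P 0; apply: eq_int h => w; rewrite big_nil.
split; first by apply: eq_int (intD (IF i) I1) => w; rewrite big_cons.
by under eq_Rintegral do rewrite big_cons; rewrite RintegralD// E1 big_cons.
Qed.

(** Convexity of powers, in the form [power_mean_le]: an average loses nothing in L^p. *)
Lemma bdd_average (J : Type) (D : J -> Prop) (S : J -> seq nat) (N : J -> nat)
    (F : J -> nat -> T -> C) :
  (forall j, D j -> (size (S j) <= N j)%N /\ (0 < N j)%N) ->
  bdd (fun ju => D ju.1 /\ ju.2 \in S ju.1) (fun ju => F ju.1 ju.2) ->
  bdd D (fun j w => (N j)%:R^-1 * \sum_(u <- S j) F j u w).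
Proof.
move=> DS [aF bF]; split.
  move=> j Dj; apply: algZ; apply: alg_sum => u uS.
  exact: (aF (j, u)).
case=> [|p].
  by exists 1 => j Dj; rewrite /moment; under eq_Rintegral do rewrite expr0; rewrite Rint_cst.
have [K HK] := bF p.+1; exists (Num.max K 0) => j Dj.
have [SN N0] := DS _ Dj.
have N0' : 0 < (N j)%:R :> R by rewrite ltr0n.
(* Set to 0 outside [S j], so that integrability holds for every index, as [int_sum] requires. *)
pose F' u := if u \in S j then F j u else (fun=> 0).
have F'E u : u \in S j -> F' u = F j u by rewrite /F' => ->.
have aF' u : algT (F' u).
  by rewrite /F'; case: ifPn => [uS|_]; [exact: (aF (j, u))|exact: alg_cst].
have [I1 E1] := int_sum (S j) (fun u => int_nsqX p.+1 (aF' u)).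
apply: (@le_trans _ _ (\int[P]_w ((N j)%:R^-1 * \sum_(u <- S j) nsq (F' u w) ^+ p.+1))).
  apply: le_int.
  - apply: int_nsqX; apply: algZ; apply: alg_sum => u uS; exact: (aF (j, u)).
  - exact: intZ.
  move=> w; rewrite nsqM.
  have -> : nsq ((N j)%:R^-1 : C) = (N j)%:R ^- 2.
    by rewrite -(rmorph_nat (real_complex R)) -fmorphV nsq_real exprVn.
  have E2 : \sum_(u <- S j) F j u w = \sum_(z <- [seq F' u w | u <- S j]) z.
    by rewrite big_map; apply: eq_big_seq => u uS; rewrite F'E.
  rewrite E2.
  have h1 := nsq_sum_le [seq F' u w | u <- S j].
  have h2 := @power_mean_le _ [seq nsq (F' u w) | u <- S j] p.
  rewrite !big_map !size_map in h1 h2.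
  have NN0 : 0 <= (N j)%:R :> R by exact: ltW.
  have Ni0 : 0 <= (N j)%:R^-1 :> R by rewrite invr_ge0.
  have Ni2 : 0 <= (N j)%:R ^- 2 :> R by rewrite invr_ge0 exprn_ge0.
  have S0 : 0 <= \sum_(u <- S j) nsq (F' u w) by rewrite sumr_ge0// => u _; exact: nsq_ge0.
  have SN' : (size (S j))%:R <= (N j)%:R :> R by rewrite ler_nat.
  have Sp0 : 0 <= \sum_(u <- S j) nsq (F' u w) ^+ p.+1.
    by rewrite sumr_ge0// => u _; rewrite exprn_ge0// nsq_ge0.
  apply: (@le_trans _ _ (((N j)%:R ^- 2 * ((N j)%:R * \sum_(u <- S j) nsq (F' u w))) ^+ p.+1)).
    rewrite lerXn2r ?nnegrE//; first by rewrite mulr_ge0// nsq_ge0.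
      by rewrite !mulr_ge0.
    rewrite ler_wpM2l// big_map; apply: le_trans h1 _.
    by rewrite ler_wpM2r.
  rewrite (_ : (N j)%:R ^- 2 * _ = (N j)%:R^-1 * \sum_(u <- S j) nsq (F' u w)); last first.
    by field; rewrite pnatr_eq0 -lt0n.
  rewrite exprMn exprS -!mulrA ler_wpM2l//.
  apply: (@le_trans _ _ ((N j)%:R^-1 ^+ p * ((size (S j))%:R ^+ p * \sum_(u <- S j) nsq (F' u w) ^+ p.+1))).
    rewrite ler_wpM2l ?exprn_ge0//; apply: h2.
    by move=> x /mapP[u _ ->]; exact: nsq_ge0.
  rewrite mulrA -exprMn ler_piMl// exprn_ile1//.
  by rewrite ler_pdivrMl// mulr1.
rewrite RintegralZl// E1 ler_pdivrMl//.
apply: (@le_trans _ _ (\sum_(u <- S j) Num.max K 0)).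
  rewrite big_seq [leRHS]big_seq; apply: ler_sum => u uS; rewrite F'E// le_max.
  by have := HK (j, u); rewrite /moment /= => -> //.
rewrite big_const_seq count_predT iter_addr_0 -[leLHS]mulr_natl.
apply: ler_wpM2r; last by rewrite ler_nat.
by rewrite le_max lexx orbT.
Qed.

End moment_calculus.

(** * Moments of martingale sums *)

Section martingale_chains.
Context d (T : measurableType d) (R : realType) (P : probability T R).
Local Notation C := R[i].
Local Notation int_ f := (P.-integrable setT (EFin \o f)).
Local Notation Ec := (complex_expectation P).
Context (W : nat -> nat -> T -> C).
Context (entW : independent_centered_entries P W).
Context (hermW : forall i j w, W j i w = ((W i j w)^*)%C).
Local Notation algT := (alg W all_edges).
Local Notation moment := (moment P).
Local Notation bdd := (bdd P W).

(** A martingale indexed by a list that is revealed from its end: the increment at [z] is given the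
    tail after [z], which plays the role of the past. *)
Fixpoint chainsum (F : nat -> seq nat -> T -> C) (s : seq nat) (w : T) : C :=
  if s is z :: s' then F z s' w + chainsum F s' w else 0.

Definition rt (n : nat) : C := (Num.sqrt n%:R)%:C%C.

(** Iteration of [expr_add_le] along the list. [A s] is the set of entries on which the partial sum
    over [s] depends, and increments are orthogonal to polynomials in these entries. *)
Lemma chain_moment_Re p (F : nat -> seq nat -> T -> C) (S : seq nat)
    (A : seq nat -> nat -> nat -> Prop) n B :
  (0 < n)%N -> 0 <= B ->
  (forall pre s, S = pre ++ s ->
     (forall i j, A s i j -> A s j i) /\ alg W (A s) (chainsum F s)) ->
  (forall pre z s, S = pre ++ z :: s -> [/\ algT (F z s), moment (F z s) p.+1 <= B &
     forall g, alg W (A s) g -> Ec (fun w => F z s w * g w) = 0]) ->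
  \int[P]_w (complex.Re (chainsum F S w) ^+ p.+1.*2) <=
  (1 + n%:R^-1) ^+ size S * ((size S)%:R * (burkholder_cst R p * n%:R ^+ p * B)).
Proof.
move=> n0 B0; elim: S => [|z s IH] hA hF.
  by rewrite /= mul0r mulr0; under eq_Rintegral do rewrite expr0n/=; rewrite Rint_cst.
have {}IH := IH (fun pre s' E => hA (z :: pre) s' (congr1 (cons z) E))
               (fun pre z' s' E => hF (z :: pre) z' s' (congr1 (cons z) E)).
have [symA aZ] := hA [:: z] s erefl.
have [aX XB X0] := hF [::] z s erefl.
pose Z w := complex.Re (chainsum F s w).
pose X w := complex.Re (F z s w).
have ZA k : alg W (A s) (fun w => (Z w ^+ k)%:C%C).
  by under eq_fun do rewrite rmorphXn; apply/algX/alg_Re.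
have ZT k := algT_alg (ZA k).
have XA k : algT (fun w => (X w ^+ k)%:C%C).
  by under eq_fun do rewrite rmorphXn; apply/algX/alg_Re.
have iR (g : T -> R) : algT (fun w => (g w)%:C%C) -> int_ g.
  by move=> h; apply: (alg_real_integrable (A := all_edges) entW hermW).
(* The martingale property, tested against an odd power of the real part of the partial sum, which
   is a polynomial in the past. *)
have ZX0 : \int[P]_w (Z w ^+ p.*2.+1 * X w) = 0.
  have := congr1 (@complex.Re R) (X0 _ (ZA p.*2.+1)); rewrite complex_expectationE /= => E0.
  rewrite -[RHS]E0.
  by apply: eq_Rintegral => w _; rewrite ReM /= mulr0 subr0 mulrC.
have aZX : algT (fun w => (Z w ^+ p.*2.+1 * X w)%:C%C).
  by under eq_fun do rewrite rmorphM; apply: algM; [exact: ZT|exact: (XA 1)].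
apply: (@le_trans _ _ (\int[P]_w ((1 + n%:R^-1) * Z w ^+ p.+1.*2 +
   (p.+1.*2%:R * (Z w ^+ p.*2.+1 * X w) + burkholder_cst R p * n%:R ^+ p * X w ^+ p.+1.*2)))).
  apply: le_int.
  - apply: iR; under eq_fun do rewrite rmorphXn; apply/algX/alg_Re => //=.
    by apply: algD => //; exact: algT_alg aZ.
  - apply: intD; first by apply: intZ; exact: iR.
    by apply: intD; apply: intZ; exact: iR.
  by move=> w; rewrite /= ReD addrC addrA expr_add_le.
have I1 := iR _ (ZT p.+1.*2); have I2 := iR _ aZX; have I3 := iR _ (XA p.+1.*2).
rewrite RintegralD//; [|exact: intZ|by apply: intD; exact: intZ].
rewrite RintegralD//; [|exact: intZ|exact: intZ].
rewrite !RintegralZl// ZX0 mulr0 add0r.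
have XB' : \int[P]_w X w ^+ p.+1.*2 <= B.
  apply: le_trans XB; apply: le_int => //; first exact: (int_nsqX entW hermW).
  move=> w; rewrite -mul2n exprM lerXn2r ?nnegrE ?sqr_ge0 ?nsq_ge0//.
  by rewrite /nsq lerDl sqr_ge0.
have q1 : 1 <= 1 + n%:R^-1 :> R by rewrite lerDl invr_ge0.
have q0 : 0 <= 1 + n%:R^-1 :> R by rewrite (le_trans _ q1).
have b0 : 0 <= burkholder_cst R p * n%:R ^+ p.
  by rewrite mulr_ge0 ?exprn_ge0// mulr_ge0 ?exprn_ge0.
apply: (@le_trans _ _ ((1 + n%:R^-1) * ((1 + n%:R^-1) ^+ size s * ((size s)%:R * (burkholder_cst R p * n%:R ^+ p * B)))
  + burkholder_cst R p * n%:R ^+ p * B)).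
  by apply: lerD; [exact: ler_wpM2l|exact: ler_wpM2l].
rewrite /= mulrA -exprS -natr1 [X in _ <= _ * X]mulrDl mul1r mulrDr lerD2l.
by rewrite ler_peMl ?exprn_ege1// mulr_ge0.
Qed.

(** Real and imaginary parts are bounded separately, and (1 + 1/n)^n is at most e. *)
Lemma chain_moment p (F : nat -> seq nat -> T -> C) (S : seq nat)
    (A : seq nat -> nat -> nat -> Prop) n B :
  (0 < n)%N -> 0 <= B -> (size S <= n)%N ->
  (forall pre s, S = pre ++ s ->
     (forall i j, A s i j -> A s j i) /\ alg W (A s) (chainsum F s)) ->
  (forall pre z s, S = pre ++ z :: s -> [/\ algT (F z s), moment (F z s) p.+1 <= B &
     forall g, alg W (A s) g -> Ec (fun w => F z s w * g w) = 0]) ->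
  moment (chainsum F S) p.+1 <=
  2 ^+ p.+2 * expR 1 * burkholder_cst R p * B * n%:R ^+ p.+1.
Proof.
move=> n0 B0 Sn hA hF.
have aS : algT (chainsum F S) by have [_] := hA [::] S erefl; exact: algT_alg.
have HR := chain_moment_Re n0 B0 hA hF.
(* Multiplication by -i makes the imaginary part of the chain the real part of another chain with
   the same bounds. *)
pose G z s w : C := - 'i%C * F z s w.
have GE s w : chainsum G s w = - 'i%C * chainsum F s w.
  by elim: s => [|z s IH] /=; rewrite ?mulr0// IH mulrDr.
have nG z s : moment (G z s) p.+1 = moment (F z s) p.+1.
  apply: eq_Rintegral => w _; rewrite nsqM nsqN.
  by rewrite [nsq 'i%C](_ : _ = 1) ?mul1r// /nsq/= expr1n expr0n add0r.
have hA' pre s : S = pre ++ s ->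
    (forall i j, A s i j -> A s j i) /\ alg W (A s) (chainsum G s).
  move=> /hA[? aF]; split => //.
  by rewrite (_ : chainsum G s = fun w => - 'i%C * chainsum F s w); [exact: algZ|exact/funext].
have hF' pre z s : S = pre ++ z :: s -> [/\ algT (G z s), moment (G z s) p.+1 <= B &
     forall g, alg W (A s) g -> Ec (fun w => G z s w * g w) = 0].
  move=> E; have [aF mF zF] := hF _ _ _ E; split; first exact: algZ.
    by rewrite nG.
  move=> g ag; under eq_fun do rewrite -mulrA.
  rewrite (EcZ entW hermW (A := all_edges)); last by apply: algM => //; exact: algT_alg ag.
  by rewrite zF// mulr0.
have HI := chain_moment_Re n0 B0 hA' hF'.
have iR (g : T -> R) : algT (fun w => (g w)%:C%C) -> int_ g.
  by move=> h; apply: (alg_real_integrable (A := all_edges) entW hermW).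
have IR : int_ (fun w => complex.Re (chainsum F S w) ^+ p.+1.*2).
  by apply: iR; under eq_fun do rewrite rmorphXn; apply/algX/alg_Re.
have II : int_ (fun w => complex.Re (chainsum G S w) ^+ p.+1.*2).
  apply: iR; under eq_fun do rewrite rmorphXn; apply/algX/alg_Re => //.
  by have [_] := hA' [::] S erefl; exact: algT_alg.
apply: (@le_trans _ _ (\int[P]_w (2 ^+ p.+1 * (complex.Re (chainsum F S w) ^+ p.+1.*2 + complex.Re (chainsum G S w) ^+ p.+1.*2)))).
  apply: le_int; [exact: (int_nsqX entW hermW)|exact/intZ/intD|].
  move=> w; rewrite GE -!mul2n !exprM.
  rewrite (_ : complex.Re (- 'i%C * chainsum F S w) = complex.Im (chainsum F S w)); last first.
    by rewrite ReM/=; ring.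
  by rewrite exprD_le ?sqr_ge0.
rewrite RintegralZl//; last exact/intD.
rewrite RintegralD//.
pose u : R := n%:R; have u0 : 0 < u by rewrite ltr0n.
have Bn0 : 0 <= burkholder_cst R p * n%:R ^+ p * B.
  by rewrite !mulr_ge0 ?exprn_ge0 ?mulr_ge0 ?exprn_ge0.
have key0 : (1 + u^-1) ^+ size S * ((size S)%:R * (burkholder_cst R p * u ^+ p * B)) <=
   expR 1 * (u * (burkholder_cst R p * u ^+ p * B)).
  apply: ler_pM.
  - by rewrite exprn_ge0// addr_ge0// invr_ge0 ltW.
  - by rewrite mulr_ge0.
  - apply: (@le_trans _ _ ((1 + u^-1) ^+ n)).
      by rewrite ler_weXn2l// lerDl invr_ge0 ltW.
    have -> : 1 = n%:R * u^-1 :> R by rewrite mulfV// gt_eqF.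
    rewrite expRM_natl lerXn2r ?nnegrE ?expR_ge0//.
      by rewrite addr_ge0 ?invr_ge0 ?(ltW u0)// mulr_ge0 ?invr_ge0 ?(ltW u0).
    by rewrite (_ : n%:R / u = 1) ?expR_ge1Dx// mulfV// gt_eqF.
  - by rewrite ler_wpM2r// ler_nat.
apply: (@le_trans _ _ (2 ^+ p.+1 * (expR 1 * (u * (burkholder_cst R p * u ^+ p * B)) +
   expR 1 * (u * (burkholder_cst R p * u ^+ p * B))))).
  by rewrite ler_wpM2l ?exprn_ge0// lerD// (le_trans _ key0).
by rewrite -/u !exprS le_eqVlt; apply/orP; left; apply/eqP; ring.
Qed.

(** The Burkholder-type estimate in uniform form: [N] bounded martingale increments add up to order
    sqrt N, whereas the triangle inequality would give order N. *)
Lemma bdd_chain (J : Type) (D : J -> Prop) (S : J -> seq nat) (N : J -> nat)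
    (F : J -> nat -> seq nat -> T -> C) (A : J -> seq nat -> nat -> nat -> Prop) :
  (forall j, D j -> (size (S j) <= N j)%N /\ (0 < N j)%N) ->
  bdd (fun k : J * nat * seq nat => D k.1.1 /\ exists pre, S k.1.1 = pre ++ k.1.2 :: k.2)
      (fun k => F k.1.1 k.1.2 k.2) ->
  (forall j pre s, D j -> S j = pre ++ s ->
     (forall i i', A j s i i' -> A j s i' i) /\ alg W (A j s) (chainsum (F j) s)) ->
  (forall j pre z s g, D j -> S j = pre ++ z :: s -> alg W (A j s) g ->
     Ec (fun w => F j z s w * g w) = 0) ->
  bdd D (fun j w => (rt (N j))^-1 * chainsum (F j) (S j) w).
Proof.
move=> DS [aF bF] hA hE.
have aS j : D j -> algT (chainsum (F j) (S j)).
  by move=> Dj; have [_] := hA j [::] (S j) Dj erefl; exact: algT_alg.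
split; first by move=> j Dj; apply: algZ; exact: aS.
case=> [|p].
  exists 1 => j Dj; rewrite /moment; under eq_Rintegral do rewrite expr0.
  by rewrite Rint_cst.
have [K HK] := bF p.+1; pose B := Num.max K 0.
have B0 : 0 <= B by rewrite le_max lexx orbT.
exists (2 ^+ p.+2 * expR 1 * burkholder_cst R p * B) => j Dj.
have [SN N0] := DS _ Dj; have u0 : 0 < (N j)%:R :> R by rewrite ltr0n.
have H := @chain_moment p (F j) (S j) (A j) (N j) B N0 B0 SN.
have {}H := H (fun pre s => hA j pre s Dj).
have h2 pre z s : S j = pre ++ z :: s -> [/\ algT (F j z s), moment (F j z s) p.+1 <= B &
     forall g, alg W (A j s) g -> Ec (fun w => F j z s w * g w) = 0].
  move=> E; have Dk : D j /\ exists pre, S j = pre ++ z :: s by split => //; exists pre.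
  split; first exact: (aF (j, z, s)).
    by rewrite le_max (HK (j, z, s) Dk).
  by move=> g; apply: hE E.
have {}H := H h2.
have nE w : nsq ((rt (N j))^-1 * chainsum (F j) (S j) w) ^+ p.+1 =
   (N j)%:R ^- p.+1 * nsq (chainsum (F j) (S j) w) ^+ p.+1.
  rewrite nsqM exprMn /rt -fmorphV nsq_real exprVn sqr_sqrtr ?ltW//.
  by rewrite exprVn.
rewrite /moment; under eq_Rintegral do rewrite nE.
rewrite RintegralZl//; last by apply: (int_nsqX entW hermW) => //; exact: aS.
rewrite ler_pdivrMl ?exprn_gt0//; apply: le_trans H _.
by rewrite mulrC.
Qed.

End martingale_chains.

(** * Formal power series *)

Section fps.
Context (A : comNzRingType).

(** The coefficient sequence. It is given a commutative ring structure so that identities between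
    generating series are accessible to [ring]. *)
Definition fps := nat -> A.

HB.instance Definition _ := gen_eqMixin fps.
HB.instance Definition _ := gen_choiceMixin fps.
HB.instance Definition _ := GRing.Zmodule.copy fps (nat -> A).

Definition fps_one : fps := fun k => (k == 0%N)%:R.
Definition fps_mul (f g : fps) : fps :=
  fun k => \sum_(i < k.+1) f i * g (k - i)%N.

(** Each coefficient of a product depends on finitely many coefficients, so associativity and
    commutativity are inherited from truncations to polynomials. *)
Let trunc n (f : fps) : {poly A} := \poly_(i < n) f i.

Let fps_mulE n k f g : (k < n)%N -> fps_mul f g k = (trunc n f * trunc n g)`_k.
Proof.
move=> kn; rewrite coefM; apply: eq_bigr => i _; rewrite !coef_poly.
by rewrite (leq_ltn_trans _ kn) ?(leq_ltn_trans (leq_subr _ _) kn)// -ltnS.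
Qed.

Let fps_mulC : commutative fps_mul.
Proof. by move=> f g; apply/funext => k; rewrite !(@fps_mulE k.+1)// mulrC. Qed.

Let fps_mulA : associative fps_mul.
Proof.
move=> f g h; apply/funext => k.
transitivity ((trunc k.+1 f * trunc k.+1 g * trunc k.+1 h)`_k).
  rewrite -mulrA coefM; apply: eq_bigr => i _.
  rewrite (@fps_mulE k.+1) ?coef_poly ?ltn_ord//.
  by rewrite ltnS leq_subr.
rewrite coefM; apply: eq_bigr => i _.
by rewrite (@fps_mulE k.+1 i)// coef_poly ltnS leq_subr.
Qed.

Let fps_mul1 : left_id fps_one fps_mul.
Proof.
move=> f; apply/funext => k; rewrite /fps_mul big_ord_recl /= subn0 mul1r.
by rewrite big1 ?addr0// => i _; rewrite /fps_one mul0r.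
Qed.

Let fps_mulDl : left_distributive fps_mul +%R.
Proof.
move=> f g h; apply/funext => k; rewrite /fps_mul.
transitivity (\sum_(i < k.+1) (f i * h (k - i)%N + g i * h (k - i)%N)).
  by apply: eq_bigr => i _; rewrite -mulrDl.
by rewrite big_split.
Qed.

Let fps_one_neq0 : fps_one != 0.
Proof.
by apply/eqP => /(congr1 (fun f : fps => f 0%N)) /eqP; rewrite /fps_one eqxx oner_eq0.
Qed.

HB.instance Definition _ := GRing.Zmodule_isComNzRing.Build fps
  fps_mulA fps_mulC fps_mul1 fps_mulDl fps_one_neq0.

Implicit Types f g : fps.

Lemma fpsM_coef f g k : (f * g) k = \sum_(i < k.+1) f i * g (k - i)%N.
Proof. by []. Qed.

Lemma fpsD_coef f g k : (f + g) k = f k + g k.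
Proof. by []. Qed.

Lemma fpsN_coef f k : (- f) k = - f k.
Proof. by []. Qed.

Lemma fps1_coef k : (1 : fps) k = (k == 0%N)%:R.
Proof. by []. Qed.

Lemma fps0_coef k : (0 : fps) k = 0.
Proof. by []. Qed.

Definition fpsX : fps := fun k => (k == 1%N)%:R.

Lemma fpsXM_coef f k : (fpsX * f) k = if k is j.+1 then f j else 0.
Proof.
rewrite fpsM_coef; case: k => [|k]; first by rewrite big_ord1 mul0r.
rewrite 2!big_ord_recl mul0r add0r /= /bump/= mul1r subSS subn0.
by rewrite big1 ?addr0// => i _; rewrite /fpsX mul0r.
Qed.

Lemma fpsX2M_coef f k : (fpsX ^+ 2 * f) k = if k is j.+2 then f j else 0.
Proof. by rewrite expr2 -mulrA fpsXM_coef; case: k => // k; rewrite fpsXM_coef. Qed.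

Definition fpsC (a : A) : fps := fun k => if k == 0%N then a else 0.

Lemma fpsCM_coef a f k : (fpsC a * f) k = a * f k.
Proof.
rewrite fpsM_coef big_ord_recl /= subn0 big1 ?addr0// => i _.
by rewrite /fpsC /= mul0r.
Qed.

Lemma fpsCD a b : fpsC (a + b) = fpsC a + fpsC b.
Proof. by apply/funext => k; rewrite fpsD_coef /fpsC; case: ifP => _; rewrite ?addr0. Qed.

Lemma fpsCM a b : fpsC (a * b) = fpsC a * fpsC b.
Proof. by apply/funext => k; rewrite fpsCM_coef /fpsC; case: ifP => _; rewrite ?mulr0. Qed.

Lemma fpsC1 : fpsC 1 = 1.
Proof. by apply/funext => k; rewrite fps1_coef /fpsC; case: ifP. Qed.

Lemma fpsXM_inj f g : fpsX * f = fpsX * g -> f = g.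
Proof.
move=> h; apply/funext => k.
by have := congr1 (fun u : fps => u k.+1) h; rewrite /= !fpsXM_coef.
Qed.

(* The Euler operator t d/dt. *)
Definition theta f : fps := fun k => k%:R * f k.

Lemma thetaD f g : theta (f + g) = theta f + theta g.
Proof. by apply/funext => k; rewrite /theta fpsD_coef mulrDr. Qed.

Lemma thetaM f g : theta (f * g) = theta f * g + f * theta g.
Proof.
apply/funext => k; rewrite fpsD_coef /theta !fpsM_coef mulr_sumr -big_split/=.
apply: eq_bigr => i _.
have -> : k%:R = i%:R + (k - i)%:R :> A by rewrite -natrD subnKC// -ltnS.
by ring.
Qed.

Lemma theta1 : theta 1 = 0.
Proof.
apply/funext => k; rewrite /theta fps1_coef.
by case: k => [|k]; rewrite ?mul0r ?mulr0.
Qed.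

Lemma thetaX : theta fpsX = fpsX.
Proof.
by apply/funext => -[|[|k]]; rewrite /theta /fpsX /= ?mul0r ?mulr0 ?mul1r.
Qed.

End fps.

(** * Walks and their decomposition at a vertex *)

Section walks.
Context (A : comNzRingType).
Implicit Types (M : nat -> nat -> A) (S : seq nat).

(** For a duplicate-free [S] containing [u] and [v], the entry at [u], [v] of the k-th power of [M]
    restricted to [S]. With a list of vertices in place of a matrix size, deleting a vertex is
    [rem]. *)
Fixpoint walk M S (k u v : nat) : A :=
  if k is k'.+1 then \sum_(z <- S) M u z * walk M S k' z v else (u == v)%:R.

Lemma sum_delta S u (F : nat -> A) : uniq S -> u \in S ->
  \sum_(z <- S) (u == z)%:R * F z = F u.
Proof.
move=> uS uin; rewrite (bigD1_seq u)//= eqxx mul1r big1 ?addr0// => z /negbTE.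
by rewrite eq_sym => ->; rewrite mul0r.
Qed.

Lemma walk_outside M S k u v : v \notin S -> u != v -> walk M S k u v = 0.
Proof.
move=> vS; elim: k u => [|k IH] u uv /=; first by rewrite (negbTE uv).
rewrite big_seq big1// => z zS; rewrite IH ?mulr0//.
by apply: contraNneq vS => <-.
Qed.

Lemma walkSr M S k u v : uniq S -> u \in S -> v \in S ->
  walk M S k.+1 u v = \sum_(z <- S) walk M S k u z * M z v.
Proof.
move=> uS; elim: k u => [|k IH] u uin vin.
  rewrite /= (sum_delta (fun z => M z v))//.
  transitivity (\sum_(z <- S) (v == z)%:R * M u z); last by rewrite sum_delta.
  by apply: eq_bigr => z _; rewrite mulrC eq_sym.
transitivity (\sum_(z <- S) M u z * \sum_(y <- S) walk M S k z y * M y v).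
  by apply: eq_big_seq => z zS; rewrite -IH.
under eq_bigr do rewrite mulr_sumr.
rewrite exchange_big/=; apply: eq_bigr => y _.
by rewrite mulr_suml; apply: eq_bigr => z _; rewrite mulrA.
Qed.

Lemma walk_transpose M S k u v : uniq S -> u \in S -> v \in S ->
  walk (fun a b => M b a) S k u v = walk M S k v u.
Proof.
move=> uS; elim: k u => [|k IH] u uin vin; first by rewrite /= eq_sym.
rewrite [RHS]walkSr//=; apply: eq_big_seq => z zS.
by rewrite IH// mulrC.
Qed.

Lemma sum_rem S i (F : nat -> A) : i \in S ->
  \sum_(z <- S) F z = F i + \sum_(z <- rem i S) F z.
Proof. by move=> iS; rewrite (perm_big _ (perm_to_rem iS)) big_cons. Qed.

(* Walks of length j + 1 from u, staying in S until their last step, which goes to i. *)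
Definition entrance M S i j u : A := \sum_(z <- S) walk M S j u z * M z i.

Lemma entranceS M S i j u :
  entrance M S i j.+1 u = \sum_(z <- S) M u z * entrance M S i j z.
Proof.
rewrite /entrance; under [RHS]eq_bigr do rewrite mulr_sumr.
rewrite exchange_big/=; apply: eq_bigr => y _.
by rewrite mulr_suml; apply: eq_bigr => z _; rewrite mulrA.
Qed.

(** A walk from [u] either avoids [i], or enters [i] for the first time at step [j + 1] and
    continues freely from there. *)
Lemma walk_passage M S i k u v : uniq S -> i \in S -> u \in rem i S ->
  walk M S k u v = walk M (rem i S) k u v +
    \sum_(j < k) entrance M (rem i S) i j u * walk M S (k.-1 - j)%N i v.
Proof.
move=> uS iS; have uS' : uniq (rem i S) by exact: rem_uniq.
elim: k u => [|k IH] u uin; first by rewrite big_ord0 addr0.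
rewrite /= (sum_rem _ iS).
rewrite [X in _ + X](_ : _ = \sum_(z <- rem i S) (M u z * walk M (rem i S) k z v +
   \sum_(j < k) M u z * entrance M (rem i S) i j z * walk M S (k.-1 - j)%N i v)); last first.
  apply: eq_big_seq => z zS; rewrite IH// mulrDr mulr_sumr; congr (_ + _).
  by apply: eq_bigr => j _; rewrite mulrA.
rewrite big_split/= addrCA; congr (_ + _).
rewrite big_ord_recl /= subn0; congr (_ + _).
  by congr (_ * _); rewrite /entrance sum_delta.
rewrite exchange_big/=; apply: eq_bigr => j _; rewrite -mulr_suml -entranceS.
congr (_ * walk _ _ _ _ _); rewrite /bump /=; case: k j {IH} => [|k] [j /= jk] //.
Qed.

(* The e_j of the first-return decomposition. *)
Definition excursion M S i : fps A := fun k =>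
  match k with
  | 0 => 0
  | 1 => M i i
  | j.+2 => \sum_(u <- S) M i u * entrance M S i j u
  end.

Definition loops M S i : fps A := fun k => walk M S k i i.

(** Cut a closed walk at its first return to [i]. This is the Schur complement formula for a
    diagonal entry of the resolvent, as an identity of formal series. *)
Lemma loops_renewal M S i : uniq S -> i \in S ->
  loops M S i = 1 + excursion M (rem i S) i * loops M S i.
Proof.
move=> uS iS; apply/funext => -[|k].
  by rewrite fpsD_coef fps1_coef fpsM_coef big_ord1 mul0r addr0 /loops /= eqxx.
rewrite fpsD_coef fps1_coef add0r fpsM_coef big_ord_recl mul0r add0r.
rewrite big_ord_recl /= /bump /= subSS subn0 /loops /= (sum_rem _ iS); congr (_ + _).
have iS' : i \notin rem i S by rewrite mem_rem_uniqF.
rewrite [LHS](_ : _ = \sum_(z <- rem i S)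
   \sum_(j < k) M i z * entrance M (rem i S) i j z * walk M S (k.-1 - j)%N i i); last first.
  (* A walk that stays off [i] cannot end at [i], so only the entrance terms survive. *)
  apply: eq_big_seq => z zS; rewrite (walk_passage _ _ _ uS iS zS) walk_outside//.
    by rewrite add0r mulr_sumr; apply: eq_bigr => j _; rewrite mulrA.
  by apply: contraNneq iS' => zi; rewrite -{1}zi.
rewrite exchange_big/=; apply: eq_bigr => j _; rewrite -mulr_suml.
by congr (_ * walk _ _ _ _ _); case: k j => [|k] [j /= jk].
Qed.

End walks.

Lemma walk_morph (A B : comNzRingType) (phi : {rmorphism A -> B}) M S k u v :
  phi (walk M S k u v) = walk (fun a b => phi (M a b)) S k u v.
Proof.
elim: k u => [|k IH] u /=; first by rewrite rmorph_nat.
by rewrite rmorph_sum/=; apply: eq_bigr => z _; rewrite rmorphM IH.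
Qed.

(** * Orders of magnitude in powers of N^(-1/2) *)

Section order_calculus.
Context d (T : measurableType d) (R : realType) (P : probability T R).
Local Notation C := R[i].
Local Notation Ec := (complex_expectation P).
Context (W : nat -> nat -> T -> C).
Context (entW : independent_centered_entries P W).
Context (hermW : forall i j w, W j i w = ((W i j w)^*)%C).
Local Notation algT := (alg W all_edges).
Local Notation bdd := (bdd P W).
Local Notation rt := (@rt R).

Lemma rt_conj n : ((rt n)^*)%C = rt n.
Proof. by rewrite /rt conjc_real. Qed.

Lemma rt_sqr n : rt n ^+ 2 = n%:R.
Proof. by rewrite /rt -rmorphXn/= sqr_sqrtr// rmorph_nat. Qed.

Lemma nsq_rt n : nsq (rt n) = n%:R.
Proof. by rewrite /rt nsq_real sqr_sqrtr. Qed.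

Lemma rt_neq0 n : (0 < n)%N -> rt n != 0.
Proof.
by move=> n0; rewrite /rt -[0](rmorph0 (real_complex R)) (inj_eq (@complexI R)) gt_eqF// sqrtr_gt0 ltr0n.
Qed.

(* A family F_j is of order N_j^(-s/2) in every L^p. *)
Definition Ob (J : Type) (N : J -> nat) (s : nat) (D : J -> Prop) (F : J -> T -> C) :=
  bdd D (fun j w => rt (N j) ^+ s * F j w).

Section families.
Context (J : Type) (N : J -> nat) (D : J -> Prop).
Implicit Types F G : J -> T -> C.
Local Notation Ob := (Ob N).

Lemma Ob_alg s F : (forall j, D j -> (0 < N j)%N) -> Ob s D F ->
  forall j, D j -> algT (F j).
Proof.
move=> N0 [aF _] j Dj; have := algZ ((rt (N j) ^+ s)^-1) (aF j Dj).
congr alg; apply/funext => w; rewrite mulrA mulVf ?mul1r// expf_neq0// rt_neq0//.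
exact: N0.
Qed.

Lemma Ob0 F : bdd D F -> Ob 0 D F.
Proof. by apply: bdd_ext => j w _; rewrite mul1r. Qed.

Lemma Ob_ext s F G : (forall j w, D j -> F j w = G j w) -> Ob s D F -> Ob s D G.
Proof. by move=> FG; apply: bdd_ext => j w /FG ->. Qed.

Lemma ObD s F G : Ob s D F -> Ob s D G -> Ob s D (fun j w => F j w + G j w).
Proof.
move=> oF oG; apply: bdd_ext (bddD entW hermW oF oG) => j w _.
by rewrite mulrDr.
Qed.

Lemma ObN s F : Ob s D F -> Ob s D (fun j w => - F j w).
Proof. by move=> oF; apply: bdd_ext (bddN entW hermW oF) => j w _; rewrite mulrN. Qed.

Lemma ObB s F G : Ob s D F -> Ob s D G -> Ob s D (fun j w => F j w - G j w).
Proof. by move=> oF oG; apply: ObD => //; exact: ObN. Qed.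

Lemma ObM s s' F G : Ob s D F -> Ob s' D G -> Ob (s + s') D (fun j w => F j w * G j w).
Proof.
move=> oF oG; apply: bdd_ext (bddM entW hermW oF oG) => j w _.
by rewrite exprD; ring.
Qed.

Lemma Ob_cst (a : C) : Ob 0 D (fun _ _ => a).
Proof. by apply/Ob0/bdd_cst. Qed.

Lemma ObZ s (a : C) F : Ob s D F -> Ob s D (fun j w => a * F j w).
Proof. by move=> oF; apply: (ObM (s := 0)) => //; exact: Ob_cst. Qed.

Lemma Ob_conj s F : Ob s D F -> Ob s D (fun j w => ((F j w)^*)%C).
Proof.
move=> oF; apply: bdd_ext (bdd_conj hermW oF) => j w _.
by rewrite rmorphM rmorphXn [X in X ^+ _ * _]rt_conj.
Qed.

Lemma Ob_sum_ord s n (F : 'I_n -> J -> T -> C) : (forall i, Ob s D (F i)) ->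
  Ob s D (fun j w => \sum_(i < n) F i j w).
Proof.
move=> oF; apply: bdd_ext (bdd_sum_ord entW hermW oF) => j w _.
by rewrite mulr_sumr.
Qed.

Lemma Ob_invrt : (forall j, D j -> (0 < N j)%N) -> Ob 1 D (fun j _ => (rt (N j))^-1).
Proof.
move=> N0; apply: (@bdd_ext _ _ _ _ _ _ _ (fun _ _ => 1)).
  by move=> j w /N0 Nj; rewrite mulfV// rt_neq0.
exact: bdd_cst.
Qed.

Lemma Ob_invN : (forall j, D j -> (0 < N j)%N) -> Ob 2 D (fun j _ => (N j)%:R^-1).
Proof.
move=> N0; apply: Ob_ext (ObM (Ob_invrt N0) (Ob_invrt N0)) => j w _.
by rewrite -invfM -expr2 rt_sqr.
Qed.

Lemma Ob_weaken s s' F : (s' <= s)%N -> (forall j, D j -> (0 < N j)%N) ->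
  Ob s D F -> Ob s' D F.
Proof.
move=> ss N0 oF; rewrite -(subnK ss) in oF.
have oV : bdd D (fun j _ => (rt (N j))^-1 ^+ (s - s')).
  apply: (@bdd_cst _ _ _ _ _ _ _ _ 1) => j /N0 Nj.
  rewrite nsqX /rt -fmorphV nsq_real exprVn sqr_sqrtr//.
  by rewrite exprn_ile1// ?invr_ge0// invf_le1 ?ler1n// ltr0n.
apply: bdd_ext (bddM entW hermW oV oF) => j w /N0 Nj.
by rewrite exprVn exprD -!mulrA mulKf// expf_neq0// rt_neq0.
Qed.

Lemma Ob_expectation s F : (forall j, D j -> (0 < N j)%N) -> Ob s D F ->
  Ob s D (fun j _ => Ec (F j)).
Proof.
move=> N0 oF; have [K HK] := bdd_expectation entW hermW oF.
apply: (@bdd_cst _ _ _ _ _ _ _ _ K) => j Dj.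
by rewrite -(EcZ entW hermW _ (Ob_alg N0 oF Dj)) HK.
Qed.

Lemma Ob_prod_fps s s' K (F G : J -> T -> fps C) :
  (forall k, (k <= K)%N -> Ob s D (fun j w => F j w k)) ->
  (forall k, (k <= K)%N -> Ob s' D (fun j w => G j w k)) ->
  forall k, (k <= K)%N -> Ob (s + s') D (fun j w => (F j w * G j w) k).
Proof.
move=> oF oG k kK.
apply: (@Ob_ext _ (fun j w => \sum_(i < k.+1) F j w i * G j w (k - i)%N)) => //.
apply: Ob_sum_ord => i; apply: ObM.
  by apply: oF; rewrite (leq_trans _ kK)// -ltnS.
by apply: oG; rewrite (leq_trans (leq_subr _ _)).
Qed.

Lemma Ob_average s (S : J -> seq nat) (F : J -> nat -> T -> C) :
  (forall j, D j -> (size (S j) <= N j)%N /\ (0 < N j)%N) ->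
  bdd (fun ju => D ju.1 /\ ju.2 \in S ju.1) (fun ju w => rt (N ju.1) ^+ s * F ju.1 ju.2 w) ->
  Ob s D (fun j w => (N j)%:R^-1 * \sum_(u <- S j) F j u w).
Proof.
move=> DS oF; have := bdd_average (F := fun j u w => rt (N j) ^+ s * F j u w) entW hermW DS oF.
by apply: bdd_ext => j w _; rewrite -mulr_sumr; ring.
Qed.

End families.

Lemma Ob_reindex (J J' : Type) (N : J -> nat) (N' : J' -> nat) s (D : J -> Prop)
   (D' : J' -> Prop) (g : J' -> J) (F : J -> T -> C) :
  (forall j, D' j -> D (g j)) -> (forall j, N' j = N (g j)) ->
  Ob N s D F -> Ob N' s D' (fun j => F (g j)).
Proof.
move=> DD NN oF; apply: bdd_ext (bdd_reindex DD oF) => j w _.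
by rewrite NN.
Qed.

End order_calculus.

(** * Rows and quadratic forms of the matrix *)

Lemma chainsum_sum d (T : measurableType d) (R : realType) (F : nat -> T -> R[i]) s w :
  chainsum (fun z _ => F z) s w = \sum_(z <- s) F z w.
Proof. by elim: s => [|z s IH] /=; rewrite ?big_nil// big_cons IH. Qed.

Lemma quadratic_cons (A : comNzRingType) (a b : nat -> A) (m : nat -> nat -> A) z s :
  \sum_(u <- z :: s) \sum_(v <- z :: s) a u * m u v * b v =
  a z * m z z * b z + a z * (\sum_(v <- s) m z v * b v) +
  (\sum_(u <- s) a u * m u z) * b z + \sum_(u <- s) \sum_(v <- s) a u * m u v * b v.
Proof.
transitivity (\sum_(u <- z :: s) (a u * m u z * b z + \sum_(v <- s) a u * m u v * b v)).
  by apply: eq_bigr => u _; rewrite big_cons.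
rewrite big_split/= !big_cons -mulr_suml.
have -> : \sum_(v <- s) a z * m z v * b v = a z * \sum_(v <- s) m z v * b v.
  by rewrite mulr_sumr; apply: eq_bigr => v _; rewrite mulrA.
by ring.
Qed.

(** One index type for all families: the normalisation, the vertex set, a distinguished vertex, a
    second vertex, and a list of vertices over which a row is summed. The normalisation is kept
    apart from the size of the set so that vertices can be removed without rescaling. *)
Record idx := Idx { iN : nat; iS : seq nat; ii : nat; iu : nat; il : seq nat }.

Section wigner.
Context d (T : measurableType d) (R : realType) (P : probability T R).
Local Notation C := R[i].
Local Notation Ec := (complex_expectation P).
Context (W : nat -> nat -> T -> C).
Context (entW : independent_centered_entries P W).
Context (hermW : forall i j w, W j i w = ((W i j w)^*)%C).
Context (sigma : R) (sigma_gt0 : 0 < sigma).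
Context (varW : forall i j, i != j -> Ec (fun w => W i j w * W j i w) = (sigma ^+ 2)%:C%C).
Local Notation algT := (alg W all_edges).
Local Notation bdd := (bdd P W).
Local Notation rt := (@rt R).
Local Notation Ob := (Ob P W).

(** [scaled] is the entry of the matrix under study; [reduced] is free of [N] and has unit variance
    off the diagonal. *)
Definition scaled N i j w : C := ((Num.sqrt N%:R * sigma)^-1)%:C%C * W i j w.
Definition reduced i j w : C := (sigma^-1)%:C%C * W i j w.
Local Notation X := scaled.
Local Notation V := reduced.

Lemma scaled_conj N i j w : ((X N i j w)^*)%C = X N j i w.
Proof. by rewrite /X rmorphM [X in X * _]conjc_real [in RHS]hermW. Qed.

Lemma rt_scaled N i j w : (0 < N)%N -> rt N * X N i j w = V i j w.
Proof.
move=> N0; rewrite /X /V mulrA; congr (_ * _).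
rewrite /rt -rmorphM invfM mulrA mulfV ?mul1r//.
by rewrite gt_eqF// sqrtr_gt0 ltr0n.
Qed.

Lemma alg_scaled (A : nat -> nat -> Prop) N i j : A i j -> alg W A (X N i j).
Proof. by move=> Aij; apply: algZ; exact: alg_entry. Qed.

Lemma alg_reduced (A : nat -> nat -> Prop) i j : A i j -> alg W A (V i j).
Proof. by move=> Aij; apply: algZ; exact: alg_entry. Qed.

Lemma Ec_entry i j : Ec (W i j) = 0.
Proof. exact: entries_centered. Qed.

Lemma Ec_reduced i j : Ec (V i j) = 0.
Proof.
rewrite (EcZ (A := all_edges) entW hermW); last exact: alg_entry.
by rewrite Ec_entry mulr0.
Qed.

Lemma Ec_reduced2 i j : i != j -> Ec (fun w => V i j w * V j i w) = 1.
Proof.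
move=> ij; rewrite /V.
under eq_fun => w do rewrite mulrACA.
rewrite (EcZ (A := all_edges) entW hermW); last by apply: algM; exact: alg_entry.
rewrite varW// -!rmorphM/=; apply: complex_ext => //=; field.
by rewrite gt_eqF.
Qed.

Lemma bdd_reduced : bdd (fun _ : nat * nat => True) (fun e => V e.1 e.2).
Proof.
apply: (bddZ (K := sigma^-1 ^+ 2) entW hermW); first by move=> j _; rewrite nsq_real.
split; first by move=> e _; exact: alg_entry.
move=> p; have [c Hc] := entries_moments entW p.*2; exists c => -[i j] _.
rewrite /moment; under eq_Rintegral do rewrite nsq_normc -exprM mul2n.
have := Hc i j; rewrite /abs_moment unlock -lee_fin => h.
have I := integrable_normcX entW i j p.*2.
by rewrite /Rintegral fineK//; exact: integrable_fin_num.
Qed.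

Lemma bdd_reduced_family (J : Type) (D : J -> Prop) (a b : J -> nat) :
  bdd D (fun j => V (a j) (b j)).
Proof. exact: (bdd_reindex (g := fun j => (a j, b j)) _ bdd_reduced). Qed.

Lemma Ob_scaled (J : Type) (N : J -> nat) (D : J -> Prop) (a b : J -> nat) :
  (forall j, D j -> (0 < N j)%N) -> Ob N 1 D (fun j => X (N j) (a j) (b j)).
Proof.
move=> N0; apply: bdd_ext (bdd_reduced_family D a b) => j w Dj.
by rewrite expr1 rt_scaled// N0.
Qed.

Definition wk N S k u v w : C := walk (fun a b => X N a b w) S k u v.
Definition ent N S i k u w : C := entrance (fun a b => X N a b w) S i k u.
Definition within (S : seq nat) (a b : nat) : Prop := a \in S /\ b \in S.
Definition spoke (i z : nat) (a b : nat) : Prop := (a = i /\ b = z) \/ (a = z /\ b = i).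
(** What is known once the row of [i] has been revealed along [s]: all entries inside [S] and those
    joining [i] to [s]. The pair to be revealed next is a [spoke]. *)
Definition past (S : seq nat) i (s : seq nat) (a b : nat) : Prop :=
  within S a b \/ (a = i /\ b \in s) \/ (a \in s /\ b = i).

Lemma alg_wk N S k u v : u \in S -> alg W (within S) (wk N S k u v).
Proof.
move=> uS; elim: k u uS => [|k IH] u uS; first exact: alg_cst.
apply: alg_sum => z zS; apply: algM; first exact: alg_scaled.
exact: IH.
Qed.

Lemma past_sym S i s a b : past S i s a b -> past S i s b a.
Proof. by move=> [[h1 h2]|[[h1 h2]|[h1 h2]]]; [left|right;right|right;left]. Qed.

Lemma within_past S i s a b : within S a b -> past S i s a b.
Proof. by left. Qed.

Lemma spoke_past S i s z : z \in S -> i \notin S -> {subset s <= S} -> z \notin s ->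
  forall a b, spoke i z a b -> ~ past S i s a b /\ ~ past S i s b a.
Proof.
move=> zS iS sS zs.
have h a b : spoke i z a b -> ~ past S i s a b.
  move=> [[-> ->]|[-> ->]] [[h1 h2]|[[h1 h2]|[h1 h2]]].
  - by rewrite h1 in iS.
  - by rewrite h2 in zs.
  - by rewrite (sS _ h1) in iS.
  - by rewrite h2 in iS.
  - by rewrite (sS _ h2) in iS.
  - by rewrite h1 in zs.
move=> a b sab; split; first exact: h.
by apply: h; case: sab => -[? ?]; [right|left].
Qed.

Lemma wk_conj N S k u v w : uniq S -> u \in S -> v \in S ->
  ((wk N S k u v w)^*)%C = wk N S k v u w.
Proof.
move=> uS uin vin; rewrite /wk -(walk_transpose _ _ uS)// -[LHS]/(conjc _).
rewrite (walk_morph (conjc : {rmorphism C -> C})); congr (walk _ S k v u).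
by apply/funext => a; apply/funext => b; exact: scaled_conj.
Qed.

Definition dom0 (j : idx) : Prop :=
  [/\ (0 < iN j)%N, uniq (iS j) & (size (iS j) <= iN j)%N].

(** The two orders to be proved for the k-th power: diagonal entries are O(1), off-diagonal entries
    O(N^(-1/2)). *)
Definition diag_ok k := Ob iN 0 (fun j => dom0 j /\ iu j \in iS j)
  (fun j => wk (iN j) (iS j) k (iu j) (iu j)).
Definition offdiag_ok k := Ob iN 1
  (fun j => dom0 j /\ [/\ iu j \in iS j, ii j \in iS j & iu j != ii j])
  (fun j => wk (iN j) (iS j) k (iu j) (ii j)).

Definition partial_row (j : idx) : Prop :=
  dom0 j /\ [/\ iu j \in iS j, ii j \notin iS j, uniq (il j), {subset il j <= iS j} & iu j \notin il j].

Lemma uniq_catr (s1 s2 : seq nat) : uniq (s1 ++ s2) -> uniq s2.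
Proof. by rewrite cat_uniq => /and3P[]. Qed.

Lemma Ec_spoke0 i z A (f g : T -> C) : alg W (spoke i z) f -> Ec f = 0 ->
  alg W A g -> (forall a b, spoke i z a b -> ~ A a b /\ ~ A b a) ->
  Ec (fun w => f w * g w) = 0.
Proof. by move=> af f0 ag dis; rewrite (Ec_indep entW hermW af ag dis) f0 mul0r. Qed.

(** A martingale in the list [il]: the increment is an off-diagonal entry of the power, of order
    N^(-1/2), times a fresh centred entry of the row of [ii j]. Keeping [iu j] out of [il] excludes
    the diagonal entry, which would be too large. *)
Lemma Ob_partial_row k : offdiag_ok k -> Ob iN 0 partial_row
  (fun j w => rt (iN j) * \sum_(l <- il j) wk (iN j) (iS j) k (iu j) l w * X (iN j) l (ii j) w).
Proof.
move=> off; apply: Ob0.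
pose F (j : idx) z (s : seq nat) w : C :=
  (rt (iN j) * wk (iN j) (iS j) k (iu j) z w) * V z (ii j) w.
pose A (j : idx) s := past (iS j) (ii j) s.
have N0 j : partial_row j -> (0 < iN j)%N by case=> -[].
have algF j z s : partial_row j -> z \in il j -> {subset s <= iS j} -> z \in s ->
   alg W (A j s) (F j z s).
  move=> [_ [uS _ _ sub _]] zl sS zs; apply: algM; last by apply: alg_reduced; right; right.
  by apply: algZ; apply: alg_sub (alg_wk _ _ _ uS) => a b; left.
have H := bdd_chain (D := partial_row) (S := il) (N := iN) (F := F) (A := A) entW hermW.
apply: bdd_ext (H _ _ _ _).
- move=> j w Dj; have Nj := N0 j Dj; rewrite /F.
  rewrite (chainsum_sum (fun z w => rt (iN j) * wk (iN j) (iS j) k (iu j) z w * V z (ii j) w)).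
  rewrite !mulr_sumr; apply: eq_bigr => z _; rewrite -(rt_scaled z (ii j) w Nj).
  by field; rewrite rt_neq0.
- move=> j [[N0j uS SN] [_ _ ul sub _]]; split=> //.
  by rewrite (leq_trans _ SN)// uniq_leq_size.
- apply: bddM => //; last exact: bdd_reduced_family.
  have := Ob_reindex (g := fun q : idx * nat * seq nat => Idx (iN q.1.1) (iS q.1.1) q.1.2 (iu q.1.1) [::])
    (N' := fun q => iN q.1.1)
    (D' := fun q : idx * nat * seq nat => partial_row q.1.1 /\ exists pre, il q.1.1 = pre ++ q.1.2 :: q.2)
    _ (fun _ => erefl) off.
  apply => -[[j z] s] /= [[D0 [uS iS' ul sub ul']] [pre E]]; split => //=; split => //.
    by apply: sub; rewrite E mem_cat mem_head orbT.
  by apply: contraNneq ul' => ->; rewrite E mem_cat mem_head orbT.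
- move=> j pre s Dj E; split; first by move=> a b; exact: past_sym.
  have sub' : {subset s <= il j} by move=> x xs; rewrite E mem_cat xs orbT.
  have [_ [uS _ _ sub _]] := Dj.
  rewrite (_ : chainsum (F j) s = fun w => \sum_(z <- s) F j z s w); last first.
    by apply/funext => w; exact: (chainsum_sum (fun z => F j z [::])).
  apply: alg_sum => z zs; apply: algF => //; first exact: sub'.
  by move=> x /sub' /sub.
- move=> j pre z s g Dj E ag; have [[_ uS _] [uinS iS' ul sub ul']] := Dj.
  have zl : z \in il j by rewrite E mem_cat mem_head orbT.
  have sS : {subset s <= iS j} by move=> x xs; apply: sub; rewrite E mem_cat inE xs !orbT.
  have zs : z \notin s by move: ul; rewrite E => /uniq_catr /= /andP[].
  rewrite (_ : (fun w => _) = (fun w => V z (ii j) w * ((rt (iN j) * wk (iN j) (iS j) k (iu j) z w) * g w))); last first.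
    by apply/funext => w; rewrite /F; ring.
  apply: (@Ec_spoke0 (ii j) z (A j s)).
  + by apply: alg_reduced; right.
  + exact: Ec_reduced.
  + by apply: algM => //; apply: algZ; apply: alg_sub (alg_wk _ _ _ uinS) => a b; left.
  + by apply: spoke_past => //; exact: sub.
Qed.

(** The diagonal term is O(1) times a matrix entry of order N^(-1/2); the other terms form a partial
    row. *)
Lemma Ob_ent k : diag_ok k -> offdiag_ok k -> Ob iN 1
  (fun j => dom0 j /\ iu j \in iS j /\ ii j \notin iS j)
  (fun j => ent (iN j) (iS j) (ii j) k (iu j)).
Proof.
move=> dk ok.
have N0 j : dom0 j /\ iu j \in iS j /\ ii j \notin iS j -> (0 < iN j)%N by case=> -[].
have O1 := Ob_reindex (g := fun j => j) (N' := iN)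
   (D' := fun j => dom0 j /\ iu j \in iS j /\ ii j \notin iS j) _ (fun _ => erefl) dk.
have {}O1 := O1 (fun j h => conj h.1 h.2.1).
have O2 := ObM entW hermW O1 (Ob_scaled iu ii N0).
have O3 := Ob_reindex (g := fun j => Idx (iN j) (iS j) (ii j) (iu j) (rem (iu j) (iS j)))
   (N' := iN) (D' := fun j => dom0 j /\ iu j \in iS j /\ ii j \notin iS j) _ (fun _ => erefl)
   (Ob_partial_row ok).
have {}O3 : Ob iN 1 (fun j => dom0 j /\ iu j \in iS j /\ ii j \notin iS j)
   (fun j w => \sum_(l <- rem (iu j) (iS j)) wk (iN j) (iS j) k (iu j) l w * X (iN j) l (ii j) w).
  have : forall j, dom0 j /\ iu j \in iS j /\ ii j \notin iS j ->
     partial_row (Idx (iN j) (iS j) (ii j) (iu j) (rem (iu j) (iS j))).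
    move=> j [[h1 h2 h3] [h4 h5]]; split => //; split => //=.
    - exact: rem_uniq.
    - by move=> x /mem_rem.
    - by rewrite mem_rem_uniqF.
  by move=> /O3; apply: bdd_ext => j w _; rewrite mul1r expr1.
apply: Ob_ext (ObD entW hermW O2 O3) => j w [_ [uS _]].
by rewrite /ent /entrance (sum_rem _ uS).
Qed.

(* The fluctuation of a quadratic form in the row i around its conditional expectation. *)
Definition fluct N S i k w : C :=
  \sum_(u <- S) X N i u w * ent N S i k u w - N%:R^-1 * \sum_(u <- S) wk N S k u u w.

(** The change of N times the centred quadratic form when the entries joining [ii j] and [z] are
    revealed: a diagonal term with centred factor, and two terms linear in the new entry. *)
Definition fluct_incr (j : idx) k z (s : seq nat) w : C :=
  (V (ii j) z w * V z (ii j) w - 1) * wk (iN j) (iS j) k z z w +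
  V (ii j) z w * (rt (iN j) * \sum_(l <- s) wk (iN j) (iS j) k z l w * X (iN j) l (ii j) w) +
  (rt (iN j) * \sum_(l <- s) X (iN j) (ii j) l w * wk (iN j) (iS j) k l z w) * V z (ii j) w.

Lemma fluct_incr_sum (j : idx) k s w : (0 < iN j)%N ->
  chainsum (fluct_incr j k) s w =
  (iN j)%:R * (\sum_(u <- s) \sum_(v <- s) X (iN j) (ii j) u w * wk (iN j) (iS j) k u v w * X (iN j) v (ii j) w)
  - \sum_(u <- s) wk (iN j) (iS j) k u u w.
Proof.
move=> N0; elim: s => [|z s IH] /=; first by rewrite !big_nil mulr0 subr0.
rewrite IH /fluct_incr.
rewrite (quadratic_cons (fun u => X (iN j) (ii j) u w) (fun v => X (iN j) v (ii j) w)
  (fun u v => wk (iN j) (iS j) k u v w)).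
by rewrite big_cons -!(rt_scaled _ _ _ N0) -rt_sqr; ring.
Qed.

Lemma fluct_chain (j : idx) k w : (0 < iN j)%N ->
  fluct (iN j) (iS j) (ii j) k w = (iN j)%:R^-1 * chainsum (fluct_incr j k) (iS j) w.
Proof.
move=> N0; rewrite fluct_incr_sum// mulrBr mulrA mulVf ?mul1r; last by rewrite pnatr_eq0 -lt0n.
congr (_ - _); apply: eq_bigr => u _; rewrite /ent /entrance mulr_sumr.
by apply: eq_bigr => v _; rewrite mulrA.
Qed.

End wigner.

(** * Bounds on the entries of the powers *)

Section wigner_bounds.
Context d (T : measurableType d) (R : realType) (P : probability T R).
Local Notation C := R[i].
Local Notation Ec := (complex_expectation P).
Context (W : nat -> nat -> T -> C).
Context (entW : independent_centered_entries P W).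
Context (hermW : forall i j w, W j i w = ((W i j w)^*)%C).
Context (sigma : R) (sigma_gt0 : 0 < sigma).
Context (varW : forall i j, i != j -> Ec (fun w => W i j w * W j i w) = (sigma ^+ 2)%:C%C).
Local Notation algT := (alg W all_edges).
Local Notation bdd := (bdd P W).
Local Notation rt := (@rt R).
Local Notation Ob := (Ob P W).
Local Notation X := (scaled W sigma).
Local Notation V := (reduced W sigma).
Local Notation wk := (wk W sigma).
Local Notation ent := (ent W sigma).
Local Notation fluct := (fluct W sigma).
Local Notation fluct_incr := (fluct_incr W sigma).
Local Notation diag_ok := (diag_ok P W sigma).
Local Notation offdiag_ok := (offdiag_ok P W sigma).

Definition root_ok (j : idx) : Prop := dom0 j /\ ii j \notin iS j.

Lemma root_ok_gt0 j : root_ok j -> (0 < iN j)%N.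
Proof. by case=> -[]. Qed.

Lemma alg_fluct_past j k s : {subset s <= iS j} -> (0 < iN j)%N ->
  alg W (past (iS j) (ii j) s) (chainsum (fluct_incr j k) s).
Proof.
move=> sS N0.
rewrite (_ : chainsum _ _ = fun w => (iN j)%:R * (\sum_(u <- s) \sum_(v <- s) X (iN j) (ii j) u w * wk (iN j) (iS j) k u v w * X (iN j) v (ii j) w)
  - \sum_(u <- s) wk (iN j) (iS j) k u u w); last first.
  by apply/funext => w; exact: fluct_incr_sum.
have wkA u v : u \in s -> alg W (past (iS j) (ii j) s) (wk (iN j) (iS j) k u v).
  by move=> us; apply: alg_sub (alg_wk _ _ _ _ _ (sS _ us)) => a b; left.
apply: algB; last by apply: alg_sum => u us; exact: wkA.
apply: algZ; apply: alg_sum => u us; apply: alg_sum => v vs.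
apply: algM; first apply: algM.
- by apply: alg_scaled; right; left.
- exact: wkA.
- by apply: alg_scaled; right; right.
Qed.

(** The martingale property: each of the three terms is a centred polynomial in the new entries
    times a polynomial in the past. *)
Lemma Ec_fluct_incr j k pre z s g : root_ok j -> iS j = pre ++ z :: s ->
  alg W (past (iS j) (ii j) s) g -> Ec (fun w => fluct_incr j k z s w * g w) = 0.
Proof.
move=> [[N0 uS SN] iS'] E ag.
have zS : z \in iS j by rewrite E mem_cat mem_head orbT.
have sS : {subset s <= iS j} by move=> x xs; rewrite E mem_cat inE xs !orbT.
have zs : z \notin s by move: uS; rewrite E => /uniq_catr /= /andP[].
have zi : ii j != z by apply: contraNneq iS' => ->.
have dis := spoke_past zS iS' sS zs.
have wkA u v : u \in iS j -> alg W (past (iS j) (ii j) s) (wk (iN j) (iS j) k u v).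
  by move=> us; apply: alg_sub (alg_wk _ _ _ _ _ us) => a b; left.
have XA1 l : l \in s -> alg W (past (iS j) (ii j) s) (X (iN j) l (ii j)).
  by move=> ls; apply: alg_scaled; right; right.
have XA2 l : l \in s -> alg W (past (iS j) (ii j) s) (X (iN j) (ii j) l).
  by move=> ls; apply: alg_scaled; right; left.
have VA1 : alg W (spoke (ii j) z) (V (ii j) z) by apply: alg_reduced; left.
have VA2 : alg W (spoke (ii j) z) (V z (ii j)) by apply: alg_reduced; right.
pose f1 w := V (ii j) z w * V z (ii j) w - 1.
pose g1 w := wk (iN j) (iS j) k z z w * g w.
pose g2 w := rt (iN j) * (\sum_(l <- s) wk (iN j) (iS j) k z l w * X (iN j) l (ii j) w) * g w.
pose g3 w := rt (iN j) * (\sum_(l <- s) X (iN j) (ii j) l w * wk (iN j) (iS j) k l z w) * g w.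
have af1 : alg W (spoke (ii j) z) f1.
  by apply: algB; [exact: algM|exact: alg_cst].
have ag1 : alg W (past (iS j) (ii j) s) g1 by apply: algM => //; exact: wkA.
have ag2 : alg W (past (iS j) (ii j) s) g2.
  apply: algM => //; apply: algZ; apply: alg_sum => l ls; apply: algM; first exact: wkA.
  exact: XA1.
have ag3 : alg W (past (iS j) (ii j) s) g3.
  apply: algM => //; apply: algZ; apply: alg_sum => l ls; apply: algM; first exact: XA2.
  by apply: wkA; exact: sS.
have E1 : Ec (fun w => f1 w * g1 w) = 0.
  apply: (Ec_spoke0 entW hermW af1 _ ag1 dis).
  rewrite /f1 (EcB entW hermW (A := spoke (ii j) z)); last exact: alg_cst.
    by rewrite (Ec_reduced2 entW hermW sigma_gt0 varW zi) complex_expectation_cst subrr.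
  exact: algM.
have E2 : Ec (fun w => V (ii j) z w * g2 w) = 0.
  exact: (Ec_spoke0 entW hermW VA1 (Ec_reduced entW hermW _ _ _) ag2 dis).
have E3 : Ec (fun w => V z (ii j) w * g3 w) = 0.
  exact: (Ec_spoke0 entW hermW VA2 (Ec_reduced entW hermW _ _ _) ag3 dis).
rewrite (_ : (fun w => _) = fun w => f1 w * g1 w + (V (ii j) z w * g2 w + V z (ii j) w * g3 w)); last first.
  by apply/funext => w; rewrite /fluct_incr /f1 /g1 /g2 /g3; ring.
have a1 : algT (fun w => f1 w * g1 w) by apply: algM; [exact: algT_alg af1|exact: algT_alg ag1].
have a2 : algT (fun w => V (ii j) z w * g2 w) by apply: algM; [exact: algT_alg VA1|exact: algT_alg ag2].
have a3 : algT (fun w => V z (ii j) w * g3 w) by apply: algM; [exact: algT_alg VA2|exact: algT_alg ag3].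
rewrite (EcD entW hermW a1); last exact: algD.
by rewrite (EcD entW hermW a2 a3) E1 E2 E3 !addr0.
Qed.

(** [bdd_chain] for the increments [fluct_incr], whose row sums are bounded by [Ob_partial_row]. *)
Lemma Ob_fluct k : diag_ok k -> offdiag_ok k -> Ob iN 1 root_ok
  (fun j => fluct (iN j) (iS j) (ii j) k).
Proof.
move=> dk ok.
pose D' (q : idx * nat * seq nat) := root_ok q.1.1 /\ exists pre, iS q.1.1 = pre ++ q.1.2 :: q.2.
have H := bdd_chain (D := root_ok) (S := iS) (N := iN) (F := fun j => fluct_incr j k)
  (A := fun j => past (iS j) (ii j)) entW hermW.
apply: bdd_ext (H _ _ _ _).
- move=> j w Dj; have N0 := root_ok_gt0 Dj.
  rewrite fluct_chain// expr1 mulrA; congr (_ * _); rewrite -rt_sqr.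
  by field; exact: rt_neq0.
- by move=> j [[]].
- have prt q : D' q -> partial_row (Idx (iN q.1.1) (iS q.1.1) (ii q.1.1) q.1.2 q.2).
    move: q => [[j z] s] [[[N0 uS SN] iS'] [pre /= E]]; split => //; split => //=.
    + by rewrite E mem_cat mem_head orbT.
    + by move: uS; rewrite E => /uniq_catr /= /andP[].
    + by move=> x xs; rewrite E mem_cat inE xs !orbT.
    + by move: uS; rewrite E => /uniq_catr /= /andP[].
  have O2 := Ob_reindex (N' := fun q => iN q.1.1) (D' := D')
    (g := fun q => Idx (iN q.1.1) (iS q.1.1) (ii q.1.1) q.1.2 q.2) prt (fun _ => erefl)
    (Ob_partial_row entW hermW ok).
  have O1 := Ob_reindex (N' := fun q => iN q.1.1) (D' := D')
    (g := fun q => Idx (iN q.1.1) (iS q.1.1) (ii q.1.1) q.1.2 q.2) _ (fun _ => erefl) dk.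
  have {}O1 := O1 (fun q Dq => conj (prt q Dq).1 (let: And5 a _ _ _ _ := (prt q Dq).2 in a)).
  have b1 : bdd D' (fun q => V (ii q.1.1) q.1.2) by exact: bdd_reduced_family.
  have b2 : bdd D' (fun q => V q.1.2 (ii q.1.1)) by exact: bdd_reduced_family.
  have b3 : bdd D' (fun q w => V (ii q.1.1) q.1.2 w * V q.1.2 (ii q.1.1) w - 1).
    apply: (bddB entW hermW); first exact: bddM.
    exact: (@bdd_cst _ _ _ _ _ _ _ _ (nsq 1)).
  have b4 : bdd D' (fun q => wk (iN q.1.1) (iS q.1.1) k q.1.2 q.1.2).
    by apply: bdd_ext O1 => q w _; rewrite mul1r.
  have b5 : bdd D' (fun q w => rt (iN q.1.1) * \sum_(l <- q.2) wk (iN q.1.1) (iS q.1.1) k q.1.2 l w * X (iN q.1.1) l (ii q.1.1) w).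
    by apply: bdd_ext O2 => q w _; rewrite mul1r.
  (* By Hermitian symmetry this is the complex conjugate of the row sum in [b5]. *)
  have b6 : bdd D' (fun q w => rt (iN q.1.1) * \sum_(l <- q.2) X (iN q.1.1) (ii q.1.1) l w * wk (iN q.1.1) (iS q.1.1) k l q.1.2 w).
    apply: bdd_ext (bdd_conj hermW b5) => q w Dq.
    have [[_ uS _] [zS _ _ sS _]] := prt _ Dq.
    rewrite rmorphM [X in X * _]rt_conj rmorph_sum; congr (_ * _).
    apply: eq_big_seq => l lq; rewrite rmorphM mulrC.
    congr (_ * _); first exact: scaled_conj.
    by apply: wk_conj => //; exact: sS.
  apply: (bddD entW hermW); first apply: (bddD entW hermW).
  + exact: bddM.
  + exact: bddM.
  + exact: bddM.
- move=> j pre s Dj E; split; first by move=> a b; exact: past_sym.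
  apply: alg_fluct_past; last exact: root_ok_gt0.
  by move=> x xs; rewrite E mem_cat xs orbT.
- by move=> j pre z s g; exact: Ec_fluct_incr.
Qed.

Definition tau N S k w : C := N%:R^-1 * \sum_(u <- S) wk N S k u u w.

Definition exc N S i w : fps C := excursion (fun a b => X N a b w) S i.

Lemma exc_fluct N S i j w : exc N S i w j.+2 = fluct N S i j w + tau N S j w.
Proof. by rewrite /exc /fluct /tau /= subrK. Qed.

Lemma Ob_tau0 k : diag_ok k -> Ob iN 0 dom0 (fun j => tau (iN j) (iS j) k).
Proof.
move=> dk; apply: (Ob_average entW hermW); first by move=> j [? ? ?].
apply: bdd_ext (Ob_reindex (N' := fun q : idx * nat => iN q.1)
  (D' := fun q : idx * nat => dom0 q.1 /\ q.2 \in iS q.1)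
  (g := fun q => Idx (iN q.1) (iS q.1) (ii q.1) q.2 [::]) _ _ dk) => //.
Qed.

Lemma Ob_exc a : (forall j, (j.+2 <= a)%N -> diag_ok j /\ offdiag_ok j) ->
  Ob iN 0 root_ok (fun j w => exc (iN j) (iS j) (ii j) w a).
Proof.
case: a => [|[|a]] H.
- exact: (Ob_cst _ _ _ _ 0).
- apply: (Ob_weaken entW hermW (s := 1)) => //; first exact: root_ok_gt0.
  by apply: Ob_scaled => //; exact: root_ok_gt0.
have [da oa] := H a (leqnn _).
have O1 : Ob iN 0 root_ok (fun j => fluct (iN j) (iS j) (ii j) a).
  by apply: (Ob_weaken entW hermW (s := 1)) (Ob_fluct da oa) => //; exact: root_ok_gt0.
have O2 : Ob iN 0 root_ok (fun j => tau (iN j) (iS j) a).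
  by apply: (Ob_reindex (g := id) _ _ (Ob_tau0 da)) => // j [].
by apply: Ob_ext (ObD entW hermW O1 O2) => j w _; rewrite exc_fluct.
Qed.

Definition vertex_ok (j : idx) : Prop := dom0 j /\ ii j \in iS j.
(** Removes the distinguished vertex and keeps the normalisation [iN]. *)
Definition peel (j : idx) : idx := Idx (iN j) (rem (ii j) (iS j)) (ii j) (iu j) [::].

Lemma dom0_rem j : dom0 j -> dom0 (peel j).
Proof.
move=> [N0 uS SN]; split => //=; first exact: rem_uniq.
by rewrite (leq_trans _ SN)// size_subseq// rem_subseq.
Qed.

Lemma peel_ok j : vertex_ok j -> root_ok (peel j).
Proof.
move=> [D0 iin]; split; first exact: dom0_rem.
by case: D0 => _ uS _; rewrite /= mem_rem_uniqF.
Qed.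

Lemma wk_renewal N S i k w : uniq S -> i \in S ->
  wk N S k.+1 i i w = \sum_(m < k.+1) exc N (rem i S) i w m.+1 * wk N S (k - m)%N i i w.
Proof.
move=> uS iS; have := loops_renewal (fun a b => X N a b w) uS iS.
move=> /(congr1 (fun f : fps C => f k.+1)).
rewrite fpsD_coef fps1_coef add0r fpsM_coef big_ord_recl mul0r add0r => h.
by apply: (eq_trans h); apply: eq_bigr => m _; rewrite /bump /= subSS.
Qed.

(** Joint strong induction. On the diagonal, the renewal equation expresses a loop through shorter
    loops and through excursions, which involve lower powers on the set without the vertex. Off the
    diagonal, the first passage gives an entrance, of order N^(-1/2), times a loop, of order 1. *)
Lemma walks_ok k : diag_ok k /\ offdiag_ok k.
Proof.
elim/ltn_ind: k => -[|k] IH.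
  split.
    by apply: Ob_ext (Ob_cst _ _ _ _ 1) => j w _; rewrite /wk /= eqxx.
  apply: (Ob_ext (F := fun _ _ => 0)) => [j w [_ [_ _ /negbTE ui]]|].
    by rewrite /wk /= ui.
  by apply: bdd_ext (bdd_cst _ _ (a := fun=> 0) (K := nsq 0) _) => // j w _; rewrite mulr0.
split.
  pose sw (j : idx) := Idx (iN j) (iS j) (iu j) (iu j) [::].
  suff : Ob iN 0 vertex_ok (fun j => wk (iN j) (iS j) k.+1 (ii j) (ii j)).
    by move=> H; apply: (Ob_reindex (g := sw) _ _ H).
  apply: (Ob_ext (F := fun j w => \sum_(m < k.+1) exc (iN j) (rem (ii j) (iS j)) (ii j) w m.+1 * wk (iN j) (iS j) (k - m)%N (ii j) (ii j) w)).
    by move=> j w [[N0 uS _] iS]; rewrite [RHS]wk_renewal.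
  apply: (Ob_sum_ord entW hermW) => m; apply: (ObM entW hermW (s := 0) (s' := 0)).
    have O1 := @Ob_exc m.+1 (fun j jm => IH j (leq_trans (ltnW jm) (ltn_ord m))).
    by apply: (Ob_reindex (g := peel) _ _ O1) => //; exact: peel_ok.
  have [q2 _] := IH (k - m)%N (leq_ltn_trans (leq_subr _ _) (ltnSn k)).
  by apply: (Ob_reindex (g := fun j => Idx (iN j) (iS j) (ii j) (ii j) [::]) _ _ q2).
pose D (j : idx) := dom0 j /\ [/\ iu j \in iS j, ii j \in iS j & iu j != ii j].
apply: (Ob_ext (F := fun j w => \sum_(m < k.+1) ent (iN j) (rem (ii j) (iS j)) (ii j) m (iu j) w * wk (iN j) (iS j) (k - m)%N (ii j) (ii j) w)).
  move=> j w [[N0 uS _] [uin iin ui]].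
  have ur : iu j \in rem (ii j) (iS j) by rewrite mem_rem_uniq// inE ui.
  rewrite {2}/wk (walk_passage _ _ _ uS iin ur) walk_outside ?add0r//.
  by rewrite mem_rem_uniqF.
apply: (Ob_sum_ord entW hermW) => m; apply: (ObM entW hermW (s := 1) (s' := 0)).
  have [dm om] := IH m (ltn_ord m).
  apply: (Ob_reindex (g := peel) _ _ (Ob_ent entW hermW dm om)) => // j [D0 [uin iin ui]].
  have [_ iin'] := peel_ok (conj D0 iin).
  split; first exact: dom0_rem.
  split => //; case: D0 => _ uS _; by rewrite /= mem_rem_uniq// inE ui.
have [q2 _] := IH (k - m)%N (leq_ltn_trans (leq_subr _ _) (ltnSn k)).
by apply: (Ob_reindex (g := fun j => Idx (iN j) (iS j) (ii j) (ii j) [::]) _ _ q2) => // j [D0 [_ ? _]].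
Qed.

End wigner_bounds.

(** * Concentration of the normalised traces *)

Section trace_concentration.
Context d (T : measurableType d) (R : realType) (P : probability T R).
Local Notation C := R[i].
Local Notation Ec := (complex_expectation P).
Context (W : nat -> nat -> T -> C).
Context (entW : independent_centered_entries P W).
Context (hermW : forall i j w, W j i w = ((W i j w)^*)%C).
Context (sigma : R) (sigma_gt0 : 0 < sigma).
Context (varW : forall i j, i != j -> Ec (fun w => W i j w * W j i w) = (sigma ^+ 2)%:C%C).
Local Notation algT := (alg W all_edges).
Local Notation bdd := (bdd P W).
Local Notation rt := (@rt R).
Local Notation Ob := (Ob P W).
Local Notation X := (scaled W sigma).
Local Notation V := (reduced W sigma).
Local Notation wk := (wk W sigma).
Local Notation ent := (ent W sigma).
Local Notation fluct := (fluct W sigma).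
Local Notation fluct_incr := (fluct_incr W sigma).
Local Notation tau := (tau W sigma).
Local Notation exc := (exc W sigma).

Context (c : fps C) (c_eq : c = 1 + (fpsX C) ^+ 2 * c ^+ 2).

(** At most [e] vertices are missing. Each peeling raises [e] by one, so estimates are proved for
    all [e] together. *)
Definition near e (j : idx) : Prop := dom0 j /\ (iN j <= size (iS j) + e)%N.
Definition vertex_near e j := near e j /\ ii j \in iS j.
Definition root_near e j := near e j /\ ii j \notin iS j.

Lemma near_gt0 e j : near e j -> (0 < iN j)%N.
Proof. by case=> -[]. Qed.

Lemma vertex_near_gt0 e j : vertex_near e j -> (0 < iN j)%N.
Proof. by case=> /near_gt0. Qed.

Lemma root_near_gt0 e j : root_near e j -> (0 < iN j)%N.
Proof. by case=> /near_gt0. Qed.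

Lemma vertex_near_ok e j : vertex_near e j -> vertex_ok j.
Proof. by case=> -[]. Qed.

Lemma root_near_ok e j : root_near e j -> root_ok j.
Proof. by case=> -[]. Qed.

Lemma peel_near e j : vertex_near e j -> root_near e.+1 (peel j).
Proof using Type.
move=> [[D0 Ne] iS']; have [h1 h2] := peel_ok (conj D0 iS'); split => //; split => //.
rewrite /= size_rem//; move: iS' Ne; clear; case: (iS j) => //= x s _; lia.
Qed.

Lemma Ob_deficit e : Ob iN 2 (near e) (fun j _ => (size (iS j))%:R / (iN j)%:R - 1).
Proof using Type.
apply: (@bdd_cst _ _ _ _ _ _ _ _ (e%:R ^+ 2)) => j [[N0 _ SN] Ne].
rewrite rt_sqr mulrBr mulr1 mulrCA mulfV ?mulr1; last by rewrite pnatr_eq0 -lt0n.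
rewrite -nsqN opprB -natrB// -(rmorph_nat (real_complex R)) nsq_real.
by rewrite lerXn2r ?nnegrE// ler_nat; move: Ne; clear; lia.
Qed.

(** The deviation of the excursion series from its limit t^2 c; the small parameter of the
    expansion. *)
Definition excess N S i w : fps C := exc N S i w - (fpsX C) ^+ 2 * c.

Lemma excess0 N S i w : excess N S i w 0%N = 0.
Proof. by rewrite /excess fpsD_coef fpsN_coef fpsX2M_coef subr0. Qed.

Lemma excess1 N S i w : excess N S i w 1%N = X N i i w.
Proof. by rewrite /excess fpsD_coef fpsN_coef fpsX2M_coef subr0. Qed.

Lemma excessSS N S i w k : excess N S i w k.+2 = fluct N S i k w + (tau N S k w - c k).
Proof. by rewrite /excess fpsD_coef fpsN_coef fpsX2M_coef exc_fluct addrA. Qed.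

Definition hloops N S i w : fps C := fun k => wk N S k i i w.

(** The resolvent identity: [hloops] is the inverse of 1 - e and [c] the inverse of 1 - t^2 c. *)
Lemma hloops_expand1 N S i w : uniq S -> i \in S ->
  hloops N S i w = c + c * excess N (rem i S) i w * hloops N S i w.
Proof.
move=> uS iS; have := loops_renewal (fun a b => X N a b w) uS iS.
rewrite -/(exc N (rem i S) i w) (_ : loops _ _ _ = hloops N S i w)//.
set h := hloops N S i w => hE.
have h1 : h * (1 - exc N (rem i S) i w) = 1 by rewrite mulrBr mulr1 {1}hE; ring.
have c1 : c * (1 - (fpsX C) ^+ 2 * c) = 1 by rewrite mulrBr mulr1 {1}c_eq; ring.
rewrite /excess; move: h1 c1; set x2 := _ ^+ 2 * c; set e := exc _ _ _ _ => h1 c1.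
rewrite (_ : c * (e - x2) * h = h * (c * (1 - x2)) - c * (h * (1 - e))); last by ring.
by rewrite h1 c1; ring.
Qed.

Lemma hloops_expand2 N S i w : uniq S -> i \in S ->
  hloops N S i w = c + c ^+ 2 * excess N (rem i S) i w +
    c ^+ 2 * excess N (rem i S) i w * excess N (rem i S) i w * hloops N S i w.
Proof.
move=> uS iS; have := hloops_expand1 N w uS iS.
set h := hloops _ _ _ _; set f := excess _ _ _ _ => E.
by rewrite {1}E {1}E; ring.
Qed.

(** The identity [hloops_expand1] inserted into itself until the remainder has three factors
    [excess], hence order N^(-3/2). *)
Lemma hloops_expand3 N S i w : uniq S -> i \in S ->
  hloops N S i w = c + c ^+ 2 * excess N (rem i S) i w +
    c ^+ 3 * excess N (rem i S) i w ^+ 2 +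
    c ^+ 3 * (excess N (rem i S) i w * excess N (rem i S) i w * excess N (rem i S) i w * hloops N S i w).
Proof.
move=> uS iS; have := hloops_expand2 N w uS iS.
have := hloops_expand1 N w uS iS.
set h := hloops _ _ _ _; set f := excess _ _ _ _ => E1 E2.
by rewrite {1}E2 {1}E1; ring.
Qed.

Definition trace_ok k := forall e, Ob iN 1 (near e) (fun j w => tau (iN j) (iS j) k w - c k).

(** The coefficient of index [m.+2] involves only the trace of the m-th power; this shift by two is
    what makes the induction on traces close. *)
Lemma Ob_excess e k : (forall m, (m.+2 <= k)%N -> trace_ok m) ->
  Ob iN 1 (root_near e) (fun j w => excess (iN j) (iS j) (ii j) w k).
Proof.
case: k => [|[|k]] H.
- apply: (Ob_ext (F := fun _ _ => 0)) => [j w _|]; first by rewrite excess0.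
  by apply: bdd_ext (bdd_cst _ _ (a := fun=> 0) (K := nsq 0) _) => // j w _; rewrite mulr0.
- apply: (Ob_ext (F := fun j => X (iN j) (ii j) (ii j))) => [j w _|]; first by rewrite excess1.
  by apply: Ob_scaled => //; exact: root_near_gt0.
have [dk ok] := walks_ok entW hermW sigma_gt0 varW k.
have O1 := Ob_reindex (g := id) (@root_near_ok e) (fun _ => erefl) (Ob_fluct entW hermW sigma_gt0 varW dk ok).
have O2 := Ob_reindex (g := id) (D' := root_near e) _ (fun _ => erefl) (H k (leqnn _) e).
have {}O2 := O2 (fun j h => h.1).
by apply: Ob_ext (ObD entW hermW O1 O2) => j w _; rewrite excessSS.
Qed.

Lemma Ob_const_fps (D : idx -> Prop) (f : fps C) k : Ob iN 0 D (fun _ _ => f k).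
Proof. exact: Ob_cst. Qed.

Lemma Ob_hloops e k : Ob iN 0 (vertex_near e) (fun j w => hloops (iN j) (iS j) (ii j) w k).
Proof.
have [dk _] := walks_ok entW hermW sigma_gt0 varW k.
by apply: (Ob_reindex (g := fun j => Idx (iN j) (iS j) (ii j) (ii j) [::]) _ _ dk) => // j /vertex_near_ok[].
Qed.

Lemma Ob_excess_peel e k : (forall m, (m.+2 <= k)%N -> trace_ok m) ->
  Ob iN 1 (vertex_near e) (fun j w => excess (iN j) (rem (ii j) (iS j)) (ii j) w k).
Proof.
by move=> H; apply: (Ob_reindex (g := peel) _ _ (Ob_excess e.+1 H)) => //; exact: peel_near.
Qed.

Lemma Ob_hloops_center e k : (forall m, (m.+2 <= k)%N -> trace_ok m) ->
  Ob iN 1 (vertex_near e) (fun j w => hloops (iN j) (iS j) (ii j) w k - c k).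
Proof.
move=> H.
apply: (Ob_ext (F := fun j w => (c * (excess (iN j) (rem (ii j) (iS j)) (ii j) w) * hloops (iN j) (iS j) (ii j) w) k)).
  move=> j w [[[_ uS _] _] iS']; rewrite {2}hloops_expand1// fpsD_coef; ring.
apply: (Ob_prod_fps entW hermW (s := 1) (s' := 0) (K := k)) => // m mk; last exact: Ob_hloops.
apply: (Ob_prod_fps entW hermW (s := 0) (s' := 1) (K := k)
  (F := fun _ _ => c) (G := fun j w => excess (iN j) (rem (ii j) (iS j)) (ii j) w)) => // q qk.
  exact: Ob_const_fps.
by apply: Ob_excess_peel => r rq; apply: H; rewrite (leq_trans rq).
Qed.

Lemma tau_center N S k w : (0 < N)%N ->
  tau N S k w - c k = N%:R^-1 * (\sum_(u <- S) (wk N S k u u w - c k)) +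
     ((size S)%:R / N%:R - 1) * c k.
Proof.
move=> N0; rewrite /tau sumrB big_const_seq count_predT iter_addr_0 -mulr_natr.
by field; rewrite pnatr_eq0 -lt0n.
Qed.

Definition at_vertex (q : idx * nat) : idx := Idx (iN q.1) (iS q.1) q.2 q.2 [::].

(** Strong induction: traces of lower powers control the excess, hence each loop around its limit,
    hence the average of loops. The missing vertices contribute only order 1/N. *)
Lemma trace_ok_all k : trace_ok k.
Proof.
elim/ltn_ind: k => k IH e.
have H : forall m, (m.+2 <= k)%N -> trace_ok m by move=> m mk; apply: IH; rewrite (leq_trans _ mk).
apply: (Ob_ext (F := fun j w => (iN j)%:R^-1 * (\sum_(u <- iS j) (wk (iN j) (iS j) k u u w - c k)) +
     ((size (iS j))%:R / (iN j)%:R - 1) * c k)).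
  by move=> j w /near_gt0 N0; rewrite tau_center.
apply: (ObD entW hermW).
  apply: (Ob_average entW hermW (F := fun j u w => wk (iN j) (iS j) k u u w - c k)); first by move=> j [[]].
  have := Ob_hloops_center e H.
  by move=> /(Ob_reindex (g := at_vertex) (N' := fun q => iN q.1)
    (D' := fun q => near e q.1 /\ q.2 \in iS q.1)); apply.
apply: (Ob_weaken entW hermW (s := 2)) => //; first exact: near_gt0.
by apply: (ObM entW hermW (s := 2) (s' := 0)); [exact: Ob_deficit|exact: Ob_cst].
Qed.

(** Removing [i] deletes one diagonal term and the walks through [i]. By first passage, the latter
    are an entrance times an off-diagonal entry, of order 1/N for each starting vertex, and the
    trace is divided by N. *)
Lemma Ob_tau_peel k : Ob iN 2 vertex_ok
  (fun j w => tau (iN j) (iS j) k w - tau (iN j) (rem (ii j) (iS j)) k w).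
Proof.
have N0 j : vertex_ok j -> (0 < iN j)%N by case=> -[].
apply: (Ob_ext (F := fun j w => (iN j)%:R^-1 * wk (iN j) (iS j) k (ii j) (ii j) w +
  (iN j)%:R^-1 * \sum_(u <- rem (ii j) (iS j)) \sum_(m < k)
    ent (iN j) (rem (ii j) (iS j)) (ii j) m u w * wk (iN j) (iS j) (k.-1 - m)%N (ii j) u w)).
  move=> j w [[_ uS _] iS']; rewrite /tau (sum_rem _ iS') -mulrBr -mulrDr; congr (_ * _).
  rewrite -addrA; congr (_ + _); rewrite -sumrB; apply: eq_big_seq => u ur.
  by rewrite {2}/wk (walk_passage _ _ _ uS iS' ur) addrC addKr.
apply: (ObD entW hermW).
  apply: (ObM entW hermW (s := 2) (s' := 0)); first exact: Ob_invN.
  have [dk _] := walks_ok entW hermW sigma_gt0 varW k.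
  by apply: (Ob_reindex (g := fun j => Idx (iN j) (iS j) (ii j) (ii j) [::]) _ _ dk).
apply: (Ob_average entW hermW (S := fun j => rem (ii j) (iS j))
  (F := fun j u w => \sum_(m < k) ent (iN j) (rem (ii j) (iS j)) (ii j) m u w * wk (iN j) (iS j) (k.-1 - m)%N (ii j) u w)).
  by move=> j /peel_ok[[] ? ? ? _].
apply: (@Ob_sum_ord _ _ _ _ _ entW hermW _ (fun q => iN q.1) _ 2 _
  (fun m q w => ent (iN q.1) (rem (ii q.1) (iS q.1)) (ii q.1) m q.2 w * wk (iN q.1) (iS q.1) (k.-1 - m)%N (ii q.1) q.2 w)) => m.
apply: (ObM entW hermW (s := 1) (s' := 1)).
  have [dm om] := walks_ok entW hermW sigma_gt0 varW m.
  apply: (Ob_reindex (g := fun q => Idx (iN q.1) (rem (ii q.1) (iS q.1)) (ii q.1) q.2 [::]) _ _ (Ob_ent entW hermW dm om)) => //.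
  by move=> q [/peel_ok[D0 /= iS'] ur].
have [_ om] := walks_ok entW hermW sigma_gt0 varW (k.-1 - m)%N.
have q1 := Ob_reindex (g := fun q : idx * nat => Idx (iN q.1) (iS q.1) (ii q.1) q.2 [::])
  (N' := fun q => iN q.1) (D' := fun q => vertex_ok q.1 /\ q.2 \in rem (ii q.1) (iS q.1)) _ (fun _ => erefl) om.
have mr (q : idx * nat) : vertex_ok q.1 -> q.2 \in rem (ii q.1) (iS q.1) -> (q.2 != ii q.1) && (q.2 \in iS q.1).
  by move=> [[_ uS _] _]; rewrite mem_rem_uniq// inE.
have {}q1 := q1 _.
apply: (Ob_ext (F := fun q w => ((wk (iN q.1) (iS q.1) (k.-1 - m)%N q.2 (ii q.1) w)^*)%C)).
  move=> q w [Dq /(mr _ Dq)/andP[_ qS]]; have [[_ uS _] iS'] := Dq.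
  exact: wk_conj.
apply: (Ob_conj hermW); apply: q1 => q [Dq /(mr _ Dq)/andP[qi qS]].
by have [D0 iS'] := Dq; split.
Qed.

(** Entries inside [S] belong to the past of every increment, so each increment is orthogonal to
    [g]. *)
Lemma Ec_fluct0 j k g : root_ok j -> alg W (within (iS j)) g ->
  Ec (fun w => fluct (iN j) (iS j) (ii j) k w * g w) = 0.
Proof.
move=> rj ag; have N0 := root_ok_gt0 rj; have [[_ uS _] iS'] := rj.
have agT := algT_alg ag.
have aF pre s : iS j = pre ++ s -> algT (chainsum (fluct_incr j k) s).
  move=> E; apply: algT_alg; apply: alg_fluct_past => //.
  by move=> x xs; rewrite E mem_cat xs orbT.
have H pre s : iS j = pre ++ s -> Ec (fun w => chainsum (fluct_incr j k) s w * g w) = 0.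
  elim: s pre => [|z s IH] pre E /=.
    by under eq_fun do rewrite mul0r; rewrite complex_expectation_cst.
  have E' : iS j = (pre ++ [:: z]) ++ s by rewrite -catA.
  have a1 := aF _ _ E; have a2 := aF _ _ E'.
  have a3 : algT (fluct_incr j k z s).
    have := algB a1 a2; congr alg; apply/funext => w /=; ring.
  under eq_fun do rewrite mulrDl.
  rewrite (EcD entW hermW (A := all_edges)) ?(IH _ E') ?addr0; [|exact: algM|exact: algM].
  rewrite (Ec_fluct_incr entW hermW sigma_gt0 varW k rj E)//.
  by apply: alg_sub ag => a b; left.
under eq_fun do rewrite fluct_chain// -mulrA.
rewrite (EcZ entW hermW (A := all_edges)) ?(H [::])// ?mulr0//.
by apply: algM => //; exact: (aF [::]).
Qed.

Lemma alg_tau N S k : alg W (within S) (tau N S k).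
Proof. by apply: algZ; apply: alg_sum => u uS; exact: alg_wk. Qed.

Lemma alg_fluct j k : root_ok j -> algT (fluct (iN j) (iS j) (ii j) k).
Proof.
move=> rj; have N0 := root_ok_gt0 rj.
rewrite (_ : fluct _ _ _ _ = fun w => (iN j)%:R^-1 * chainsum (fluct_incr j k) (iS j) w); last first.
  by apply/funext => w; rewrite fluct_chain.
by apply: algZ; apply: algT_alg; exact: alg_fluct_past.
Qed.

Definition utau (a : nat) (j : idx) w : C := tau (iN j) (iS j) a w - c a.

Lemma alg_utau a j : alg W (within (iS j)) (utau a j).
Proof. by apply: algB; [exact: alg_tau|exact: alg_cst]. Qed.

Lemma Ob_utau a e : Ob iN 1 (near e) (utau a).
Proof. exact: trace_ok_all. Qed.

Lemma Ec_scaled0 j g : root_ok j -> alg W (within (iS j)) g ->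
  Ec (fun w => X (iN j) (ii j) (ii j) w * g w) = 0.
Proof.
move=> [_ iS'] ag.
rewrite (Ec_indep entW hermW (A := fun a b => a = ii j /\ b = ii j) _ ag); last 2 first.
- by apply: alg_scaled.
- by move=> a b [-> ->]; rewrite /within (negbTE iS'); split => -[].
rewrite (EcZ entW hermW (A := all_edges)) ?(Ec_entry entW) ?mulr0 ?mul0r//.
exact: alg_entry.
Qed.

(** Against a polynomial inside [S] the diagonal entry and the fluctuation average to 0, so only the
    product of centred traces, with index lowered by two, remains. *)
Lemma Ob_Ec_excess_utau a b e :
  (forall q, (q.+2 <= a)%N -> forall e', Ob iN 3 (near e') (fun j _ => Ec (fun w => utau q j w * utau b j w))) ->
  Ob iN 3 (root_near e) (fun j _ => Ec (fun w => excess (iN j) (iS j) (ii j) w a * utau b j w)).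
Proof.
have O0 : Ob iN 3 (root_near e) (fun _ _ => 0).
  by apply: bdd_ext (bdd_cst _ _ (a := fun=> 0) (K := nsq 0) _) => // j w _; rewrite mulr0.
case: a => [|[|a]] H.
- apply: Ob_ext O0 => j _ _; under eq_fun do rewrite excess0 mul0r.
  by rewrite complex_expectation_cst.
- apply: Ob_ext O0 => j _ /root_near_ok rj; under eq_fun do rewrite excess1.
  by rewrite Ec_scaled0//; exact: alg_utau.
have O1 := Ob_reindex (g := id) (N' := iN) (D' := root_near e) (fun j h => h.1) (fun _ => erefl) (H a (leqnn _) e).
apply: Ob_ext O1 => j _ /root_near_ok rj.
under [in RHS]eq_fun do rewrite excessSS mulrDl.
have aT := algT_alg (alg_utau b j).
rewrite (EcD entW hermW (A := all_edges)).
- by rewrite Ec_fluct0 ?add0r//; exact: alg_utau.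
- by apply: algM => //; exact: alg_fluct.
- by apply: algM => //; exact: algT_alg (alg_utau a j).
Qed.

End trace_concentration.

(** * Covariances of the normalised traces *)

Section trace_covariance.
Context d (T : measurableType d) (R : realType) (P : probability T R).
Local Notation C := R[i].
Local Notation Ec := (complex_expectation P).
Context (W : nat -> nat -> T -> C).
Context (entW : independent_centered_entries P W).
Context (hermW : forall i j w, W j i w = ((W i j w)^*)%C).
Context (sigma : R) (sigma_gt0 : 0 < sigma).
Context (varW : forall i j, i != j -> Ec (fun w => W i j w * W j i w) = (sigma ^+ 2)%:C%C).
Local Notation algT := (alg W all_edges).
Local Notation bdd := (bdd P W).
Local Notation rt := (@rt R).
Local Notation Ob := (Ob P W).
Local Notation X := (scaled W sigma).
Local Notation V := (reduced W sigma).
Local Notation wk := (wk W sigma).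
Local Notation ent := (ent W sigma).
Local Notation fluct := (fluct W sigma).
Local Notation fluct_incr := (fluct_incr W sigma).
Local Notation tau := (tau W sigma).
Local Notation exc := (exc W sigma).
Context (c : fps C) (c_eq : c = 1 + (fpsX C) ^+ 2 * c ^+ 2).
Local Notation excess := (excess W sigma c).
Local Notation hloops := (hloops W sigma).
Local Notation utau := (utau W sigma c).

(** The loop at [ii j] is expanded to second order in the excess, and the trace is replaced by the
    one without that vertex, on which the fluctuation averages to 0. *)
Lemma Ob_Ec_center_utau a b e :
  (forall q, (q < a)%N -> forall e', Ob iN 3 (near e') (fun j _ => Ec (fun w => utau q j w * utau b j w))) ->
  Ob iN 3 (vertex_near e) (fun j _ =>
    Ec (fun w => (hloops (iN j) (iS j) (ii j) w a - c a) * utau b j w)).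
Proof.
move=> IH.
have N0 : forall j, vertex_near e j -> (0 < iN j)%N := @vertex_near_gt0 e.
have tr := trace_ok_all entW hermW sigma_gt0 varW c_eq.
pose dl (j : idx) w := excess (iN j) (rem (ii j) (iS j)) (ii j) w.
pose hl (j : idx) w := hloops (iN j) (iS j) (ii j) w.
have odl k : Ob iN 1 (vertex_near e) (fun j w => dl j w k).
  by apply: (Ob_excess_peel entW hermW sigma_gt0 varW) => m _; exact: tr.
have ohl k : Ob iN 0 (vertex_near e) (fun j w => hl j w k).
  exact: (Ob_hloops entW hermW sigma_gt0 varW).
have ou : Ob iN 1 (vertex_near e) (fun j => utau b (peel j)).
  apply: (Ob_reindex (g := peel) _ _ (Ob_utau entW hermW sigma_gt0 varW c_eq b e.+1)) => //.
  by move=> j /peel_near[].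
(* Cost of deleting the vertex in the trace: order N^(-1/2) for the centred loop times 1/N for the
   change of trace. *)
have o1 : Ob iN 3 (vertex_near e) (fun j w => (hl j w a - c a) * (utau b j w - utau b (peel j) w)).
  apply: (ObM entW hermW (s := 1) (s' := 2)).
    by apply: (Ob_hloops_center entW hermW sigma_gt0 varW c_eq) => m _; exact: tr.
  apply: Ob_ext (Ob_reindex (g := id) (@vertex_near_ok e) (fun _ => erefl) (Ob_tau_peel entW hermW sigma_gt0 varW b)).
  by move=> j w _; rewrite /utau /utau /=; ring.
have oc2 k : Ob iN 0 (vertex_near e) (fun _ _ => (c ^+ 2) k) by exact: Ob_const_fps.
(* The quadratic remainder has two factors [dl] and one centred trace, each of order N^(-1/2). *)
have o3 : Ob iN 3 (vertex_near e) (fun j w => (c ^+ 2 * dl j w * dl j w * hl j w) a * utau b (peel j) w).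
  apply: (ObM entW hermW (s := 2) (s' := 1)) => //.
  apply: (Ob_prod_fps entW hermW (s := 2) (s' := 0) (K := a)
    (F := fun j w => c ^+ 2 * dl j w * dl j w) (G := hl)) => // k _.
  apply: (Ob_prod_fps entW hermW (s := 1) (s' := 1) (K := k)
    (F := fun j w => c ^+ 2 * dl j w) (G := dl)) => // k' _.
  exact: (Ob_prod_fps entW hermW (s := 0) (s' := 1) (K := k')
    (F := fun j w => c ^+ 2) (G := dl)).
have odu k : Ob iN 2 (vertex_near e) (fun j w => dl j w k * utau b (peel j) w).
  exact: (ObM entW hermW (s := 1) (s' := 1)).
(* The linear term reduces to covariances of traces of index below [a], controlled by the hypothesis
   [IH]. *)
have o2 : Ob iN 3 (vertex_near e) (fun j _ => \sum_(m < a.+1) (c ^+ 2) m * Ec (fun w => dl j w (a - m)%N * utau b (peel j) w)).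
  apply: (Ob_sum_ord entW hermW) => m; apply: (ObM entW hermW (s := 0) (s' := 3)).
    exact: oc2.
  have := @Ob_Ec_excess_utau _ _ _ _ _ entW hermW _ sigma_gt0 varW c (a - m)%N b e.+1.
  move=> H; apply: (Ob_reindex (g := peel) _ _ (H _)) => //; first exact: peel_near.
  move=> q qa e'; apply: IH; rewrite (leq_trans _ (leq_subr m a))//.
  exact: ltnW.
have e1 := Ob_expectation entW hermW N0 o1.
have e3 := Ob_expectation entW hermW N0 o3.
apply: Ob_ext (ObD entW hermW (ObD entW hermW e1 o2) e3) => j _ Dj.
have a1 := Ob_alg N0 o1 Dj; have a3 := Ob_alg N0 o3 Dj.
have adu k := Ob_alg N0 (odu k) Dj.
have E2 : \sum_(m < a.+1) (c ^+ 2) m * Ec (fun w => dl j w (a - m)%N * utau b (peel j) w) =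
   Ec (fun w => (c ^+ 2 * dl j w) a * utau b (peel j) w).
  under [in RHS]eq_fun do rewrite fpsM_coef mulr_suml.
  rewrite (Ec_sum_ord entW hermW (A := all_edges)
    (F := fun m w => (c ^+ 2) m * dl j w (a - m)%N * utau b (peel j) w)); last first.
    by move=> m; under eq_fun do rewrite -mulrA; apply: algZ.
  apply: eq_bigr => m _; under [in RHS]eq_fun do rewrite -mulrA.
  by rewrite (EcZ entW hermW (A := all_edges)).
have a2 : algT (fun w => (c ^+ 2 * dl j w) a * utau b (peel j) w).
  under eq_fun do rewrite fpsM_coef mulr_suml.
  apply: (alg_sum_ord (F := fun m w => (c ^+ 2) m * dl j w (a - m)%N * utau b (peel j) w)) => m.
  by under eq_fun do rewrite -mulrA; apply: algZ.
rewrite E2 -(EcD entW hermW a1 a2) -(EcD entW hermW (algD a1 a2) a3).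
congr (Ec _); apply/funext => w.
have [[[_ uS _] _] iS'] := Dj.
have hE := hloops_expand2 W sigma c_eq (iN j) w uS iS'.
move: hE; rewrite -/(dl j w) => hE.
move: (congr1 (fun f : fps C => f a) hE); rewrite !fpsD_coef => hEa.
by rewrite /hl hEa; ring.
Qed.

(** Averaging [Ob_Ec_center_utau] over the vertices closes an induction on [a]. The order gains
    N^(-1/2) over what Cauchy-Schwarz yields, and this gain keeps trace covariances out of the
    coefficient of 1/N. *)
Lemma Ob_Ec_utau2 a b e :
  Ob iN 3 (near e) (fun j _ => Ec (fun w => utau a j w * utau b j w)).
Proof.
elim/ltn_ind: a b e => a IH b e.
have N0 : forall j, near e j -> (0 < iN j)%N := @near_gt0 e.
have ou k := Ob_utau entW hermW sigma_gt0 varW c_eq k e.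
have o1 := @Ob_Ec_center_utau a b e (fun q qa e' => IH q qa b e').
have o2 : Ob iN 3 (near e) (fun j _ => (iN j)%:R^-1 * \sum_(i <- iS j)
     Ec (fun w => (hloops (iN j) (iS j) i w a - c a) * utau b j w)).
  apply: (Ob_average entW hermW (F := fun j i _ => Ec (fun w => (hloops (iN j) (iS j) i w a - c a) * utau b j w))).
    by move=> j [[]].
  by move: o1 => /(Ob_reindex (g := at_vertex) (N' := fun q => iN q.1)
    (D' := fun q => near e q.1 /\ q.2 \in iS q.1)); apply.
have o3 : Ob iN 3 (near e) (fun j _ => ((size (iS j))%:R / (iN j)%:R - 1) * (c a * Ec (utau b j))).
  apply: (ObM entW hermW (s := 2) (s' := 1)); first exact: Ob_deficit.
  by apply: (ObZ entW hermW); apply: (Ob_expectation entW hermW).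
apply: Ob_ext (ObD entW hermW o2 o3) => j _ Dj.
have au k := Ob_alg N0 (ou k) Dj.
have ah i : i \in iS j -> algT (fun w => (hloops (iN j) (iS j) i w a - c a) * utau b j w).
  move=> iSj; apply: algM => //; apply: algB; last exact: alg_cst.
  by apply: algT_alg; exact: alg_wk.
rewrite -(Ec_sum entW hermW (A := all_edges))//.
rewrite -(EcZ entW hermW (A := all_edges)); last exact: alg_sum.
rewrite mulrA -(EcZ entW hermW (A := all_edges))//.
rewrite -(EcD entW hermW (A := all_edges)); last exact: algZ.
  congr (Ec _); apply/funext => w.
  have E : utau a j w = (iN j)%:R^-1 * (\sum_(i <- iS j) (hloops (iN j) (iS j) i w a - c a)) +
      ((size (iS j))%:R / (iN j)%:R - 1) * c a := tau_center W sigma c _ _ _ (N0 _ Dj).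
  by rewrite E -mulr_suml; ring.
by apply: algZ; exact: alg_sum.
Qed.

End trace_covariance.

(** * Exact covariances of quadratic forms in a row *)

Section quadratic_covariance.
Context d (T : measurableType d) (R : realType) (P : probability T R).
Local Notation C := R[i].
Local Notation Ec := (complex_expectation P).
Context (W : nat -> nat -> T -> C).
Context (entW : independent_centered_entries P W).
Context (hermW : forall i j w, W j i w = ((W i j w)^*)%C).
Context (sigma : R) (sigma_gt0 : 0 < sigma).
Context (varW : forall i j, i != j -> Ec (fun w => W i j w * W j i w) = (sigma ^+ 2)%:C%C).
Local Notation algT := (alg W all_edges).
Local Notation bdd := (bdd P W).
Local Notation rt := (@rt R).
Local Notation Ob := (Ob P W).
Local Notation X := (scaled W sigma).
Local Notation V := (reduced W sigma).
Local Notation wk := (wk W sigma).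
Local Notation ent := (ent W sigma).
Local Notation fluct := (fluct W sigma).
Local Notation fluct_incr := (fluct_incr W sigma).
Context (r : nat) (alpha : R).
(** A form of r being 0 or 1 that treats the real and complex cases in one computation. *)
Context (r_sqr : (r * r)%N = r).
Context (sqW : forall i j, i != j -> Ec (fun w => W i j w * W i j w) = r%:R * (sigma ^+ 2)%:C%C).
Context (fourthW : forall i j, i != j -> Ec (fun w => (W i j w * W j i w) ^+ 2) = alpha%:C%C).
Context (symW : r = 1%N -> forall i j w, W j i w = W i j w).
Local Notation tau := (tau W sigma).

(** The fourth absolute moment of the normalised off-diagonal entries. *)
Definition kurt : C := (alpha / sigma ^+ 4)%:C%C.

Let s0 : (sigma%:C%C : C) != 0.
Proof. by rewrite -[0](rmorph0 (real_complex R)) (inj_eq (@complexI R)) gt_eqF. Qed.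

Let sV : (sigma^-1)%:C%C = (sigma%:C%C : C)^-1.
Proof. by rewrite fmorphV. Qed.

Lemma Ec_reduced_sqr i j : i != j -> Ec (fun w => V i j w * V i j w) = r%:R.
Proof.
move=> ij; rewrite /reduced; under eq_fun do rewrite mulrACA.
rewrite (EcZ (A := all_edges) entW hermW); last by apply: algM; exact: alg_entry.
by rewrite sqW// sV rmorphXn/=; field.
Qed.

Lemma Ec_reduced4 i j : i != j -> Ec (fun w => (V i j w * V j i w) ^+ 2) = kurt.
Proof.
move=> ij; rewrite /reduced; under eq_fun do rewrite mulrACA exprMn.
rewrite (EcZ (A := all_edges) entW hermW); last by apply/algX/algM; exact: alg_entry.
rewrite fourthW// !sV /kurt rmorphM fmorphV rmorphXn/=.
by field.
Qed.

Lemma wk_sym N S k u v w : r = 1%N -> uniq S -> u \in S -> v \in S ->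
  wk N S k u v w = wk N S k v u w.
Proof.
move=> r1 uS uin vin; rewrite /wk -(walk_transpose _ _ uS)//.
congr (walk _ S k v u); apply/funext => a; apply/funext => b.
by rewrite /scaled (symW r1).
Qed.

Lemma wk_comp N S a b u v w : uniq S -> u \in S ->
  \sum_(l <- S) wk N S a u l w * wk N S b l v w = wk N S (a + b) u v w.
Proof.
move=> uS; elim: a u => [|a IH] u uin.
  by rewrite add0n /wk /= (sum_delta (fun l => walk _ S b l v)).
rewrite addSn /wk /=; under eq_bigr do rewrite mulr_suml.
rewrite exchange_big/=; apply: eq_big_seq => z zS.
by rewrite -[RHS](congr1 (fun y => X N u z w * y) (IH z zS)) mulr_sumr;
  apply: eq_bigr => l _; rewrite mulrA.
Qed.

Lemma alg_linear S i s (f p : nat -> T -> C) : {subset s <= S} ->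
  (forall l, l \in s -> alg W (within S) (f l)) -> (forall l, alg W (spoke i l) (p l)) ->
  alg W (past S i s) (fun w => \sum_(l <- s) f l w * p l w).
Proof.
move=> sS af ap; apply: alg_sum => l ls; apply: algM.
  by apply: alg_sub (af l ls) => a b; left.
by apply: alg_sub (ap l) => a b [[-> ->]|[-> ->]]; right; [left|right].
Qed.

Lemma spoke_within S i z : i \notin S ->
  forall a b, spoke i z a b -> ~ within S a b /\ ~ within S b a.
Proof.
by move=> iS a b [[-> ->]|[-> ->]]; rewrite /within (negbTE iS); split => -[].
Qed.

Lemma Ec_linear0 S i s g (f p : nat -> T -> C) : i \notin S ->
  alg W (within S) g -> {subset s <= S} ->
  (forall l, l \in s -> alg W (within S) (f l)) -> (forall l, alg W (spoke i l) (p l)) ->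
  (forall l, Ec (p l) = 0) ->
  Ec (fun w => g w * \sum_(l <- s) f l w * p l w) = 0.
Proof.
move=> iS ag sS af ap p0.
under eq_fun do rewrite mulr_sumr.
rewrite (Ec_sum entW hermW (A := all_edges)).
  rewrite big_seq big1// => l ls.
  rewrite (_ : (fun w => _) = fun w => p l w * (g w * f l w)); last by apply/funext => w; ring.
  apply: (Ec_spoke0 entW hermW (ap l) (p0 l) (A := within S)); first by apply: algM => //; exact: af.
  exact: spoke_within.
move=> l ls; apply: algM; first exact: algT_alg ag.
by apply: algM; [exact: algT_alg (af l ls)|exact: algT_alg (ap l)].
Qed.

(** Entries of the row at distinct vertices are independent and centred, so only equal vertices
    contribute to the double sum. *)
Lemma Ec_bilinear S i s (f p g q : nat -> T -> C) kappa : i \notin S -> uniq s ->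
  {subset s <= S} ->
  (forall l, l \in s -> alg W (within S) (f l)) -> (forall l, alg W (spoke i l) (p l)) ->
  (forall l, l \in s -> alg W (within S) (g l)) -> (forall l, alg W (spoke i l) (q l)) ->
  (forall l, Ec (p l) = 0) -> (forall l, Ec (q l) = 0) ->
  (forall l, l \in s -> Ec (fun w => p l w * q l w) = kappa) ->
  Ec (fun w => (\sum_(l <- s) f l w * p l w) * (\sum_(l <- s) g l w * q l w)) =
  kappa * \sum_(l <- s) Ec (fun w => f l w * g l w).
Proof.
move=> iS us sS af ap ag aq p0 q0 pq.
elim: s us sS af ag pq => [|z s IH] us sS af ag pq.
  by under eq_fun do rewrite !big_nil mulr0; rewrite complex_expectation_cst big_nil mulr0.
move: us => /= /andP[zs us].
have sS' : {subset s <= S} by move=> x xs; apply: sS; rewrite inE xs orbT.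
have af' l : l \in s -> alg W (within S) (f l) by move=> ls; apply: af; rewrite inE ls orbT.
have ag' l : l \in s -> alg W (within S) (g l) by move=> ls; apply: ag; rewrite inE ls orbT.
have pq' l : l \in s -> Ec (fun w => p l w * q l w) = kappa.
  by move=> ls; apply: pq; rewrite inE ls orbT.
have afz := af z (mem_head _ _); have agz := ag z (mem_head _ _).
have {}IH := IH us sS' af' ag' pq'.
pose A w := \sum_(l <- s) f l w * p l w; pose B w := \sum_(l <- s) g l w * q l w.
have aA : alg W (past S i s) A by exact: alg_linear.
have aB : alg W (past S i s) B by exact: alg_linear.
have dis := spoke_past (sS _ (mem_head _ _)) iS sS' zs.
have wp h : alg W (within S) h -> alg W (past S i s) h by apply: alg_sub => a b; left.
have E1 : Ec (fun w => p z w * (f z w * B w)) = 0.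
  by apply: (Ec_spoke0 entW hermW (ap z) (p0 z) _ dis); apply: algM => //; exact: wp.
have E2 : Ec (fun w => q z w * (g z w * A w)) = 0.
  by apply: (Ec_spoke0 entW hermW (aq z) (q0 z) _ dis); apply: algM => //; exact: wp.
have E3 : Ec (fun w => (p z w * q z w) * (f z w * g z w)) = kappa * Ec (fun w => f z w * g z w).
  rewrite (Ec_indep entW hermW (A := spoke i z) (B := within S)); last exact: spoke_within.
  - by rewrite pq// mem_head.
  - exact: algM.
  - exact: algM.
have t1 : algT (fun w => (p z w * q z w) * (f z w * g z w)).
  by apply: algM; apply: algM; [exact: algT_alg (ap z)|exact: algT_alg (aq z)|exact: algT_alg afz|exact: algT_alg agz].
have t2 : algT (fun w => p z w * (f z w * B w)).
  by apply: algM; [exact: algT_alg (ap z)|apply: algM; [exact: algT_alg afz|exact: algT_alg aB]].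
have t3 : algT (fun w => q z w * (g z w * A w)).
  by apply: algM; [exact: algT_alg (aq z)|apply: algM; [exact: algT_alg agz|exact: algT_alg aA]].
have t4 : algT (fun w => A w * B w) by apply: algM; [exact: algT_alg aA|exact: algT_alg aB].
rewrite (_ : (fun w => _) = fun w => ((p z w * q z w) * (f z w * g z w) + p z w * (f z w * B w)) +
   (q z w * (g z w * A w) + A w * B w)); last first.
  by apply/funext => w; rewrite !big_cons /A /B; ring.
rewrite (EcD entW hermW (algD t1 t2) (algD t3 t4)) (EcD entW hermW t1 t2) (EcD entW hermW t3 t4).
by rewrite E1 E2 E3 IH big_cons; ring.
Qed.

Lemma Ec_sum_indep A B (l : seq ((T -> C) * (T -> C))) :
  (forall q, q \in l -> alg W A q.1 /\ alg W B q.2) ->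
  (forall a b, A a b -> ~ B a b /\ ~ B b a) ->
  Ec (fun w => \sum_(q <- l) q.1 w * q.2 w) = \sum_(q <- l) Ec q.1 * Ec q.2.
Proof.
move=> al AB; rewrite (Ec_sum entW hermW (A := all_edges)).
  by apply: eq_big_seq => q ql; have [a b] := al q ql; exact: (Ec_indep entW hermW a b AB).
by move=> q ql; have [a b] := al q ql; apply: algM; [exact: algT_alg a|exact: algT_alg b].
Qed.

End quadratic_covariance.

Section quadratic_covariance_exact.
Context d (T : measurableType d) (R : realType) (P : probability T R).
Local Notation C := R[i].
Local Notation Ec := (complex_expectation P).
Context (W : nat -> nat -> T -> C).
Context (entW : independent_centered_entries P W).
Context (hermW : forall i j w, W j i w = ((W i j w)^*)%C).
Context (sigma : R) (sigma_gt0 : 0 < sigma).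
Context (varW : forall i j, i != j -> Ec (fun w => W i j w * W j i w) = (sigma ^+ 2)%:C%C).
Local Notation algT := (alg W all_edges).
Local Notation bdd := (bdd P W).
Local Notation rt := (@rt R).
Local Notation Ob := (Ob P W).
Local Notation X := (scaled W sigma).
Local Notation V := (reduced W sigma).
Local Notation wk := (wk W sigma).
Local Notation ent := (ent W sigma).
Local Notation fluct := (fluct W sigma).
Local Notation fluct_incr := (fluct_incr W sigma).
Context (r : nat) (alpha : R).
Context (r_sqr : (r * r)%N = r).
Context (sqW : forall i j, i != j -> Ec (fun w => W i j w * W i j w) = r%:R * (sigma ^+ 2)%:C%C).
Context (fourthW : forall i j, i != j -> Ec (fun w => (W i j w * W j i w) ^+ 2) = alpha%:C%C).
Context (symW : r = 1%N -> forall i j w, W j i w = W i j w).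
Local Notation tau := (tau W sigma).
Local Notation kurt := (kurt sigma alpha).

(** With V the new entry, the variance of its squared modulus gives [kurt - 1]; the mean of V times
    its conjugate is 1 and that of V squared is [r], which together produce the factor 1 + r on the
    row terms. *)
Lemma Ec_fluct_incr2 a b (j : idx) pre z s : root_ok j -> iS j = pre ++ z :: s ->
  let A := wk (iN j) (iS j) a in let B := wk (iN j) (iS j) b in
  Ec (fun w => fluct_incr j a z s w * fluct_incr j b z s w) =
  (kurt - 1) * Ec (fun w => A z z w * B z z w) +
  (1 + r%:R) * (\sum_(l <- s) Ec (fun w => A z l w * B l z w) +
                \sum_(l <- s) Ec (fun w => A l z w * B z l w)).
Proof.
move=> rj E A B.
have N0 := root_ok_gt0 rj; have [[_ uS SN] iS'] := rj.
set i := ii j; set S := iS j.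
rewrite -/i -/S in iS' uS E.
have zS : z \in S by rewrite E mem_cat mem_head orbT.
have sS : {subset s <= S} by move=> x xs; rewrite E mem_cat inE xs !orbT.
have /andP[zs us] : (z \notin s) && uniq s by move: uS; rewrite E => /uniq_catr.
have iz : i != z by apply: contraNneq iS' => ->.
have zi : z != i by rewrite eq_sym.
have il l : l \in s -> i != l by move=> /sS lS; apply: contraNneq iS' => ->.
have dis := spoke_past zS iS' sS zs.
have aA u v : u \in S -> alg W (within S) (A u v) by move=> uSi; exact: alg_wk.
have aB u v : u \in S -> alg W (within S) (B u v) by move=> uSi; exact: alg_wk.
have V1 l : alg W (spoke i l) (V i l) by apply: alg_reduced; left.
have V2 l : alg W (spoke i l) (V l i) by apply: alg_reduced; right.
have V01 l : Ec (V i l) = 0 by exact: (Ec_reduced entW hermW).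
have V02 l : Ec (V l i) = 0 by exact: (Ec_reduced entW hermW).
pose xa w := \sum_(l <- s) A z l w * V l i w.
pose ya w := \sum_(l <- s) A l z w * V i l w.
pose xb w := \sum_(l <- s) B z l w * V l i w.
pose yb w := \sum_(l <- s) B l z w * V i l w.
have axa : alg W (past S i s) xa by apply: alg_linear => // l ls; exact: aA.
have aya : alg W (past S i s) ya by apply: alg_linear => // l ls; apply: aA; exact: sS.
have axb : alg W (past S i s) xb by apply: alg_linear => // l ls; exact: aB.
have ayb : alg W (past S i s) yb by apply: alg_linear => // l ls; apply: aB; exact: sS.
have wp h : alg W (within S) h -> alg W (past S i s) h by apply: alg_sub => ? ?; left.
pose p w := V i z w * V z i w - 1.
have ap : alg W (spoke i z) p by apply: algB; [exact: algM|exact: alg_cst].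
have FaE w : fluct_incr j a z s w = p w * A z z w + V i z w * xa w + V z i w * ya w.
  rewrite /fluct_incr -/i -/S -/A /p /xa /ya; congr (_ + _ + _).
    rewrite mulr_sumr; congr (_ * _); apply: eq_bigr => l _.
    by rewrite mulrCA (rt_scaled _ _ _ _ _ N0).
  rewrite mulr_sumr mulrC; congr (_ * _); apply: eq_bigr => l _.
  by rewrite mulrA (rt_scaled _ _ _ _ _ N0) mulrC.
have FbE w : fluct_incr j b z s w = p w * B z z w + V i z w * xb w + V z i w * yb w.
  rewrite /fluct_incr -/i -/S -/B /p /xb /yb; congr (_ + _ + _).
    rewrite mulr_sumr; congr (_ * _); apply: eq_bigr => l _.
    by rewrite mulrCA (rt_scaled _ _ _ _ _ N0).
  rewrite mulr_sumr mulrC; congr (_ * _); apply: eq_bigr => l _.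
  by rewrite mulrA (rt_scaled _ _ _ _ _ N0) mulrC.
(* The nine products of the expansion, each as a factor on the spoke and a factor in the past. The
   four with exactly one [p] vanish: their past factor is linear in centred row entries. *)
pose l9 : seq ((T -> C) * (T -> C)) := [::
  (fun w => p w * p w, fun w => A z z w * B z z w);
  (fun w => p w * V i z w, fun w => A z z w * xb w);
  (fun w => p w * V z i w, fun w => A z z w * yb w);
  (fun w => p w * V i z w, fun w => B z z w * xa w);
  (fun w => V i z w * V i z w, fun w => xa w * xb w);
  (fun w => V i z w * V z i w, fun w => xa w * yb w);
  (fun w => p w * V z i w, fun w => B z z w * ya w);
  (fun w => V i z w * V z i w, fun w => ya w * xb w);
  (fun w => V z i w * V z i w, fun w => ya w * yb w)].
rewrite (_ : (fun w => _) = fun w => \sum_(q <- l9) q.1 w * q.2 w); last first.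
  by apply/funext => w; rewrite FaE FbE /l9 !big_cons big_nil /=; ring.
rewrite (Ec_sum_indep entW hermW (A := spoke i z) (B := past S i s)) => [|q|]; last exact: dis.
  rewrite /l9 !big_cons big_nil /=.
  have z1 : Ec (fun w => A z z w * xb w) = 0.
    by apply: (Ec_linear0 entW hermW iS' (aA z z zS) sS) => // l ls; exact: aB.
  have z2 : Ec (fun w => A z z w * yb w) = 0.
    by apply: (Ec_linear0 entW hermW iS' (aA z z zS) sS) => // l ls; apply: aB; exact: sS.
  have z3 : Ec (fun w => B z z w * xa w) = 0.
    by apply: (Ec_linear0 entW hermW iS' (aB z z zS) sS) => // l ls; exact: aA.
  have z4 : Ec (fun w => B z z w * ya w) = 0.
    by apply: (Ec_linear0 entW hermW iS' (aB z z zS) sS) => // l ls; apply: aA; exact: sS.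
  have c1 : Ec (fun w => xa w * xb w) = r%:R * \sum_(l <- s) Ec (fun w => A z l w * B z l w).
    apply: (Ec_bilinear entW hermW iS' us sS) => // l ls; [exact: aA|exact: aB|].
    by apply: (Ec_reduced_sqr entW hermW sigma_gt0 sqW); rewrite eq_sym il.
  have c2 : Ec (fun w => xa w * yb w) = 1 * \sum_(l <- s) Ec (fun w => A z l w * B l z w).
    apply: (Ec_bilinear entW hermW iS' us sS) => // l ls; [exact: aA|apply: aB; exact: sS|].
    by apply: (Ec_reduced2 entW hermW sigma_gt0 varW); rewrite eq_sym il.
  have c3 : Ec (fun w => ya w * xb w) = 1 * \sum_(l <- s) Ec (fun w => A l z w * B z l w).
    apply: (Ec_bilinear entW hermW iS' us sS) => // l ls; [apply: aA; exact: sS|exact: aB|].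
    by apply: (Ec_reduced2 entW hermW sigma_gt0 varW); rewrite il.
  have c4 : Ec (fun w => ya w * yb w) = r%:R * \sum_(l <- s) Ec (fun w => A l z w * B l z w).
    apply: (Ec_bilinear entW hermW iS' us sS) => // l ls; [apply: aA; exact: sS|apply: aB; exact: sS|].
    by apply: (Ec_reduced_sqr entW hermW sigma_gt0 sqW); rewrite il.
  have vv1 : Ec (fun w => V i z w * V i z w) = r%:R by exact: (Ec_reduced_sqr entW hermW sigma_gt0 sqW).
  have vv2 : Ec (fun w => V z i w * V z i w) = r%:R by exact: (Ec_reduced_sqr entW hermW sigma_gt0 sqW).
  have vv3 : Ec (fun w => V i z w * V z i w) = 1 by exact: (Ec_reduced2 entW hermW sigma_gt0 varW).
  have pp : Ec (fun w => p w * p w) = kurt - 1.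
    have aVV : algT (fun w => V i z w * V z i w).
      by apply: algM; [exact: algT_alg (V1 z)|exact: algT_alg (V2 z)].
    rewrite (_ : (fun w => _) = fun w => (V i z w * V z i w) ^+ 2 + ((-2) * (V i z w * V z i w) + 1)); last first.
      by apply/funext => w; rewrite /p; ring.
    rewrite (EcD entW hermW (algX 2 aVV)); last by apply: algD; [exact: algZ|exact: alg_cst].
    rewrite (EcD entW hermW (algZ (-2) aVV)); last exact: alg_cst.
    rewrite (EcZ entW hermW _ aVV) vv3 complex_expectation_cst.
    by rewrite (Ec_reduced4 entW hermW sigma_gt0 fourthW iz); ring.
  (* For r = 1 the powers are symmetric, so indices may be exchanged; for r = 0 the factor [r%:R]
     kills both sides. *)
  have sym (f g : nat -> T -> C) (h : nat -> T -> C) :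
      (r = 1%N -> forall l w, l \in s -> g l w = h l w) ->
      r%:R * \sum_(l <- s) Ec (fun w => f l w * g l w) = r%:R * \sum_(l <- s) Ec (fun w => f l w * h l w) :> C.
    move=> gh; have [r0|r1] : r = 0%N \/ r = 1%N.
      by move: r_sqr; case: (r) => [|[|m]] //; [left|right|rewrite mulSn; nia].
      by rewrite r0 !mul0r.
    congr (_ * _); apply: eq_big_seq => l ls; congr (Ec _); apply/funext => w.
    by rewrite gh.
  have S1 : r%:R * \sum_(l <- s) Ec (fun w => A z l w * B z l w) =
            r%:R * \sum_(l <- s) Ec (fun w => A z l w * B l z w) :> C.
    by apply: sym => r1 l w ls; apply: (wk_sym sigma symW _ _ w r1) => //; exact: sS.
  have S2 : r%:R * \sum_(l <- s) Ec (fun w => A l z w * B l z w) =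
            r%:R * \sum_(l <- s) Ec (fun w => A l z w * B z l w) :> C.
    by apply: sym => r1 l w ls; apply: (wk_sym sigma symW _ _ w r1) => //; exact: sS.
  have rr : r%:R * r%:R = r%:R :> C by rewrite -natrM r_sqr.
  rewrite z1 z2 z3 z4 c1 c2 c3 c4 vv1 vv2 vv3 pp !mulr0 !mul1r S1 S2 !(mulrA r%:R) rr.
  by ring.
rewrite /l9 !inE => ql.
have {ql} : (alg W (spoke i z) q.1 /\ alg W (past S i s) q.2).
  repeat (case/orP: ql => [/eqP -> /=|ql]; first by split; apply: algM => //; apply: wp; auto).
  by move/eqP: ql => -> /=; split; exact: algM.
by [].
Qed.

End quadratic_covariance_exact.

(** * Second moments of the excess at order 1/N *)

Section excess_covariance.
Context d (T : measurableType d) (R : realType) (P : probability T R).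
Local Notation C := R[i].
Local Notation Ec := (complex_expectation P).
Context (W : nat -> nat -> T -> C).
Context (entW : independent_centered_entries P W).
Context (hermW : forall i j w, W j i w = ((W i j w)^*)%C).
Context (sigma : R) (sigma_gt0 : 0 < sigma).
Context (varW : forall i j, i != j -> Ec (fun w => W i j w * W j i w) = (sigma ^+ 2)%:C%C).
Local Notation algT := (alg W all_edges).
Local Notation bdd := (bdd P W).
Local Notation rt := (@rt R).
Local Notation Ob := (Ob P W).
Local Notation X := (scaled W sigma).
Local Notation V := (reduced W sigma).
Local Notation wk := (wk W sigma).
Local Notation ent := (ent W sigma).
Local Notation fluct := (fluct W sigma).
Local Notation fluct_incr := (fluct_incr W sigma).
Context (r : nat) (alpha : R).
Context (r_sqr : (r * r)%N = r).
Context (sqW : forall i j, i != j -> Ec (fun w => W i j w * W i j w) = r%:R * (sigma ^+ 2)%:C%C).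
Context (fourthW : forall i j, i != j -> Ec (fun w => (W i j w * W j i w) ^+ 2) = alpha%:C%C).
Context (symW : r = 1%N -> forall i j w, W j i w = W i j w).
Local Notation tau := (tau W sigma).
Local Notation kurt := (kurt sigma alpha).

Lemma double_sum_cons (A : comNzRingType) (g : nat -> nat -> A) z s :
  \sum_(u <- z :: s) \sum_(v <- z :: s) g u v =
  g z z + \sum_(v <- s) g z v + \sum_(u <- s) g u z + \sum_(u <- s) \sum_(v <- s) g u v.
Proof.
transitivity (\sum_(u <- z :: s) (g u z + \sum_(v <- s) g u v)).
  by apply: eq_bigr => u _; rewrite big_cons.
by rewrite big_split/= !big_cons; ring.
Qed.

(** Increments at different vertices are orthogonal. Completing the sum over pairs by its diagonal
    costs 1 + r, which turns [kurt - 1] into [kurt - 2 - r]. *)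
Lemma Ec_chain2 a b (j : idx) pre s : root_ok j -> iS j = pre ++ s ->
  let A := wk (iN j) (iS j) a in let B := wk (iN j) (iS j) b in
  Ec (fun w => chainsum (fluct_incr j a) s w * chainsum (fluct_incr j b) s w) =
  (kurt - 2 - r%:R) * (\sum_(z <- s) Ec (fun w => A z z w * B z z w)) +
  (1 + r%:R) * (\sum_(z <- s) \sum_(l <- s) Ec (fun w => A z l w * B l z w)).
Proof.
move=> rj E A B; have N0 := root_ok_gt0 rj.
elim: s pre E => [|z s IH] pre E.
  by under eq_fun do rewrite mulr0; rewrite complex_expectation_cst !big_nil !mulr0 addr0.
have E' : iS j = (pre ++ [:: z]) ++ s by rewrite -catA.
have {}IH := IH _ E'.
have sS : {subset s <= iS j} by move=> x xs; rewrite E mem_cat inE xs !orbT.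
have zsS : {subset z :: s <= iS j} by move=> x xs; rewrite E mem_cat xs orbT.
have pc k : alg W (past (iS j) (ii j) s) (chainsum (fluct_incr j k) s) by exact: alg_fluct_past.
have tc k : algT (chainsum (fluct_incr j k) s) := algT_alg (pc k).
have tF k : algT (fluct_incr j k z s).
  have := algB (algT_alg (alg_fluct_past W sigma k zsS N0)) (tc k).
  by congr alg; apply/funext => w /=; ring.
have Z1 : Ec (fun w => fluct_incr j a z s w * chainsum (fluct_incr j b) s w) = 0.
  exact: (Ec_fluct_incr entW hermW sigma_gt0 varW a rj E).
have Z2 : Ec (fun w => fluct_incr j b z s w * chainsum (fluct_incr j a) s w) = 0.
  exact: (Ec_fluct_incr entW hermW sigma_gt0 varW b rj E).
rewrite (_ : (fun w => _) = fun w =>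
   (fluct_incr j a z s w * fluct_incr j b z s w + fluct_incr j a z s w * chainsum (fluct_incr j b) s w) +
   (fluct_incr j b z s w * chainsum (fluct_incr j a) s w + chainsum (fluct_incr j a) s w * chainsum (fluct_incr j b) s w)); last first.
  by apply/funext => w /=; ring.
rewrite (EcD entW hermW (algD (algM (tF a) (tF b)) (algM (tF a) (tc b)))
  (algD (algM (tF b) (tc a)) (algM (tc a) (tc b)))).
rewrite (EcD entW hermW (algM (tF a) (tF b)) (algM (tF a) (tc b))).
rewrite (EcD entW hermW (algM (tF b) (tc a)) (algM (tc a) (tc b))).
rewrite Z1 Z2 IH (Ec_fluct_incr2 entW hermW sigma_gt0 varW r_sqr sqW fourthW symW a b rj E).
by rewrite double_sum_cons big_cons -/A -/B; ring.
Qed.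

(** The sum over pairs is the trace of the product of the two powers, that is of the power
    [a + b]. *)
Lemma Ec_fluct2 a b (j : idx) : root_ok j ->
  Ec (fun w => fluct (iN j) (iS j) (ii j) a w * fluct (iN j) (iS j) (ii j) b w) =
  (iN j)%:R^-1 * ((kurt - 2 - r%:R) * ((iN j)%:R^-1 *
      \sum_(z <- iS j) Ec (fun w => wk (iN j) (iS j) a z z w * wk (iN j) (iS j) b z z w)) +
    (1 + r%:R) * Ec (tau (iN j) (iS j) (a + b)%N)).
Proof.
move=> rj; have N0 := root_ok_gt0 rj; have [[_ uS _] _] := rj.
have tc k : algT (chainsum (fluct_incr j k) (iS j)).
  by apply: algT_alg; exact: alg_fluct_past.
rewrite (_ : (fun w => _) = fun w => (iN j)%:R^-1 * (iN j)%:R^-1 *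
  (chainsum (fluct_incr j a) (iS j) w * chainsum (fluct_incr j b) (iS j) w)); last first.
  by apply/funext => w; rewrite !fluct_chain//; ring.
rewrite (EcZ entW hermW _ (algM (tc a) (tc b))) (Ec_chain2 a b (pre := [::]) rj erefl).
have -> : Ec (tau (iN j) (iS j) (a + b)%N) = (iN j)%:R^-1 *
   \sum_(z <- iS j) \sum_(l <- iS j) Ec (fun w => wk (iN j) (iS j) a z l w * wk (iN j) (iS j) b l z w).
  have tw k u v : u \in iS j -> algT (wk (iN j) (iS j) k u v).
    by move=> uSj; apply: algT_alg; exact: alg_wk.
  rewrite (EcZ entW hermW (A := all_edges)); last by apply: alg_sum => u uSj; exact: tw.
  rewrite (Ec_sum entW hermW (A := all_edges)); last by move=> u uSj; exact: tw.
  congr (_ * _); apply: eq_big_seq => z zS.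
  rewrite -(Ec_sum entW hermW (A := all_edges)).
    by congr (Ec _); apply/funext => w; rewrite wk_comp.
  by move=> l lS; apply: algM; exact: tw.
by ring.
Qed.

Context (s2 : R).
Context (diagW : forall i, Ec (fun w => W i i w * W i i w) = s2%:C%C).
Context (c : fps C) (c_eq : c = 1 + (fpsX C) ^+ 2 * c ^+ 2).
Local Notation excess := (excess W sigma c).
Local Notation hloops := (hloops W sigma).
Local Notation utau := (utau W sigma c).

Definition diagvar : C := (s2 / sigma ^+ 2)%:C%C.

(** The limit of N times the mean of the product of the coefficients [p] and [q] of the excess. *)
Definition excess_cov (p q : nat) : C :=
  match p, q with
  | 1, 1 => diagvar
  | p'.+2, q'.+2 => (kurt - 2 - r%:R) * (c p' * c q') + (1 + r%:R) * c (p' + q')%N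
  | _, _ => 0
  end.

(** In the exact formula, diagonal entries and traces are replaced by coefficients of [c] at a cost
    of N^(-1/2), on top of the factor 1/N. *)
Lemma Ob_fluct2 a b e : Ob iN 3 (root_near e) (fun j _ =>
  Ec (fun w => fluct (iN j) (iS j) (ii j) a w * fluct (iN j) (iS j) (ii j) b w) -
  (iN j)%:R^-1 * excess_cov a.+2 b.+2).
Proof.
have N0 : forall j, root_near e j -> (0 < iN j)%N := @root_near_gt0 e.
have N1 : forall j, near e j -> (0 < iN j)%N := @near_gt0 e.
pose D (q : idx * nat) := root_near e q.1 /\ q.2 \in iS q.1.
have N2 q : D q -> (0 < iN q.1)%N by case=> /N0.
have tr k := Ob_hloops_center entW hermW sigma_gt0 varW c_eq e (k := k)
   (fun m _ => trace_ok_all entW hermW sigma_gt0 varW c_eq m).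
have wc k : @Ob _ (fun q : idx * nat => iN q.1) 1 D (fun q w => wk (iN q.1) (iS q.1) k q.2 q.2 w - c k).
  by apply: (Ob_reindex (g := at_vertex) _ _ (tr k)) => // q [[? _] ?].
have w0 k : @Ob _ (fun q : idx * nat => iN q.1) 0 D (fun q w => wk (iN q.1) (iS q.1) k q.2 q.2 w).
  by apply: (Ob_reindex (g := at_vertex) _ _ (Ob_hloops entW hermW sigma_gt0 varW e k)) => // q [[? _] ?].
have o1 : @Ob _ (fun q : idx * nat => iN q.1) 1 D (fun q w => wk (iN q.1) (iS q.1) a q.2 q.2 w * wk (iN q.1) (iS q.1) b q.2 q.2 w - c a * c b).
  apply: Ob_ext (ObD entW hermW (ObM entW hermW (wc a) (w0 b)) (ObZ entW hermW (c a) (wc b))) => q w _.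
  by ring.
have o2 := Ob_expectation entW hermW N2 o1.
have o3 : Ob iN 1 (root_near e) (fun j _ => (iN j)%:R^-1 * (\sum_(z <- iS j)
    Ec (fun w => wk (iN j) (iS j) a z z w * wk (iN j) (iS j) b z z w - c a * c b))).
  apply: (Ob_average entW hermW (F := fun j z _ => Ec (fun w => wk (iN j) (iS j) a z z w * wk (iN j) (iS j) b z z w - c a * c b))).
    by move=> j [[[]]].
  exact: o2.
have o4 : Ob iN 1 (root_near e) (fun j _ => ((size (iS j))%:R / (iN j)%:R - 1) * (c a * c b)).
  apply: (ObM entW hermW (s := 1) (s' := 0)); last exact: Ob_cst.
  apply: (Ob_weaken entW hermW (s := 2)) => //.
  exact: (Ob_reindex (g := id) (D' := root_near e) (fun j h => h.1) (fun _ => erefl) (Ob_deficit P W e)).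
have o5 : Ob iN 1 (root_near e) (fun j _ => Ec (tau (iN j) (iS j) (a + b)%N) - c (a + b)%N).
  have ot := trace_ok_all entW hermW sigma_gt0 varW c_eq (a + b)%N e.
  have := Ob_expectation entW hermW N1 ot.
  move=> /(Ob_reindex (g := id) (N' := iN) (D' := root_near e) (fun j h => h.1) (fun _ => erefl)).
  apply: Ob_ext => j _ Dj.
  rewrite (EcB entW hermW (A := within (iS j))) ?complex_expectation_cst//; last exact: alg_cst.
  exact: alg_tau.
have o6 := ObM entW hermW (Ob_invN entW hermW N0) (ObD entW hermW
  (ObZ entW hermW (kurt - 2 - r%:R) (ObD entW hermW o3 o4)) (ObZ entW hermW (1 + r%:R) o5)).
apply: Ob_ext o6 => j _ Dj.
rewrite (Ec_fluct2 _ _ (root_near_ok Dj)) /excess_cov.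
have aw z : z \in iS j -> algT (fun w => wk (iN j) (iS j) a z z w * wk (iN j) (iS j) b z z w).
  by move=> zS; apply: algM; apply: algT_alg; exact: alg_wk.
have -> : \sum_(z <- iS j) Ec (fun w => wk (iN j) (iS j) a z z w * wk (iN j) (iS j) b z z w - c a * c b) =
  \sum_(z <- iS j) Ec (fun w => wk (iN j) (iS j) a z z w * wk (iN j) (iS j) b z z w) - (size (iS j))%:R * (c a * c b).
  transitivity (\sum_(z <- iS j) (Ec (fun w => wk (iN j) (iS j) a z z w * wk (iN j) (iS j) b z z w) - c a * c b)).
    apply: eq_big_seq => z zS; rewrite (EcB entW hermW (A := all_edges)) ?complex_expectation_cst//; last exact: alg_cst.
    exact: aw.
  by rewrite sumrB big_const_seq count_predT iter_addr_0 -[(c a * c b) *+ _]mulr_natl.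
by generalize kurt => K; field; rewrite pnatr_eq0 -lt0n (N0 _ Dj).
Qed.

(** Each coefficient is a fluctuation plus a centred trace. Mixed products average to 0 by
    [Ec_fluct0], and products of traces are negligible by [Ob_Ec_utau2]. *)
Lemma Ob_excess_cov p q e : Ob iN 3 (root_near e) (fun j _ =>
  Ec (fun w => excess (iN j) (iS j) (ii j) w p * excess (iN j) (iS j) (ii j) w q) -
  (iN j)%:R^-1 * excess_cov p q).
Proof.
have N0 : forall j, root_near e j -> (0 < iN j)%N := @root_near_gt0 e.
have O0 : Ob iN 3 (root_near e) (fun _ _ => 0).
  by apply: bdd_ext (bdd_cst _ _ (a := fun=> 0) (K := nsq 0) _) => // j w _; rewrite mulr0.
(* The diagonal entry is centred and occurs neither in the fluctuation nor in the trace. *)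
have X0 j k : root_near e j ->
    Ec (fun w => X (iN j) (ii j) (ii j) w * (fluct (iN j) (iS j) (ii j) k w + utau k j w)) = 0.
  move=> Dj; have [_ iS'] := Dj; have rj := root_near_ok Dj.
  pose B := past (iS j) (ii j) (iS j).
  have aB : alg W B (fun w => fluct (iN j) (iS j) (ii j) k w + utau k j w).
    apply: algD.
      rewrite (_ : fluct _ _ _ _ = fun w => (iN j)%:R^-1 * chainsum (fluct_incr j k) (iS j) w).
        by apply: algZ; apply: alg_fluct_past => //; exact: N0 Dj.
      by apply/funext => w; rewrite fluct_chain//; exact: N0 Dj.
    by apply: alg_sub (alg_utau W sigma c k j) => u v; left.
  rewrite (Ec_indep entW hermW (A := fun u v => u = ii j /\ v = ii j) _ aB).
  - rewrite (EcZ entW hermW (A := all_edges)) ?(Ec_entry entW) ?mulr0 ?mul0r//.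
    exact: alg_entry.
  - exact: alg_scaled.
  - move=> u v [-> ->]; rewrite /B /past /within (negbTE iS').
    by split=> -[[h _]|[[_ h]|[h _]]].
case: p => [|[|p]].
- apply: Ob_ext O0 => j _ _; under eq_fun do rewrite excess0 mul0r.
  by rewrite complex_expectation_cst mulr0 subrr.
- case: q => [|[|q]].
  + apply: Ob_ext O0 => j _ _; under eq_fun do rewrite excess0 mulr0.
    by rewrite complex_expectation_cst mulr0 subrr.
  + apply: Ob_ext O0 => j _ /N0 Nj; under eq_fun do rewrite !excess1.
    rewrite /scaled; under eq_fun do rewrite mulrACA.
    rewrite (EcZ entW hermW (A := all_edges)); last by apply: algM; exact: alg_entry.
    rewrite diagW /excess_cov /diagvar -!rmorphM/= -(rmorph_nat (real_complex R)) -fmorphV -rmorphM/= -rmorphB/=.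
    rewrite (_ : _ - _ = 0) ?rmorph0//.
    have sN : Num.sqrt (iN j)%:R ^+ 2 = (iN j)%:R :> R by rewrite sqr_sqrtr.
    rewrite -[X in _ - X^-1 * _]sN; field.
    by rewrite !gt_eqF// sqrtr_gt0 ltr0n.
  + apply: Ob_ext O0 => j _ Dj; under eq_fun do rewrite excess1 excessSS.
    by rewrite X0// mulr0 subrr.
case: q => [|[|q]].
- apply: Ob_ext O0 => j _ _; under eq_fun do rewrite excess0 mulr0.
  by rewrite complex_expectation_cst mulr0 subrr.
- apply: Ob_ext O0 => j _ Dj; under eq_fun do rewrite excess1 excessSS mulrC.
  by rewrite X0// mulr0 subrr.
have o1 := Ob_fluct2 p q e.
have o2 := Ob_reindex (g := id) (N' := iN) (D' := root_near e) (fun j h => h.1) (fun _ => erefl)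
  (Ob_Ec_utau2 entW hermW sigma_gt0 varW c_eq p q e).
apply: Ob_ext (ObD entW hermW o1 o2) => j _ Dj; have rj := root_near_ok Dj.
under [in RHS]eq_fun do rewrite !excessSS.
have tf k : algT (fluct (iN j) (iS j) (ii j) k) by exact: alg_fluct.
have wu k := alg_utau W sigma c k j.
have tu k : algT (utau k j) := algT_alg (wu k).
rewrite [in RHS](_ : (fun w => _) = fun w =>
  (fluct (iN j) (iS j) (ii j) p w * fluct (iN j) (iS j) (ii j) q w + fluct (iN j) (iS j) (ii j) p w * utau q j w) +
  (fluct (iN j) (iS j) (ii j) q w * utau p j w + utau p j w * utau q j w)); last first.
  by apply/funext => w; rewrite /utau; ring.
rewrite (EcD entW hermW (algD (algM (tf p) (tf q)) (algM (tf p) (tu q)))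
   (algD (algM (tf q) (tu p)) (algM (tu p) (tu q)))).
rewrite (EcD entW hermW (algM (tf p) (tf q)) (algM (tf p) (tu q))).
rewrite (EcD entW hermW (algM (tf q) (tu p)) (algM (tu p) (tu q))).
rewrite (Ec_fluct0 entW hermW sigma_gt0 varW p rj (wu q)).
rewrite (Ec_fluct0 entW hermW sigma_gt0 varW q rj (wu p)).
by rewrite /excess_cov; ring.
Qed.

End excess_covariance.

(** * Expansion of the mean trace *)

Section mean_expansion.
Context d (T : measurableType d) (R : realType) (P : probability T R).
Local Notation C := R[i].
Local Notation Ec := (complex_expectation P).
Context (W : nat -> nat -> T -> C).
Context (entW : independent_centered_entries P W).
Context (hermW : forall i j w, W j i w = ((W i j w)^*)%C).
Context (sigma : R) (sigma_gt0 : 0 < sigma).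
Context (varW : forall i j, i != j -> Ec (fun w => W i j w * W j i w) = (sigma ^+ 2)%:C%C).
Local Notation algT := (alg W all_edges).
Local Notation bdd := (bdd P W).
Local Notation rt := (@rt R).
Local Notation Ob := (Ob P W).
Local Notation X := (scaled W sigma).
Local Notation V := (reduced W sigma).
Local Notation wk := (wk W sigma).
Local Notation ent := (ent W sigma).
Local Notation fluct := (fluct W sigma).
Local Notation fluct_incr := (fluct_incr W sigma).
Context (r : nat) (alpha : R).
Context (r_sqr : (r * r)%N = r).
Context (sqW : forall i j, i != j -> Ec (fun w => W i j w * W i j w) = r%:R * (sigma ^+ 2)%:C%C).
Context (fourthW : forall i j, i != j -> Ec (fun w => (W i j w * W j i w) ^+ 2) = alpha%:C%C).
Context (symW : r = 1%N -> forall i j w, W j i w = W i j w).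
Local Notation tau := (tau W sigma).
Local Notation kurt := (kurt sigma alpha).
Context (s2 : R).
Context (diagW : forall i, Ec (fun w => W i i w * W i i w) = s2%:C%C).
Context (c : fps C) (c_eq : c = 1 + (fpsX C) ^+ 2 * c ^+ 2).
Local Notation excess := (excess W sigma c).
Local Notation hloops := (hloops W sigma).
Local Notation utau := (utau W sigma c).
Local Notation excess_cov := (excess_cov sigma r alpha s2 c).

(** The limit of N times the mean of the square of the excess series. *)
Definition second_order : fps C := fun k => \sum_(i < k.+1) excess_cov i (k - i).

Context (nu : nat -> fps C).
(** The recursion for the coefficient of 1/N with [e] vertices missing: the deficit of vertices, the
    bias of the trace after one more removal, and the second moment of the excess. *)
Context (nu_eq : forall e, nu e = - (fpsC e%:R * c) +
   (c ^+ 2 * ((fpsX C) ^+ 2 * nu e.+1) + c ^+ 3 * second_order)).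

(** The number of missing vertices must be exact here, since it changes the coefficient of 1/N. *)
Definition exact_near e (j : idx) : Prop := dom0 j /\ iN j = (size (iS j) + e)%N.
Definition exact_vertex e j := exact_near e j /\ ii j \in iS j.

Lemma exact_near_near e j : exact_near e j -> near e j.
Proof. by case=> D0 NE; split=> //; rewrite NE. Qed.

Lemma exact_vertex_near e j : exact_vertex e j -> vertex_near e j.
Proof. by case=> /exact_near_near. Qed.

Lemma exact_peel e j : exact_vertex e j -> exact_near e.+1 (peel j).
Proof.
move=> [[D0 NE] iS']; split; first by have [] := peel_ok (conj D0 iS').
rewrite /peel /= size_rem// NE.
by move: iS'; clear; case: (iS j) => //= x s _; rewrite addSnnS.
Qed.

Definition mean_ok k := forall e, Ob iN 3 (exact_near e) (fun j _ =>
  Ec (tau (iN j) (iS j) k) - c k - (iN j)%:R^-1 * nu e k).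

(** Take expectations in [hloops_expand3], term by term. *)
Lemma Ob_mean_loop k e : (forall m, (m < k)%N -> mean_ok m) ->
  Ob iN 3 (exact_vertex e) (fun j _ => Ec (fun w => hloops (iN j) (iS j) (ii j) w k) - c k -
    (iN j)%:R^-1 * (c ^+ 2 * ((fpsX C) ^+ 2 * nu e.+1) + c ^+ 3 * second_order) k).
Proof.
move=> IH.
have N0 : forall j, exact_vertex e j -> (0 < iN j)%N by move=> j /exact_vertex_near /vertex_near_gt0.
have tr := trace_ok_all entW hermW sigma_gt0 varW c_eq.
pose dl (j : idx) w := excess (iN j) (rem (ii j) (iS j)) (ii j) w.
pose hl (j : idx) w := hloops (iN j) (iS j) (ii j) w.
have ev s F : Ob iN s (vertex_near e) F -> Ob iN s (exact_vertex e) F.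
  by move=> O; apply: (Ob_reindex (g := id) _ _ O) => //; exact: exact_vertex_near.
have odl m : Ob iN 1 (exact_vertex e) (fun j w => dl j w m).
  by apply: ev; apply: (Ob_excess_peel entW hermW sigma_gt0 varW) => q _; exact: tr.
have ohl m : Ob iN 0 (exact_vertex e) (fun j w => hl j w m).
  by apply: ev; exact: (Ob_hloops entW hermW sigma_gt0 varW).
have adl m j : exact_vertex e j -> algT (fun w => dl j w m).
  by move=> Dj; exact: (Ob_alg N0 (odl m) Dj).
pose Ed (j : idx) : fps C := fun m => Ec (fun w => dl j w m).
pose Ed2 (j : idx) : fps C := fun m => Ec (fun w => (dl j w * dl j w) m).
have O0 : Ob iN 3 (exact_vertex e) (fun _ _ => 0).
  by apply: bdd_ext (bdd_cst _ _ (a := fun=> 0) (K := nsq 0) _) => // j w _; rewrite mulr0.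
(* First-order term: the fluctuation and the diagonal entry have mean 0, and what is left is the
   bias of a lower trace with [e.+1] vertices missing. *)
have o1 m : (m <= k)%N -> Ob iN 3 (exact_vertex e) (fun j _ =>
    (Ed j - fpsC (iN j)%:R^-1 * ((fpsX C) ^+ 2 * nu e.+1)) m).
  case: m => [|[|m]] mk.
  - apply: Ob_ext O0 => j _ _; rewrite fpsD_coef fpsN_coef fpsCM_coef fpsX2M_coef mulr0 subr0 /Ed.
    by under eq_fun do rewrite /dl excess0; rewrite complex_expectation_cst.
  - apply: Ob_ext O0 => j _ Dj; rewrite fpsD_coef fpsN_coef fpsCM_coef fpsX2M_coef mulr0 subr0 /Ed.
    under eq_fun do rewrite /dl excess1.
    rewrite (EcZ entW hermW (A := all_edges)) ?(Ec_entry entW) ?mulr0//.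
    exact: alg_entry.
  have := Ob_reindex (g := peel) (N' := iN) (@exact_peel e) (fun _ => erefl) (IH m (ltnW mk) e.+1).
  apply: Ob_ext => j _ Dj; rewrite fpsD_coef fpsN_coef fpsCM_coef fpsX2M_coef /Ed; congr (_ - _).
  have rj := root_near_ok (peel_near (exact_vertex_near Dj)).
  under [in RHS]eq_fun do rewrite /dl excessSS.
  have tT : algT (tau (iN j) (rem (ii j) (iS j)) m) by apply: algT_alg; exact: alg_tau.
  have tF : algT (fluct (iN j) (rem (ii j) (iS j)) (ii j) m) by exact: (alg_fluct W sigma m rj).
  rewrite (EcD entW hermW tF); last by apply: algB => //; exact: alg_cst.
  rewrite (EcB entW hermW tT (alg_cst _ _ _)) complex_expectation_cst.
  have := Ec_fluct0 entW hermW sigma_gt0 varW m (g := fun=> 1) rj (alg_cst _ _ _).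
  by under eq_fun do rewrite mulr1; move=> ->; rewrite add0r.
(* Second-order term, from [Ob_excess_cov] along each antidiagonal. *)
have o2 m : Ob iN 3 (exact_vertex e) (fun j _ =>
    (Ed2 j - fpsC (iN j)%:R^-1 * second_order) m).
  have H : Ob iN 3 (exact_vertex e) (fun j _ => \sum_(i < m.+1)
     (Ec (fun w => dl j w i * dl j w (m - i)%N) - (iN j)%:R^-1 * excess_cov i (m - i)%N)).
    apply: (Ob_sum_ord entW hermW) => i.
    have := Ob_excess_cov entW hermW sigma_gt0 varW r_sqr sqW fourthW symW diagW c_eq i (m - i)%N e.+1.
    move=> O; apply: (Ob_reindex (g := peel) _ _ O) => // j /exact_vertex_near.
    exact: peel_near.
  apply: Ob_ext H => j _ Dj.
  rewrite fpsD_coef fpsN_coef fpsCM_coef /Ed2 /second_order.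
  under [in RHS]eq_fun do rewrite fpsM_coef.
  rewrite (Ec_sum_ord entW hermW (A := all_edges) (F := fun i w => dl j w i * dl j w (m - i)%N)).
    by rewrite mulr_sumr -sumrB.
  by move=> i; apply: algM; exact: adl.
have oc q m : Ob iN 0 (exact_vertex e) (fun _ _ => (c ^+ q) m) by exact: Ob_const_fps.
have p1 : Ob iN 3 (exact_vertex e) (fun j _ => (c ^+ 2 * (Ed j - fpsC (iN j)%:R^-1 * ((fpsX C) ^+ 2 * nu e.+1))) k).
  exact: (Ob_prod_fps entW hermW (s := 0) (s' := 3) (K := k)
    (F := fun _ _ => c ^+ 2) (G := fun j _ => Ed j - fpsC (iN j)%:R^-1 * ((fpsX C) ^+ 2 * nu e.+1))).
have p2 : Ob iN 3 (exact_vertex e) (fun j _ => (c ^+ 3 * (Ed2 j - fpsC (iN j)%:R^-1 * second_order)) k).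
  exact: (Ob_prod_fps entW hermW (s := 0) (s' := 3) (K := k)
    (F := fun _ _ => c ^+ 3) (G := fun j _ => Ed2 j - fpsC (iN j)%:R^-1 * second_order)).
(* The cubic remainder is estimated without computing it. *)
have p3 : Ob iN 3 (exact_vertex e) (fun j w => (c ^+ 3 * (dl j w * dl j w * dl j w * hl j w)) k).
  apply: (Ob_prod_fps entW hermW (s := 0) (s' := 3) (K := k)
    (F := fun _ _ => c ^+ 3) (G := fun j w => dl j w * dl j w * dl j w * hl j w)) => // q _.
  apply: (Ob_prod_fps entW hermW (s := 3) (s' := 0) (K := q)
    (F := fun j w => dl j w * dl j w * dl j w) (G := hl)) => // q' _.
  apply: (Ob_prod_fps entW hermW (s := 2) (s' := 1) (K := q')
    (F := fun j w => dl j w * dl j w) (G := dl)) => // q'' _.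
  exact: (Ob_prod_fps entW hermW (s := 1) (s' := 1) (K := q'') (F := dl) (G := dl)).
have p4 := Ob_expectation entW hermW N0 p3.
apply: Ob_ext (ObD entW hermW (ObD entW hermW p1 p2) p4) => j _ Dj.
have adl2 m : algT (fun w => (dl j w * dl j w) m).
  under eq_fun do rewrite fpsM_coef.
  apply: (alg_sum_ord (F := fun i w => dl j w i * dl j w (m - i)%N)) => i.
  by apply: algM; exact: adl.
have lin (f : fps C) (g : T -> fps C) : (forall m, algT (fun w => g w m)) ->
    algT (fun w => (f * g w) k) /\ Ec (fun w => (f * g w) k) = (f * (fun m => Ec (fun w => g w m)) : fps C) k.
  move=> ag.
  have aF (i : 'I_k.+1) : algT (fun w => f i * g w (k - i)%N) by exact: algZ.
  have E : (fun w => (f * g w) k) = (fun w => \sum_(i < k.+1) f i * g w (k - i)%N).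
    by apply/funext => w; rewrite fpsM_coef.
  rewrite E; split; first exact: (alg_sum_ord (F := fun i w => f i * g w (k - i)%N)).
  rewrite (Ec_sum_ord entW hermW (F := fun i w => f i * g w (k - i)%N) aF) fpsM_coef.
  by apply: eq_bigr => i _; rewrite (EcZ entW hermW (A := all_edges)).
have [a1 e1] := lin (c ^+ 2) (dl j) (fun m => adl m j Dj).
have [a2 e2] := lin (c ^+ 3) (fun w => dl j w * dl j w) adl2.
have a3 := Ob_alg N0 p3 Dj.
have [[[_ uS _] _] iS'] := exact_vertex_near Dj.
rewrite [in RHS](_ : (fun w => _) = fun w => (c k + (c ^+ 2 * dl j w) k) +
  ((c ^+ 3 * (dl j w * dl j w)) k + (c ^+ 3 * (dl j w * dl j w * dl j w * hl j w)) k)); last first.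
  apply/funext => w; have := hloops_expand3 W sigma c_eq (iN j) w uS iS'.
  move=> /(congr1 (fun f : fps C => f k)); rewrite !fpsD_coef => ->.
  by rewrite expr2 !addrA.
rewrite (EcD entW hermW (algD (alg_cst _ _ _) a1) (algD a2 a3)).
rewrite (EcD entW hermW (alg_cst _ _ _) a1) (EcD entW hermW a2 a3).
rewrite complex_expectation_cst e1 e2 -/(Ed j) -/(Ed2 j).
have -> : (iN j)%:R^-1 * (c ^+ 2 * ((fpsX C) ^+ 2 * nu e.+1) + c ^+ 3 * second_order) k =
   (c ^+ 2 * (fpsC (iN j)%:R^-1 * ((fpsX C) ^+ 2 * nu e.+1)) +
   c ^+ 3 * (fpsC (iN j)%:R^-1 * second_order)) k.
  rewrite -(fpsCM_coef (iN j)%:R^-1 (c ^+ 2 * ((fpsX C) ^+ 2 * nu e.+1) + c ^+ 3 * second_order)).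
  rewrite (_ : fpsC (iN j)%:R^-1 * (_ + _) = c ^+ 2 * (fpsC (iN j)%:R^-1 * ((fpsX C) ^+ 2 * nu e.+1)) +
     c ^+ 3 * (fpsC (iN j)%:R^-1 * second_order) :> fps C)//.
  by ring.
by rewrite !mulrBr !fpsD_coef !fpsN_coef; ring.
Qed.

(** Averages the previous expansion over N - e vertices while dividing by N; the missing share of
    the leading term is the summand - e c of the recursion. *)
Lemma Ob_mean k : mean_ok k.
Proof.
elim/ltn_ind: k => k IH e.
pose rho : C := (c ^+ 2 * ((fpsX C) ^+ 2 * nu e.+1) + c ^+ 3 * second_order) k.
have N0 : forall j, exact_near e j -> (0 < iN j)%N by move=> j /exact_near_near /near_gt0.
have o1 := Ob_mean_loop e IH.
have o2 : Ob iN 3 (exact_near e) (fun j _ => (iN j)%:R^-1 * (\sum_(i <- iS j)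
   (Ec (fun w => hloops (iN j) (iS j) i w k) - c k - (iN j)%:R^-1 * rho))).
  apply: (Ob_average entW hermW (F := fun j i _ => Ec (fun w => hloops (iN j) (iS j) i w k) - c k - (iN j)%:R^-1 * rho)).
    by move=> j [[]].
  by move: o1 => /(Ob_reindex (g := at_vertex) (N' := fun q => iN q.1)
    (D' := fun q => exact_near e q.1 /\ q.2 \in iS q.1)); apply.
have oN := Ob_invN entW hermW N0.
(* The missing share of the correction itself, which is of order 1/N^2. *)
have o3 : Ob iN 3 (exact_near e) (fun j _ => (iN j)%:R^-1 * (iN j)%:R^-1 * (- (e%:R * rho))).
  apply: (Ob_weaken entW hermW (s := 4)) => //.
  by apply: (ObM entW hermW (s := 4) (s' := 0)); [exact: (ObM entW hermW oN oN)|exact: Ob_cst].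
apply: Ob_ext (ObD entW hermW o2 o3) => j _ Dj.
have NN : (iN j)%:R != 0 :> C by rewrite pnatr_eq0 -lt0n N0.
have wa u : u \in iS j -> algT (wk (iN j) (iS j) k u u) by move=> uS; apply: algT_alg; exact: alg_wk.
rewrite (EcZ entW hermW (A := all_edges)); last by apply: alg_sum => u; exact: wa.
rewrite (Ec_sum entW hermW (A := all_edges)) => [|u]; last exact: wa.
rewrite nu_eq fpsD_coef fpsN_coef fpsCM_coef -/rho.
rewrite !sumrB !big_const_seq !count_predT !iter_addr_0 -[(c k) *+ _]mulr_natl -[(_ * rho) *+ _]mulr_natl.
have sE : (size (iS j))%:R = (iN j)%:R - e%:R :> C.
  by case: Dj => _ ->; rewrite natrD addrK.
rewrite sE.
set S := \sum_(i <- iS j) Ec _.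
by field.
Qed.

End mean_expansion.

(* With s = sqrt(1 - 4t^2): A = 1/s generates the arcsine moments, c = 2/(1 + s) = 2w the
   semicircle moments and z = 4t^2 = 1 - s^2; the identity is the equation of [correction_eq]
   multiplied by 2 z^2. *)
Lemma correction_identity (B : comNzRingType) (s A w k s' r : B) :
  A * s = 1 -> w * (1 + s) = 1 ->
  let z := 1 - s ^+ 2 in let k1 := k - 2 - r in
  let k2 := s' - 4 * k + 7 + 3 * r in let k3 := 2 * (k - s' - 1) in
  (r * z ^+ 2 * (A ^+ 2 - A) + k1 * (16 * (A - 1) - 8 * z) + k2 * (4 * z * (A - 1)) +
    k3 * (z ^+ 2 * A)) * (1 - w ^+ 2 * z) + z ^+ 2 * (2 * w ^+ 2 * z) * (w ^+ 2 * z * A + 2 * w) =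
  z ^+ 2 * (4 * w ^+ 3 * z * s' + w ^+ 3 * z ^+ 2 *
    (4 * k1 * w ^+ 2 + (1 + r) * (2 * w ^+ 2 * z * A + 2 * w))).
Proof.
move=> As ws1.
have ws : w * s = 1 - w by apply/eqP; rewrite eq_sym subr_eq -ws1; apply/eqP; ring.
have Aw : A * w = A - w.
  have h : A * (w * (1 + s)) = A * w + w * (A * s) by ring.
  by apply/eqP; rewrite eq_sym subr_eq; move: h; rewrite ws1 As !mulr1 => <-.
rewrite /=; set z := 1 - s ^+ 2; set k1 := k - 2 - r.
set N := (X in X * (1 - _)).
(* The relations [As] and [ws] reduce all products until only powers of [s] and terms linear in [w],
   [A] and [A ^+ 2] remain. *)
have e1 : w ^+ 2 * z = 2 * w - 1 by rewrite /z; ring: ws.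
have e2 : w * z = 1 - s by rewrite /z; ring: ws.
have e3 : z * (2 * w - 1) = (1 - s) ^+ 2 by rewrite mulrBr mulrCA [z * w]mulrC e2 /z; ring.
have e4 : z * A = A - s by rewrite /z; ring: As.
have e5 : (2 * w - 1) * A = A - 2 * w by ring: Aw.
have A2w : A ^+ 2 * w = A ^+ 2 - A + w by ring: Aw.
have ws2 : s ^+ 2 * w = s - 1 + w by ring: ws.
have ws3 : s ^+ 3 * w = s ^+ 2 - s + 1 - w by ring: ws.
have NE : N = r * (A ^+ 2 - 5 * A + 10 - 10 * s + 5 * s ^+ 2 - s ^+ 3) +
    k * (2 * A - 8 + 12 * s - 8 * s ^+ 2 + 2 * s ^+ 3) +
    s' * (2 * A - 4 + 4 * s ^+ 2 - 2 * s ^+ 3) +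
    (- 6 * A + 20 - 24 * s + 12 * s ^+ 2 - 2 * s ^+ 3).
  rewrite /N /k1; have -> : r * z ^+ 2 * (A ^+ 2 - A) = r * ((z * A) ^+ 2 - z * (z * A)) by ring.
  have -> : 4 * z * (A - 1) = 4 * (z * A - z) by ring.
  have -> : z ^+ 2 * A = z * (z * A) by ring.
  have e4' : z * (A - s) = A - 2 * s + s ^+ 3 by rewrite /z; ring: As.
  have e4'' : (A - s) ^+ 2 = A ^+ 2 - 2 + s ^+ 2 by ring: As.
  by rewrite e4 e4' e4'' /z; ring.
have Nw : N * w = r * (A ^+ 2 * w - 5 * (A * w) + 10 * w - 10 * (w * s) + 5 * (s ^+ 2 * w) - s ^+ 3 * w) +
    k * (2 * (A * w) - 8 * w + 12 * (w * s) - 8 * (s ^+ 2 * w) + 2 * (s ^+ 3 * w)) +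
    s' * (2 * (A * w) - 4 * w + 4 * (s ^+ 2 * w) - 2 * (s ^+ 3 * w)) +
    (- 6 * (A * w) + 20 * w - 24 * (w * s) + 12 * (s ^+ 2 * w) - 2 * (s ^+ 3 * w)) by rewrite NE; ring.
rewrite Aw A2w ws ws2 ws3 in Nw.
transitivity (N * (2 - 2 * w) + 2 * (A - s) * (1 - s) ^+ 2).
  rewrite -e4 -e3 [z * A](_ : _ = z * ((2 * w - 1) * A + 2 * w)); last by rewrite e5; ring.
  by rewrite (_ : 2 - 2 * w = 1 - w ^+ 2 * z) -?e1; [|rewrite e1]; ring.
transitivity (4 * s' * (1 - s) ^+ 3 + 4 * k1 * (1 - s) ^+ 3 * (2 * w - 1) + 2 * (1 + r) * (1 - s) ^+ 3 * (A - 1)).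
  have f1 : (1 - s) ^+ 3 * A = A - 3 + 3 * s - s ^+ 2 by ring: As.
  have f2 : (1 - s) ^+ 3 * w = w - 3 * (w * s) + 3 * (s ^+ 2 * w) - s ^+ 3 * w by ring.
  rewrite ws ws2 ws3 in f2.
  have f3 : (A - s) * (1 - s) ^+ 2 = A - 2 + 2 * s ^+ 2 - s ^+ 3 by ring: As.
  rewrite (_ : N * (2 - 2 * w) = 2 * N - 2 * (N * w)); last by ring.
  rewrite (_ : 4 * k1 * (1 - s) ^+ 3 * (2 * w - 1) = 4 * k1 * (2 * ((1 - s) ^+ 3 * w) - (1 - s) ^+ 3)); last by ring.
  rewrite (_ : 2 * (1 + r) * (1 - s) ^+ 3 * (A - 1) = 2 * (1 + r) * ((1 - s) ^+ 3 * A - (1 - s) ^+ 3)); last by ring.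
  rewrite (_ : 2 * (A - s) * (1 - s) ^+ 2 = 2 * ((A - s) * (1 - s) ^+ 2)); last by ring.
  by rewrite Nw f1 f2 f3 NE /k1; ring.
have e6 : z * (A - w) = A - 1 by rewrite mulrBr e4 [z * w]mulrC e2; ring.
have -> : w ^+ 3 * z ^+ 2 * (4 * k1 * w ^+ 2 + (1 + r) * (2 * w ^+ 2 * z * A + 2 * w)) =
  (w * z) * (w ^+ 2 * z) * (4 * k1 * w ^+ 2 + (1 + r) * (2 * ((w ^+ 2 * z) * A) + 2 * w)) by ring.
have -> : 4 * w ^+ 3 * z * s' = 4 * w * (w ^+ 2 * z) * s' by ring.
rewrite e1 e5.
have -> : z ^+ 2 * (4 * w * (2 * w - 1) * s' + w * z * (2 * w - 1) * (4 * k1 * w ^+ 2 + (1 + r) * (2 * (A - 2 * w) + 2 * w))) =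
  (w * z) * (z * (2 * w - 1)) * (4 * s') + (w * z) ^+ 3 * (2 * w - 1) * (4 * k1) +
  (w * z) * (z * (2 * w - 1)) * ((1 + r) * 2 * (z * (A - w))) by ring.
by rewrite e2 e3 e6; ring.
Qed.

(** * Generating series of the limiting moments *)

Section moment_series.
Context (F : numFieldType).
Local Notation X := (fpsX F).
Local Notation fps := (fps F).

(** The arcsine moments, by the recursion that integration by parts gives; the even ones are the
    central binomial coefficients. *)
Fixpoint arc (k : nat) : F :=
  match k with
  | 0 => 1
  | 1 => 0
  | k'.+2 => 4 * k'.+1%:R / k'.+2%:R * arc k'
  end.

Definition arc_series : fps := arc.
(** The semicircle density is 2 - x^2 / 2 times the arcsine density, hence this combination; the
    even values are the Catalan numbers. *)
Definition sc_series : fps := fun k => 2 * arc k - arc k.+2 / 2.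
Local Notation A := arc_series.
Local Notation c := sc_series.

Lemma fps_nat n : (n%:R : fps) = fpsC n%:R.
Proof.
elim: n => [|n IH]; first by apply/funext => k; rewrite /fpsC; case: ifP.
by rewrite -natr1 IH -(fpsC1 F) -fpsCD natr1.
Qed.

(** The differential equation of (1 - 4 t^2)^(-1/2); its coefficients are the recursion defining
    [arc]. *)
Lemma theta_arc : theta A * (1 - 4 * X ^+ 2) = 4 * X ^+ 2 * A.
Proof.
rewrite mulrBr mulr1; apply/eqP; rewrite subr_eq; apply/eqP.
rewrite (_ : 4 * X ^+ 2 * A + theta A * (4 * X ^+ 2) = X ^+ 2 * (4 * (A + theta A))); last by ring.
apply/funext => k; rewrite fpsX2M_coef /theta; case: k => [|[|k]]; rewrite ?mul0r ?mulr0//.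
rewrite fps_nat fpsCM_coef fpsD_coef /arc_series /=.
have : k.+2%:R != 0 :> F by rewrite pnatr_eq0.
rewrite -!(natr1 k.+1) -!(natr1 k) => h.
by field.
Qed.

Lemma fps_theta0 (f : fps) : theta f = 0 -> f = fpsC (f 0%N).
Proof.
move=> h; apply/funext => -[|k] //; rewrite /fpsC /=.
have := congr1 (fun g : fps => g k.+1) h; rewrite /theta fps0_coef => /eqP.
by rewrite mulf_eq0 pnatr_eq0 /= => /eqP.
Qed.

Lemma fps_mul0 (f g : fps) : (f * g) 0%N = f 0%N * g 0%N.
Proof. by rewrite fpsM_coef big_ord1. Qed.

Lemma theta_nat n : theta (n%:R : fps) = 0.
Proof.
rewrite fps_nat; apply/funext => -[|k]; rewrite /theta /fpsC /= ?mul0r ?mulr0//.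
Qed.

(** By [theta_arc] the Euler derivative of the left-hand side is 0, so the series equals its
    constant term. *)
Lemma arc_sqr : A ^+ 2 * (1 - 4 * X ^+ 2) = 1.
Proof.
have h : theta (A ^+ 2 * (1 - 4 * X ^+ 2)) = 0.
  rewrite thetaM expr2 thetaM.
  rewrite [theta (1 - _)](_ : _ = - (8 * X ^+ 2)); last first.
    have -> : 1 - 4 * X ^+ 2 = 1 + (-1) * (4 * (X * X)) :> fps by ring.
    have tN1 : theta (-1 : fps) = 0.
      have := thetaD (1 : fps) (-1); rewrite subrr theta1 add0r => <-.
      exact: (theta_nat 0).
    by rewrite thetaD theta1 thetaM tN1 thetaM theta_nat thetaM thetaX; ring.
  rewrite [LHS](_ : _ = 2 * A * (theta A * (1 - 4 * X ^+ 2)) - A ^+ 2 * (8 * X ^+ 2)); last by ring.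
  by rewrite theta_arc; ring.
rewrite (fps_theta0 h) expr2 !fps_mul0 !mul1r fpsD_coef fpsN_coef fps_mul0 expr2 fps_mul0.
by rewrite fps1_coef /fpsX /= mulr0 mulr0 subr0 fpsC1.
Qed.

(** The square root of 1 - 4 t^2. *)
Definition rootS : fps := A * (1 - 4 * X ^+ 2).

Lemma arc_root : A * rootS = 1.
Proof. by rewrite /rootS mulrA -expr2 arc_sqr. Qed.

Lemma root_sqr : rootS ^+ 2 = 1 - 4 * X ^+ 2.
Proof. by rewrite /rootS exprMn [X in _ * X]expr2 mulrA arc_sqr mul1r. Qed.

Lemma sc_root : 2 * X ^+ 2 * c = 1 - rootS.
Proof.
rewrite /rootS (_ : 1 - A * (1 - 4 * X ^+ 2) = 1 - A + X ^+ 2 * (4 * A)); last by ring.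
rewrite (_ : 2 * X ^+ 2 * c = X ^+ 2 * (2 * c)); last by ring.
apply/funext => k; rewrite !fpsD_coef fpsN_coef !fpsX2M_coef fps1_coef.
case: k => [|[|k]]; rewrite /arc_series ?addr0/= ?subrr ?subr0//.
rewrite !fps_nat !fpsCM_coef /sc_series /=.
have : k.+2%:R != 0 :> F by rewrite pnatr_eq0.
by move=> h; field.
Qed.

Lemma fps_nat_inj n (f g : fps) : n.+1%:R * f = n.+1%:R * g -> f = g.
Proof.
move=> h; apply/funext => k; have := congr1 (fun u : fps => u k) h.
by rewrite !fps_nat !fpsCM_coef; apply: mulfI; rewrite pnatr_eq0.
Qed.

Lemma fpsX2_inj (f g : fps) : X ^+ 2 * f = X ^+ 2 * g -> f = g.
Proof. by rewrite expr2 -!mulrA => /fpsXM_inj /fpsXM_inj. Qed.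

Lemma sc_root2 : c * (1 + rootS) = 2.
Proof.
apply/fpsX2_inj/(@fps_nat_inj 1).
rewrite (_ : 2 * (X ^+ 2 * (c * (1 + rootS))) = (2 * X ^+ 2 * c) * (1 + rootS)); last by ring.
rewrite sc_root (_ : (1 - rootS) * (1 + rootS) = 1 - rootS ^+ 2); last by ring.
by rewrite root_sqr; ring.
Qed.

(** Eliminate the root between 2 t^2 c = 1 - s and c (1 + s) = 2. *)
Lemma sc_eq : c = 1 + X ^+ 2 * c ^+ 2.
Proof.
apply: (@fps_nat_inj 1).
rewrite (_ : 2 * (1 + X ^+ 2 * c ^+ 2) = 2 + (2 * X ^+ 2 * c) * c); last by ring.
rewrite sc_root -[X in X + _]sc_root2; ring.
Qed.

(** Differentiate [sc_eq], then divide by 1 - 2 t^2 c, which is the root, that is multiply by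
    [A]. *)
Lemma theta_sc : theta c = 2 * X ^+ 2 * c ^+ 2 * A.
Proof.
have h : theta c * rootS = 2 * X ^+ 2 * c ^+ 2.
  have -> : rootS = 1 - 2 * X ^+ 2 * c by rewrite sc_root; ring.
  rewrite mulrBr mulr1 {1}sc_eq thetaD theta1 add0r expr2 thetaM thetaM thetaX expr2 thetaM.
  by ring.
by rewrite -h -mulrA [rootS * A]mulrC arc_root mulr1.
Qed.

(** Moments of the half sum of the unit masses at 2 and -2. *)
Definition even_pow : fps := fun k => (2 ^+ k + (-2) ^+ k) / 2.

Lemma even_powE : even_pow = A ^+ 2.
Proof.
have h : even_pow * (1 - 4 * X ^+ 2) = 1.
  rewrite (_ : _ * _ = even_pow - X ^+ 2 * (4 * even_pow)); last by ring.
  apply/funext => k; rewrite fpsD_coef fpsN_coef fpsX2M_coef fps1_coef.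
  case: k => [|[|k]]; rewrite /even_pow ?expr0 ?expr1 /= ?mulr1n ?mulr0n; [by field|by field|].
  by rewrite fps_nat fpsCM_coef !exprS; field.
by rewrite -[LHS]mulr1 -arc_sqr mulrCA h mulr1.
Qed.

Context (k s' r : F).
Let k1 := k - 2 - r.
Let k2 := s' - 4 * k + 7 + 3 * r.
Let k3 := 2 * (k - s' - 1).

(** The moments of the signed measure nu, with [k] for alpha / sigma^4 and [s'] for s2 / sigma^2. *)
Definition correction : fps := fun m =>
  r / 2 * (even_pow m - arc m) +
  (k1 * arc m.+4 + k2 * arc m.+2 + k3 * arc m) / 2.

Definition second_order_series : fps :=
  fpsC s' * X ^+ 2 + X ^+ 4 * (fpsC k1 * c ^+ 2 + fpsC (1 + r) * (theta c + c)).

(** The factor t^4 absorbs the index shifts by two and four, leaving an expression in [A] alone. *)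
Lemma correction_shift : 2 * X ^+ 4 * correction =
  fpsC r * X ^+ 4 * (A ^+ 2 - A) + fpsC k1 * (A - 1 - 2 * X ^+ 2) +
  fpsC k2 * (X ^+ 2 * (A - 1)) + fpsC k3 * (X ^+ 4 * A).
Proof.
pose A2 : fps := fun m => arc m.+2; pose A4 : fps := fun m => arc m.+4.
have h2 : X ^+ 2 * A2 = A - 1.
  apply/funext => m; rewrite fpsX2M_coef fpsD_coef fpsN_coef fps1_coef.
  by case: m => [|[|m]]; rewrite /arc_series /= ?subrr ?subr0.
have h4 : X ^+ 2 * A4 = A2 - 2.
  apply/funext => m; rewrite fpsX2M_coef fpsD_coef fpsN_coef fps_nat /fpsC.
  case: m => [|[|m]]; rewrite /A2 /A4 /= ?subr0//; [by field|by ring].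
have -> : A - 1 - 2 * X ^+ 2 = X ^+ 4 * A4.
  rewrite (_ : X ^+ 4 * A4 = X ^+ 2 * (X ^+ 2 * A4)); last by ring.
  by rewrite h4 mulrBr h2; ring.
rewrite -h2 -even_powE.
rewrite (_ : _ + _ = X ^+ 4 * (fpsC r * (even_pow - A) + fpsC k1 * A4 + fpsC k2 * A2 + fpsC k3 * A)); last by ring.
rewrite [LHS](_ : _ = X ^+ 4 * (2 * correction)); last by ring.
congr (X ^+ 4 * _); apply/funext => m.
rewrite fps_nat !fpsD_coef !fpsCM_coef fpsD_coef fpsN_coef /correction /A2 /A4 /arc_series.
by field.
Qed.

(** After multiplication by 32 t^4 both sides are polynomials in [A], the root and half of [c], and
    the claim is [correction_identity]. The factor is removed by injectivity. *)
Lemma correction_eq : correction =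
  c ^+ 2 * (X ^+ 2 * (correction - fpsC 2^-1 * theta c - c)) + c ^+ 3 * second_order_series.
Proof.
pose w := fpsC 2^-1 * c.
have h2 : 2 * fpsC 2^-1 = 1 :> fps.
  by rewrite fps_nat -fpsCM mulfV ?fpsC1// pnatr_eq0.
have cw : c = 2 * w by rewrite /w mulrA h2 mul1r.
have ws : w * (1 + rootS) = 1.
  by rewrite /w -mulrA sc_root2 mulrC h2.
pose z := 1 - rootS ^+ 2.
have zE : z = 4 * X ^+ 2 by rewrite /z root_sqr; ring.
have K := @correction_identity fps rootS A w (fpsC k) (fpsC s') (fpsC r) arc_root ws.
have C1 : fpsC k1 = fpsC k - 2 - fpsC r.
  by rewrite !fps_nat /k1; apply/funext => -[|m]; rewrite !(fpsD_coef, fpsN_coef) /fpsC /= ?subr0.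
have C2 : fpsC k2 = fpsC s' - 4 * fpsC k + 7 + 3 * fpsC r.
  by rewrite !fps_nat /k2 -!fpsCM; apply/funext => -[|m];
    rewrite !(fpsD_coef, fpsN_coef) /fpsC /= ?subr0 ?addr0.
have C3 : fpsC k3 = 2 * (fpsC k - fpsC s' - 1).
  rewrite !fps_nat /k3 -(fpsC1 F); apply/funext => m; rewrite fpsCM_coef.
  by rewrite !(fpsD_coef, fpsN_coef) /fpsC; case: ifP => _; rewrite ?subr0 ?mulr0.
have C4 : fpsC (1 + r) = 1 + fpsC r by rewrite fpsCD fpsC1.
move: K; cbv zeta; rewrite -C1 -C2 -C3 -/z => K.
have tc : theta c = 2 * w ^+ 2 * z * A.
  by rewrite theta_sc cw zE; ring.
have h : 32 * (X ^+ 4 * correction) = 32 * (X ^+ 4 * (c ^+ 2 * (X ^+ 2 * (correction - fpsC 2^-1 * theta c - c)) + c ^+ 3 * second_order_series)).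
  have S := correction_shift.
  rewrite [LHS](_ : _ = 16 * (2 * X ^+ 4 * correction)); last by ring.
  rewrite [RHS](_ : _ = 16 * (c ^+ 2 * X ^+ 2 * (2 * X ^+ 4 * correction)) +
     32 * X ^+ 4 * (- c ^+ 2 * X ^+ 2 * (fpsC 2^-1 * theta c + c) + c ^+ 3 * second_order_series)); last by ring.
  have hc : fpsC 2^-1 * theta c = w ^+ 2 * z * A.
    rewrite tc (_ : fpsC 2^-1 * _ = (2 * fpsC 2^-1) * (w ^+ 2 * z * A)); last by ring.
    by rewrite h2 mul1r.
  rewrite hc /second_order_series tc C4 cw S.
  have z2 : 16 * X ^+ 4 = z ^+ 2 by rewrite zE; ring.
  set N := (_ + fpsC k3 * _).
  have NE : 16 * N = fpsC r * z ^+ 2 * (A ^+ 2 - A) + fpsC k1 * (16 * (A - 1) - 8 * z) + fpsC k2 * (4 * z * (A - 1)) + fpsC k3 * (z ^+ 2 * A).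
    by rewrite -z2 zE /N; ring.
  move: K; rewrite -NE => K.
  apply/eqP; rewrite -subr_eq0; apply/eqP.
  rewrite [LHS](_ : _ = (16 * N * (1 - w ^+ 2 * z) + z ^+ 2 * (2 * w ^+ 2 * z) * (w ^+ 2 * z * A + 2 * w)) -
    z ^+ 2 * (4 * w ^+ 3 * z * fpsC s' + w ^+ 3 * z ^+ 2 *
    (4 * fpsC k1 * w ^+ 2 + (1 + fpsC r) * (2 * w ^+ 2 * z * A + 2 * w)))); last first.
    by move: N {NE K S} => N; rewrite zE; ring.
  by rewrite K subrr.
have {}h := @fps_nat_inj 31 _ _ h.
apply/fpsX2_inj/fpsX2_inj.
rewrite (_ : X ^+ 2 * (X ^+ 2 * correction) = X ^+ 4 * correction); last by ring.
by rewrite h; ring.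
Qed.

(** With N - e vertices but normalisation N, the k-th normalised trace is multiplied by (1 -
    e/N)^(k/2 + 1); the two terms linear in [e] are the first-order effect of this factor on c. *)
Definition correction_family (e : nat) : fps :=
  correction - fpsC e%:R * (fpsC 2^-1 * theta c) - fpsC e%:R * c.

Lemma correction_family_eq e : correction_family e = - (fpsC e%:R * c) +
  (c ^+ 2 * (X ^+ 2 * correction_family e.+1) + c ^+ 3 * second_order_series).
Proof.
have h2 : 2 * fpsC 2^-1 = 1 :> fps.
  by rewrite fps_nat -fpsCM mulfV ?fpsC1// pnatr_eq0.
have ht : fpsC 2^-1 * theta c = X ^+ 2 * c ^+ 2 * A.
  rewrite theta_sc (_ : fpsC 2^-1 * _ = (2 * fpsC 2^-1) * (X ^+ 2 * c ^+ 2 * A)); last by ring.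
  by rewrite h2 mul1r.
have e1 : X ^+ 2 * c ^+ 2 * A = c ^+ 2 * X ^+ 2 * (X ^+ 2 * c ^+ 2 * A + c).
  have x1 : X ^+ 2 * c ^+ 2 = c - 1 by rewrite [X in _ = X - 1]sc_eq; ring.
  have h : A * (c * (1 + rootS)) = A * 2 by rewrite sc_root2.
  have AE : A * (2 - c) = c.
    rewrite mulrBr -h (_ : A * (c * (1 + rootS)) - A * c = c * (A * rootS)); last by ring.
    by rewrite arc_root mulr1.
  rewrite (_ : c ^+ 2 * X ^+ 2 * _ = X ^+ 2 * c ^+ 2 * (X ^+ 2 * c ^+ 2 * A + c)); last by ring.
  by rewrite x1 -[X in _ = _ * (_ + X)]AE; ring.
rewrite /correction_family -(natr1 e) fpsCD fpsC1 ht {1}correction_eq.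
rewrite ht (mulrDl (fpsC e%:R) 1 (X ^+ 2 * c ^+ 2 * A)) mul1r.
rewrite {2}e1; ring.
Qed.

End moment_series.

(** * The mean trace of the full matrix *)

Section mean_bound.
Context d (T : measurableType d) (R : realType) (P : probability T R).
Local Notation C := R[i].
Local Notation Ec := (complex_expectation P).
Context (W : nat -> nat -> T -> C).
Context (entW : independent_centered_entries P W).
Context (hermW : forall i j w, W j i w = ((W i j w)^*)%C).
Context (sigma : R) (sigma_gt0 : 0 < sigma).
Context (varW : forall i j, i != j -> Ec (fun w => W i j w * W j i w) = (sigma ^+ 2)%:C%C).
Local Notation algT := (alg W all_edges).
Local Notation bdd := (bdd P W).
Local Notation rt := (@rt R).
Local Notation Ob := (Ob P W).
Local Notation X := (scaled W sigma).
Local Notation V := (reduced W sigma).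
Local Notation wk := (wk W sigma).
Local Notation ent := (ent W sigma).
Local Notation fluct := (fluct W sigma).
Local Notation fluct_incr := (fluct_incr W sigma).
Context (r : nat) (alpha : R).
Context (r_sqr : (r * r)%N = r).
Context (sqW : forall i j, i != j -> Ec (fun w => W i j w * W i j w) = r%:R * (sigma ^+ 2)%:C%C).
Context (fourthW : forall i j, i != j -> Ec (fun w => (W i j w * W j i w) ^+ 2) = alpha%:C%C).
Context (symW : r = 1%N -> forall i j w, W j i w = W i j w).
Local Notation tau := (tau W sigma).
Local Notation kurt := (kurt sigma alpha).
Context (s2 : R).
Context (diagW : forall i, Ec (fun w => W i i w * W i i w) = s2%:C%C).
Local Notation c := (sc_series C).
Local Notation diagvar := (diagvar sigma s2).

Lemma antidiagonal_inner (f : nat -> nat -> C) m :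
  (forall q, f 0%N q = 0) -> (forall p, f p 0%N = 0) ->
  (forall q, f 1%N q.+2 = 0) -> (forall p, f p.+2 1%N = 0) ->
  \sum_(i < m.+4.+1) f i (m.+4 - i)%N = \sum_(i < m.+1) f i.+2 (m - i).+2.
Proof.
move=> f0 g0 f1 g1.
rewrite -(big_mkord xpredT (fun i => f i (m.+4 - i)%N)) big_nat_recl// big_nat_recl//.
rewrite big_nat_recr// big_nat_recr//= f0 subSS subSn// f1 (_ : (m.+4 - m.+3 = 1)%N); last by lia.
rewrite g1 (_ : (m.+4 - m.+4 = 0)%N); last by lia.
rewrite g0 !addr0 !add0r big_mkord; apply: eq_bigr => i _.
by rewrite (_ : (m.+4 - i.+2 = (m - i).+2)%N)//; have := ltn_ord i; lia.
Qed.

(** Apart from the diagonal variance at t^2, only pairs of indices at least 2 contribute. Products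
    of coefficients of [c] sum to [c ^+ 2], and the m + 1 equal terms [c m] sum to a coefficient of
    [theta c + c]. *)
Lemma second_orderE : second_order sigma r alpha s2 c = second_order_series kurt diagvar r%:R.
Proof.
apply/funext => k; rewrite /second_order_series fpsD_coef fpsCM_coef.
rewrite (_ : fpsX C ^+ 4 = fpsX C ^+ 2 * fpsX C ^+ 2); last by rewrite -exprD.
rewrite -mulrA fpsX2M_coef /second_order.
have X2E j : (fpsX C ^+ 2) j = (j == 2%N)%:R.
  by rewrite -[fpsX C ^+ 2]mulr1 fpsX2M_coef; case: j => [|[|[|j]]] //; rewrite fps1_coef.
rewrite X2E; case: k => [|[|[|[|m]]]].
- by rewrite big_ord1 /excess_cov /= mulr0 addr0.
- by rewrite big_ord_recl big_ord1 /excess_cov /= mulr0 !addr0.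
- rewrite !big_ord_recl big_ord0 /bump /excess_cov /= fpsX2M_coef.
  by rewrite !addr0 add0r mulr1.
- by rewrite !big_ord_recl big_ord0 /bump /excess_cov /= fpsX2M_coef !addr0 mulr0.
rewrite mulr0 add0r fpsX2M_coef fpsD_coef !fpsCM_coef fpsD_coef /theta.
rewrite antidiagonal_inner => [|q|[|[|p]]|q|p]//.
rewrite expr2 fpsM_coef mulr_sumr.
have -> : (1 + r%:R) * (m%:R * c m + c m) = \sum_(i < m.+1) (1 + r%:R) * c m :> C.
  by rewrite sumr_const card_ord -[RHS]mulr_natr -addn1 natrD; ring.
rewrite -big_split/=; apply: eq_bigr => i _.
by rewrite /excess_cov subnKC// -ltnS.
Qed.

(** The case of no missing vertex, with the solution [correction_family] of the recursion. *)
Lemma mean_tau_bound k : exists K : R, forall n, (0 < n)%N ->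
  nsq (Ec (tau n (iota 0 n) k) - c k - n%:R^-1 * correction kurt diagvar r%:R k) * n%:R ^+ 3 <= K.
Proof.
have H e := correction_family_eq kurt diagvar (r%:R : C) e.
have H' e : correction_family kurt diagvar (r%:R : C) e = - (fpsC e%:R * c) +
   (c ^+ 2 * ((fpsX C) ^+ 2 * correction_family kurt diagvar (r%:R : C) e.+1) + c ^+ 3 * second_order sigma r alpha s2 c).
  by rewrite second_orderE.
have [_ M] := Ob_mean entW hermW sigma_gt0 varW r_sqr sqW fourthW symW diagW (sc_eq C) H' k 0.
have [K HK] := M 1; exists K => n n0.
have Dn : exact_near 0 (Idx n (iota 0 n) 0 0 [::]).
  split; last by rewrite /= size_iota addn0.
  by split => //=; rewrite ?iota_uniq ?size_iota.
have := HK _ Dn; rewrite /moment Rint_cst expr1 nsqM nsqX nsq_rt mulrC /=.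
have -> : correction_family kurt diagvar r%:R 0 k = correction kurt diagvar r%:R k :> C.
  rewrite /correction_family.
  have -> : fpsC (0%:R : C) = 0 by apply/funext => -[|m].
  by rewrite !mul0r !subr0.
by [].
Qed.

End mean_bound.

(** * Moments of the arcsine law *)

Section arcsine_moments.
Context (R : realType).
Local Notation mu := (@lebesgue_measure R).
Local Notation pdf := (@arcsine_pdf R).

(* The exhaustion of ]-2, 2[ by the intervals [-a n, a n] is chosen so that asin (a n / 2) is
   explicit: the library has no continuity of asin at the end points. *)
Let t (n : nat) : R := n.+2%:R^-1.
Let a (n : nat) : R := 2 * cos (t n).

Let t_itv n : 0 < t n < pi / 2.
Proof.
have t1 : t n <= 2^-1 by rewrite /t lef_pV2 ?posrE// ler_nat.
have := @pihalf_ge1 R; have t0 : 0 < t n by rewrite /t invr_gt0.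
by move: t1 t0; set x := t n; lra.
Qed.

Let cos_t_gt0 n : 0 < cos (t n).
Proof. by apply: cos_gt0_pihalf; have := t_itv n; lra. Qed.

Let cos_t_lt1 n : cos (t n) < 1.
Proof.
have := cos2Dsin2 (t n); have := sin_gt0_pihalf (t_itv n); have := cos_t_gt0 n.
by set x := cos _; set y := sin _; nra.
Qed.

Let a_itv n : 0 < a n < 2.
Proof. by have := cos_t_gt0 n; have := cos_t_lt1 n; rewrite /a; lra. Qed.

Let t_cvg0 : t n @[n --> \oo] --> 0.
Proof. by have := @cvg_harmonic R; rewrite -(cvg_shiftS (@harmonic R)). Qed.

Let a_cvg2 : a n @[n --> \oo] --> (2 : R).
Proof.
rewrite -[X in _ --> X]mulr1 -[X in _ * X](@cos0 R); apply: cvgMr.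
exact: (@cvg_comp _ _ _ t (@cos R) _ _ _ t_cvg0 (@continuous_cos R 0)).
Qed.

Let F n : set R := `[(- a n)%R, a n]%classic.

Let sub_oo n (x : R) : x \in `[(- a n), a n] -> x \in `](-2), 2[.
Proof. by have := a_itv n; rewrite !in_itv/= => /andP[? ?] /andP[? ?]; lra. Qed.

Let near_F (x : R) : x \in `](-2), 2[ -> \forall n \near \oo, x \in `[(- a n), a n].
Proof.
rewrite in_itv/= => /andP[x1 x2].
have [l1 l2] : - x < 2 /\ x < 2 by lra.
have h1 : \forall n \near \oo, - x < a n by apply: (@cvgr_gt _ _ _ _ a 2).
have h2 : \forall n \near \oo, x < a n by apply: (@cvgr_gt _ _ _ _ a 2).
near=> n; rewrite in_itv/=.
have : - x < a n by near: n.
have : x < a n by near: n.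
by move: (a n) => y ? ?; apply/andP; split; lra.
Unshelve. all: by end_near. Qed.

(** The fundamental theorem of calculus on the compact intervals [F n], followed by dominated
    convergence. Behaviour at the end points enters only through the limits of [G] along [a n]. *)
Lemma FTC_open_itv (f g G : R -> R) (u v : R) :
  mu.-integrable setT (EFin \o f) -> (forall x : R, x \notin `](-2), 2[ -> f x = 0) ->
  (forall x : R, x \in `](-2), 2[ -> f x = g x) ->
  (forall x : R, x \in `](-2), 2[ -> {for x, continuous g}) ->
  (forall x : R, x \in `](-2), 2[ -> is_derive x 1 G (g x)) ->
  G (a n) @[n --> \oo] --> u -> G (- a n) @[n --> \oo] --> v ->
  (\int[mu]_x (f x)%:E = (u - v)%:E)%E.
Proof.
move=> fI f0 fg cg dG Gu Gv.
have mf : measurable_fun setT (EFin \o f) by exact: measurable_int fI.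
have cG x : x \in `](-2), 2[ -> {for x, continuous G}.
  by move=> xI; apply: differentiable_continuous; apply/derivable1_diffP; case: (dG _ xI).
have E n : (\int[mu]_x ((EFin \o f) \_ (F n)) x = (G (a n) - G (- a n))%:E)%E.
  rewrite -integral_mkcond.
  rewrite (eq_integral (fun x : measurableTypeR R => (g x)%:E)); last first.
    by move=> x; rewrite mem_setE => /sub_oo /fg/= ->.
  have an := a_itv n; have a0 : - a n < a n by lra.
  rewrite (@continuous_FTC2 _ g G)//.
  - by apply: continuous_in_subspaceT => x; rewrite mem_setE => /sub_oo; exact: cg.
  - split.
    + by move=> x /subset_itv_oo_cc /sub_oo xI; case: (dG _ xI).
    + by apply: cvg_at_right_filter; apply: cG; rewrite in_itv/=; lra.
    + by apply: cvg_at_left_filter; apply: cG; rewrite in_itv/=; lra.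
  - by move=> x /subset_itv_oo_cc /sub_oo xI; rewrite derive1E; have D := dG _ xI; rewrite derive_val.
have mF n : measurable (F n) by exact: measurable_itv.
have h1 : {ae mu, forall x : measurableTypeR R, setT x -> ((EFin \o f) \_ (F n)) x @[n --> \oo] --> (EFin \o f) x}.
  apply: aeW => x _; have [xI|/f0 xI] := boolP (x \in `](-2), 2[).
    apply: cvg_near_cst; near=> n; rewrite patchE mem_set//.
    by near: n; exact: near_F.
  apply: cvg_near_cst; apply: nearW => n; rewrite patchE /=.
  by case: ifP => //; rewrite xI.
have h2 : {ae mu, forall (x : measurableTypeR R) n, setT x -> (`|((EFin \o f) \_ (F n)) x| <= `|(f x)%:E|)%E}.
  apply: aeW => x n _; rewrite patchE /=.
  by case: ifP => // _; rewrite abse0.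
have [_ _ C] := @dominated_convergence _ (measurableTypeR R) R mu setT measurableT
  (fun n => (EFin \o f) \_ (F n)) (EFin \o f) (fun x => `|(f x)%:E|)%E
  (fun n => (measurable_restrictT _ (mF n)).1 (measurable_funTS mf)) mf h1 (integrable_abse fI) h2.
have C' : (\int[mu]_x ((EFin \o f) \_ (F n)) x @[n --> \oo] --> (u - v)%:E)%E.
  under eq_fun do rewrite E.
  by apply: cvg_EFin; [exact: nearW|apply: cvgB].
exact: (cvg_unique _ C C').
Unshelve. all: by end_near. Qed.

Lemma integrable_arcsine_mul (h : R -> R) (M : R) : measurable_fun setT h ->
  (forall x : R, x \in `[(-2), 2] -> `|h x| <= M) ->
  mu.-integrable setT (fun x : R => (h x * pdf x)%:E).
Proof.
move=> mh hM.
have M0 : 0 <= M by apply: (le_trans (normr_ge0 (h 0))); apply: hM; rewrite in_itv/=; lra.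
apply: (@le_integrable _ (measurableTypeR R) _ _ _ _ _
  (fun x : measurableTypeR R => M%:E * (pdf x)%:E)%E) => //.
- by apply/measurable_EFinP; apply: measurable_funM => //; exact: measurable_arcsine_pdf.
- move=> x _; rewrite -EFinM !abse_EFin lee_fin !normrM (ger0_norm M0).
  rewrite /arcsine_pdf; case: ifPn => [xI|_]; last by rewrite normr0 !mulr0.
  by rewrite ler_wpM2r// hM.
- by apply: integrableZl => //; exact: integrable_arcsine_pdf.
Qed.

Let norm_le2 (x : R) : x \in `[(-2), 2] -> `|x| <= 2.
Proof. by rewrite in_itv/= ler_norml. Qed.

Lemma integrable_arcsine_exprn k : mu.-integrable setT (fun x : R => (x ^+ k * pdf x)%:E).
Proof.
apply: (integrable_arcsine_mul (M := 2 ^+ k)); first exact: exprn_measurable.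
by move=> x /norm_le2 x2; rewrite normrX lerXn2r ?nnegrE.
Qed.

Let rad (x : R) : R := Num.sqrt (4 - x ^+ 2).

Let rad_gt0 (x : R) : x \in `](-2), 2[ -> 0 < rad x.
Proof. by rewrite in_itv/= => /andP[x1 x2]; rewrite sqrtr_gt0; nra. Qed.

Let sqr_rad (x : R) : x \in `](-2), 2[ -> rad x ^+ 2 = 4 - x ^+ 2.
Proof. by rewrite in_itv/= => /andP[x1 x2]; rewrite sqr_sqrtr//; nra. Qed.

Let rad_continuous : continuous rad.
Proof.
move=> x; apply: (@continuous_comp _ _ _ (fun x : R => 4 - x ^+ 2) Num.sqrt).
  by apply: continuousB; [exact: cst_continuous|exact: exprn_continuous].
exact: sqrt_continuous.
Qed.

Let arcsine_continuous (x : R) : x \in `](-2), 2[ ->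
  {for x, continuous (fun x : R => (pi * rad x)^-1)}.
Proof.
move=> xI; apply: continuousV; first by rewrite mulf_neq0// gt_eqF// ?pi_gt0// rad_gt0.
by apply: continuousM; [exact: cst_continuous|exact: rad_continuous].
Qed.

Let is_derive_rad (x : R) : x \in `](-2), 2[ -> is_derive x 1 rad (- x / rad x).
Proof.
move=> xI; have := xI; rewrite in_itv/= => /andP[x1 x2].
have x4 : 0 < 4 - x ^+ 2 by nra.
have D1 := is_derive1_sqrt x4.
have D2 : is_derive x 1 (fun y : R => 4 - y ^+ 2) (- (2 * x)).
  by apply: is_derive_eq; rewrite /GRing.scale/=; ring.
have D3 := @is_derive1_comp R (@Num.sqrt R) (fun y : R => 4 - y ^+ 2) x _ _ D1 D2.
rewrite -(_ : (2 * rad x)^-1 * - (2 * x) = - x / rad x); first exact: D3.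
by field; exact/lt0r_neq0/rad_gt0.
Qed.

Let is_derive_arcsine (x : R) : x \in `](-2), 2[ ->
  is_derive x 1 (fun y => asin (y / 2) / pi) ((pi * rad x)^-1).
Proof.
move=> xI; have s0 := rad_gt0 xI.
have x1 : -1 < x / 2 < 1 by move: xI; rewrite in_itv/= => /andP[? ?]; lra.
have D1 := is_derive1_asin x1.
have D2 : is_derive x 1 (fun y : R => y / 2) 2^-1.
  rewrite (_ : (fun y => y / 2) = 2^-1 \*: (id : R -> R)); last first.
    by apply/funext => y /=; rewrite mulrC.
  by apply: is_derive_eq; rewrite /GRing.scale/= mulr1.
have D3 := @is_derive1_comp R (@asin R) (fun y : R => y / 2) x _ _ D1 D2.
rewrite (_ : (fun y => _) = pi^-1 \*: (@asin R \o (fun y : R => y / 2))); last first.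
  by apply/funext => y /=; rewrite mulrC.
apply: is_derive_eq; rewrite /GRing.scale/= invfM; congr (_ * _).
rewrite -invfM; congr (_^-1).
rewrite -{2}(@ger0_norm _ 2)// -sqrtr_sqr -sqrtrM; last by nra.
by rewrite /rad; congr Num.sqrt; field.
Qed.

Let asin_a n : asin (a n / 2) = pi / 2 - t n.
Proof.
rewrite /a mulrAC divff// mul1r -cosN -sinDpihalf sinK//; first by rewrite addrC.
by rewrite in_itv/=; have := t_itv n; have := @pi_gt0 R; lra.
Qed.

Let asin_Na n : asin (- (a n / 2)) = - (pi / 2 - t n).
Proof.
rewrite /a mulrAC divff// mul1r -cosN -sinDpihalf -sinN sinK//; first by rewrite addrC.
by rewrite in_itv/=; have := t_itv n; have := @pi_gt0 R; lra.
Qed.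

Let asin_lim : (pi / 2 - 0) / pi = 2^-1 :> R.
Proof. by rewrite subr0 mulrAC divff ?mul1r// gt_eqF// pi_gt0. Qed.

Let asin_cvg : (pi / 2 - t n) / pi @[n --> \oo] --> (pi / 2 - 0 : R) / pi.
Proof. by apply: cvgMl; apply: cvgB; [exact: cvg_cst|exact: t_cvg0]. Qed.

Lemma integral_arcsine_pdf : (\int[mu]_x (pdf x)%:E = 1)%E.
Proof.
rewrite (@FTC_open_itv pdf (fun x => (pi * rad x)^-1) (fun y => asin (y / 2) / pi) 2^-1 (- 2^-1) _ _ _ _ is_derive_arcsine).
- by congr (_%:E); field.
- exact: integrable_arcsine_pdf.
- by move=> x; exact: arcsine_pdf_out.
- by move=> x; exact: arcsine_pdfE.
- by move=> x; exact: arcsine_continuous.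
- under eq_fun do rewrite asin_a.
  by have := asin_cvg; rewrite asin_lim.
- under eq_fun do rewrite mulNr asin_Na mulNr.
  by apply: cvgN; have := asin_cvg; rewrite asin_lim.
Qed.

Let is_derive_pow_rad k (x : R) : x \in `](-2), 2[ ->
  is_derive x 1 (fun y => y ^+ k.+1 * rad y / pi)
    ((4 * k.+1%:R * x ^+ k - k.+2%:R * x ^+ k.+2) * (pi * rad x)^-1).
Proof.
move=> xI; have D1 := is_derive_rad xI; have s0 := rad_gt0 xI.
have D2 : is_derive x 1 (fun y : R => y ^+ k.+1) (k.+1%:R * x ^+ k).
  have := @is_deriveX R R id k.+1 x 1 1 (is_derive_id x 1).
  by rewrite /GRing.scale/= mulr1 exprfctE.
rewrite (_ : (fun y => _) = pi^-1 \*: ((fun y : R => y ^+ k.+1) * rad)); last first.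
  by apply/funext => y /=; rewrite mulrC.
apply: is_derive_eq; rewrite /GRing.scale/=.
rewrite (_ : (4 * k.+1%:R * x ^+ k - k.+2%:R * x ^+ k.+2) = k.+1%:R * x ^+ k * rad x ^+ 2 - x ^+ k.+2).
  rewrite !exprS; move: (@pi R) (pi_gt0 R) => p p0; field; rewrite !lt0r_neq0//.
by rewrite sqr_rad// (_ : k.+2%:R = k.+1%:R + 1) ?natr1// !exprS; ring.
Qed.

Let rad_2 : rad 2 = 0. Proof. by rewrite /rad (_ : 4 - _ = 0) ?sqrtr0//; ring. Qed.

Let rad_N2 : rad (- 2) = 0. Proof. by rewrite /rad (_ : 4 - _ = 0) ?sqrtr0//; ring. Qed.

Let pow_rad_cvg k (b : nat -> R) (y : R) : b n @[n --> \oo] --> y -> rad y = 0 ->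
  b n ^+ k * rad (b n) / pi @[n --> \oo] --> (0 : R).
Proof.
move=> by_ ry; rewrite -(_ : y ^+ k * rad y / pi = 0); last by rewrite ry mulr0 mul0r.
have C : {for y, continuous (fun z : R => z ^+ k * rad z / pi)}.
  apply: continuousM; last exact: cst_continuous.
  by apply: continuousM; [exact: exprn_continuous|exact: rad_continuous].
exact: (@cvg_comp _ _ _ b (fun z : R => z ^+ k * rad z / pi) _ _ _ by_ C).
Qed.

(** The integrand is the derivative of x^(k+1) sqrt(4 - x^2) / pi, which tends to 0 at both end
    points. *)
Lemma arcsine_moment_rec k :
  (\int[mu]_x (((4 * k.+1%:R * x ^+ k - k.+2%:R * x ^+ k.+2) * pdf x)%:E) = 0)%E.
Proof.
rewrite (@FTC_open_itv _ (fun x => (4 * k.+1%:R * x ^+ k - k.+2%:R * x ^+ k.+2) * (pi * rad x)^-1)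
  (fun y => y ^+ k.+1 * rad y / pi) 0 0 _ _ _ _ (@is_derive_pow_rad k)) ?subrr//.
- rewrite (_ : _ \o _ = (fun x => (4 * k.+1%:R)%:E * (x ^+ k * pdf x)%:E -
      k.+2%:R%:E * (x ^+ k.+2 * pdf x)%:E)%E).
    by apply: integrableB => //; apply: integrableZl => //; exact: integrable_arcsine_exprn.
  by apply/funext => x /=; rewrite -!EFinM -EFinB; congr _%:E; ring.
- by move=> x xI; rewrite arcsine_pdf_out// mulr0.
- by move=> x xI; rewrite arcsine_pdfE.
- move=> x xI; apply: continuousM; last exact: arcsine_continuous.
  by apply: continuousB; apply: continuousM;
    [exact: cst_continuous|exact: exprn_continuous|exact: cst_continuous|exact: exprn_continuous].
- exact: pow_rad_cvg a_cvg2 rad_2.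
- by apply: pow_rad_cvg rad_N2; apply: cvgN.
Qed.

Let is_derive_rad_pi (x : R) : x \in `](-2), 2[ ->
  is_derive x 1 (fun y => - (rad y / pi)) (x * (pi * rad x)^-1).
Proof.
move=> xI; have D1 := is_derive_rad xI; have s0 := rad_gt0 xI.
rewrite (_ : (fun y => _) = (- pi^-1) \*: rad); last first.
  by apply/funext => y /=; rewrite /GRing.scale/= mulrC mulNr.
apply: is_derive_eq; rewrite /GRing.scale/=.
by move: (@pi R) (pi_gt0 R) => p p0; field; rewrite !lt0r_neq0.
Qed.

Lemma arcsine_moment1 : (\int[mu]_x (x * pdf x)%:E = 0)%E.
Proof.
rewrite (@FTC_open_itv _ (fun x => x * (pi * rad x)^-1) (fun y => - (rad y / pi)) 0 0
  _ _ _ _ is_derive_rad_pi) ?subrr//.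
- by have := integrable_arcsine_exprn 1; under eq_fun do rewrite expr1.
- by move=> x xI; rewrite arcsine_pdf_out// mulr0.
- by move=> x xI; rewrite arcsine_pdfE.
- by move=> x xI; apply: continuousM => //; exact: arcsine_continuous.
- rewrite -oppr0; apply: cvgN.
  by have := @pow_rad_cvg 0 _ _ a_cvg2 rad_2; under eq_fun do rewrite expr0 mul1r.
- rewrite -oppr0; apply: cvgN.
  have aN : - a n @[n --> \oo] --> (- 2 : R) by apply: cvgN; exact: a_cvg2.
  by have := @pow_rad_cvg 0 (fun n => - a n) _ aN rad_N2; under eq_fun do rewrite expr0 mul1r.
Qed.

Lemma arcsine_moment k : (\int[mu]_x (x ^+ k * pdf x)%:E = (arc R k)%:E)%E.
Proof.
elim/ltn_ind: k => -[_|[_|k IH]].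
- by under eq_integral do rewrite expr0 mul1r; exact: integral_arcsine_pdf.
- by under eq_integral do rewrite expr1; exact: arcsine_moment1.
have := arcsine_moment_rec k.
under eq_integral.
  move=> x _; rewrite mulrBl -(mulrA (4 * _)) -(mulrA k.+2%:R) EFinB (EFinM (4 * _)) (EFinM k.+2%:R); over.
have I := integrable_arcsine_exprn.
have J : (\int[mu]_x (x ^+ k.+2 * pdf x)%:E)%E \is a fin_num by exact: integrable_fin_num (I _).
rewrite integralB//; [|exact: integrableZl (I _)|exact: integrableZl (I _)].
rewrite !integralZl//; try exact: I.
move=> E; have {}E : ((4 * k.+1%:R)%:E * (\int[mu]_x (x ^+ k * pdf x)%:E) -
  k.+2%:R%:E * (\int[mu]_x (x ^+ k.+2 * pdf x)%:E) = 0)%E by exact: E.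
move: E; rewrite IH// -(fineK J) -!EFinM -EFinB => -[] /eqP; rewrite subr_eq0 => /eqP E.
by congr _%:E; apply: (@mulfI _ k.+2%:R); rewrite ?pnatr_eq0// -E /=; field.
Qed.

End arcsine_moments.

(** * Integrals against densities, atoms and signed measures *)

Section density_measure.
Context d (T : measurableType d) (R : realType) (mu : {sigma_finite_measure set T -> \bar R}).
Context (f : T -> R) (fI : mu.-integrable setT (EFin \o f)) (f0 : forall x, 0 <= f x).
Local Open Scope ereal_scope.

Let density_ge0 A : 0 <= induced_charge fI A.
Proof. by apply: integral_ge0 => x _; rewrite lee_fin f0. Qed.

Definition density : set T -> \bar R := measure_of_charge _ density_ge0.

HB.instance Definition _ := Measure.on density.

Let finite_density : fin_num_fun density.
Proof. by move=> U mU; rewrite /density/= /measure_of_charge fin_num_measure. Qed.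

HB.instance Definition _ := @Measure_isFinite.Build _ _ _ density finite_density.

Lemma densityE A : density A = \int[mu]_(x in A) (f x)%:E.
Proof. by []. Qed.

Let density_dominated : density `<< mu.
Proof.
apply/null_content_dominatesP => A mA muA0; rewrite densityE.
by apply: null_set_integral => //; apply: measurable_funTS; exact: measurable_int fI.
Qed.

(** The Radon-Nikodym derivative of [density] agrees with [f] almost everywhere, having the same
    integrals over measurable sets. *)
Lemma ge0_integral_density (g : T -> R) : (forall x, (0 <= g x)%R) -> measurable_fun setT g ->
  \int[density]_x (g x)%:E = \int[mu]_x (g x * f x)%:E.
Proof.
move=> g0 mg; have mg' : measurable_fun setT (EFin \o g) by exact/measurable_EFinP.
rewrite -(@Radon_Nikodym_SigmaFinite.change_of_variables _ _ _ density mu density_dominated (EFin \o g))//.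
have D := @Radon_Nikodym_SigmaFinite.f_integrable _ _ _ density mu density_dominated.
have mf : measurable_fun setT (EFin \o f) by exact: measurable_int fI.
apply: ae_eq_integral => //.
- by apply: emeasurable_funM => //; exact: measurable_int D.
- under eq_fun do rewrite EFinM; exact: emeasurable_funM.
have H : ae_eq mu setT (Radon_Nikodym_SigmaFinite.f density mu) (EFin \o f).
  apply: integral_ae_eq => // E _ mE.
  by rewrite -Radon_Nikodym_SigmaFinite.f_integral.
by apply: filterS H => x /= H xT; rewrite EFinM H.
Qed.

Lemma integrable_density (g : T -> R) : measurable_fun setT g ->
  mu.-integrable setT (fun x => (g x * f x)%:E) -> density.-integrable setT (EFin \o g).
Proof.
move=> mg /integrableP[_ gfI]; apply/integrableP; split; first exact/measurable_EFinP.
rewrite (ge0_integral_density (g := fun x => `|g x|%R))//; last exact: measurableT_comp.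
by move: gfI; under eq_integral do rewrite /= normrM (ger0_norm (f0 _)).
Qed.

Lemma integral_density (g : T -> R) : measurable_fun setT g ->
  mu.-integrable setT (fun x => (g x * f x)%:E) ->
  \int[density]_x (g x)%:E = \int[mu]_x (g x * f x)%:E.
Proof.
move=> mg gfI; rewrite integralE [RHS]integralE.
have mp : measurable_fun setT (fun x => Num.max (g x) 0%R) by exact: measurable_funrpos.
have mn : measurable_fun setT (fun x => Num.max (- g x)%R 0%R) by exact: measurable_funrneg.
congr (_ - _).
- transitivity (\int[density]_x (Num.max (g x) 0%R)%:E).
    by apply: eq_integral => x _; rewrite funeposE EFin_max.
  rewrite ge0_integral_density// => [|x]; last by rewrite le_max lexx orbT.
  apply: eq_integral => x _; rewrite funeposE -EFin_max; congr _%:E.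
  by rewrite maxr_pMl// mul0r.
- transitivity (\int[density]_x (Num.max (- g x)%R 0%R)%:E).
    by apply: eq_integral => x _; rewrite funenegE EFin_max.
  rewrite ge0_integral_density// => [|x]; last by rewrite le_max lexx orbT.
  apply: eq_integral => x _; rewrite funenegE -EFinN -EFin_max; congr _%:E.
  by rewrite maxr_pMl// mul0r mulNr.
Qed.

End density_measure.

Section dirac_sum.
Context d (T : measurableType d) (R : realType).
Local Open Scope ereal_scope.

(** Covers both the spectral measure and the atoms of nu. *)
Definition dirac_sum (c : {nonneg R}) (a : nat -> T) (n : nat) : {measure set T -> \bar R} :=
  mscale c (msum (fun k => \d_(a k)) n).

Lemma ge0_integral_dirac_sum c a n (g : T -> R) : (forall x, (0 <= g x)%R) -> measurable_fun setT g ->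
  \int[dirac_sum c a n]_x (g x)%:E = (c%:num * \sum_(k < n) g (a k))%:E.
Proof.
move=> g0 mg; have mg' : measurable_fun setT (EFin \o g) by exact/measurable_EFinP.
rewrite ge0_integral_mscale//; last by move=> x _; rewrite lee_fin.
rewrite ge0_integral_measure_sum//; last by move=> x _; rewrite lee_fin.
rewrite EFinM -sumEFin; congr (_ * _); apply: eq_bigr => i _.
by rewrite integral_dirac// diracT mul1e.
Qed.

Lemma integrable_dirac_sum c a n (g : T -> R) : measurable_fun setT g ->
  (dirac_sum c a n).-integrable setT (EFin \o g).
Proof.
move=> mg; apply/integrableP; split; first exact/measurable_EFinP.
by rewrite (ge0_integral_dirac_sum c a n (g := fun x => `|g x|%R)) ?ltry//; exact: measurableT_comp.
Qed.

Lemma integral_dirac_sum c a n (g : T -> R) : measurable_fun setT g ->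
  \int[dirac_sum c a n]_x (g x)%:E = (c%:num * \sum_(k < n) g (a k))%:E.
Proof.
move=> mg; rewrite integralE.
have mp : measurable_fun setT (fun x => Num.max (g x) 0%R) by exact: measurable_funrpos.
have mn : measurable_fun setT (fun x => Num.max (- g x)%R 0%R) by exact: measurable_funrneg.
transitivity (\int[dirac_sum c a n]_x (Num.max (g x) 0%R)%:E - \int[dirac_sum c a n]_x (Num.max (- g x)%R 0%R)%:E).
  by congr (_ - _); apply: eq_integral => x _; rewrite ?funeposE ?funenegE EFin_max.
rewrite !ge0_integral_dirac_sum//; try by move=> x; rewrite le_max lexx orbT.
rewrite -EFinB -mulrBr -sumrB; congr (_ * _)%:E; apply: eq_bigr => i _.
by rewrite /Num.max; do 2! case: ifP => /=; lra.
Qed.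

End dirac_sum.

Section charge_integral_sub.
Context d (T : measurableType d) (R : realType) (nu : {charge set T -> \bar R}).
Context (m1 m2 : {measure set T -> \bar R}).
Local Open Scope ereal_scope.
Context (fin1 : fin_num_fun m1) (fin2 : fin_num_fun m2).
Context (nuE : forall A, measurable A -> nu A = m1 A - m2 A).

(** On the positive Hahn set the charge is [m1] minus a non-negative quantity. *)
Let jordan_pos_le P N (PN : hahn_decomposition nu P N) A : measurable A -> jordan_pos PN A <= m1 A.
Proof.
move=> mA; have [[mP _] _ _ _] := PN; have mAP := measurableI _ _ mA mP.
rewrite jordan_posE cjordan_posE /crestr0 mem_set// /crestr nuE//.
rewrite (@le_trans _ _ (m1 (A `&` P)))//.
  by rewrite -[leRHS]sube0 leeB.
by rewrite le_measure// inE.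
Qed.

Let jordan_neg_le P N (PN : hahn_decomposition nu P N) A : measurable A -> jordan_neg PN A <= m2 A.
Proof.
move=> mA; have [_ [mN _] _ _] := PN; have mAN := measurableI _ _ mA mN.
rewrite jordan_negE cjordan_negE /crestr0 mem_set// /crestr nuE//.
rewrite fin_num_oppeB ?fin2// addeC (@le_trans _ _ (m2 (A `&` N)))//.
  by rewrite -[leRHS]sube0 leeB.
by rewrite le_measure// inE.
Qed.

(** The Jordan parts p and q satisfy p + m2 = m1 + q, and being dominated by [m1] and [m2] they
    integrate [f]. Thus any decomposition into finite measures computes the integral, and the Hahn
    sets need not be identified. *)
Lemma charge_integral_sub (f : T -> R) :
  m1.-integrable setT (EFin \o f) -> m2.-integrable setT (EFin \o f) ->
  charge_integral nu f = \int[m1]_x (f x)%:E - \int[m2]_x (f x)%:E.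
Proof.
move=> I1 I2; rewrite /charge_integral; cbv zeta; set PN := (X in jordan_pos X).
set p := jordan_pos PN; set q := jordan_neg PN.
have mf : measurable_fun setT (EFin \o f) := measurable_int _ I1.
have dom (m m' : {measure set T -> \bar R}) : (forall A, measurable A -> m A <= m' A) ->
    m'.-integrable setT (EFin \o f) -> m.-integrable setT (EFin \o f).
  move=> mm' /integrableP[_ I]; apply/integrableP; split => //; apply: le_lt_trans I.
  by apply: ge0_le_measure_integral => //; exact: measurableT_comp.
have Ip : p.-integrable setT (EFin \o f) by apply: dom I1 => A; exact: jordan_pos_le.
have Iq : q.-integrable setT (EFin \o f) by apply: dom I2 => A; exact: jordan_neg_le.
have E : \int[p]_x (f x)%:E + \int[m2]_x (f x)%:E = \int[m1]_x (f x)%:E + \int[q]_x (f x)%:E.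
  rewrite -!integral_measure_add//; apply: eq_measure_integral => A mA _.
  transitivity (p A + m2 A); first exact: measure_addE.
  transitivity (m1 A + q A); last by rewrite -measure_addE.
  have := jordan_decomp PN mA.
  rewrite nuE// /cadd/= cscaleN1 /=.
  have := fin_num_measure p _ mA; have := fin_num_measure q _ mA.
  have := fin1 mA; have := fin2 mA; rewrite -/p -/q.
  case: (m1 A) => [a| |]//; case: (m2 A) => [b| |]//.
  case: (q A) => [x| |]//; case: (p A) => [y| |]//= _ _ _ _.
  by rewrite -!EFinB -!EFinD => -[] H; congr _%:E; lra.
have := integrable_fin_num measurableT Ip; have := integrable_fin_num measurableT Iq.
have := integrable_fin_num measurableT I1; have := integrable_fin_num measurableT I2.
move: E; rewrite /=.
move: (\int[m1]_x _) (\int[m2]_x _) (\int[p]_x _) (\int[q]_x _) => [a| |] [b| |] [x| |] [y| |]//.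
by rewrite -!EFinD => -[] H _ _ _ _; congr _%:E; lra.
Qed.

End charge_integral_sub.


(** * Moments of the semicircle law and of nu *)

Section limiting_moments.
Context (R : realType).
Local Notation mu := (@lebesgue_measure R).
Local Notation pdf := (@arcsine_pdf R).

(** One factor of the root cancels; at 2 and -2 both sides are 0, the inverse of 0 being 0. *)
Lemma semicircle_pdfE (x : R) : semicircle_pdf x = (2 - x ^+ 2 / 2) * pdf x.
Proof.
have [xI|xI] := boolP (x \in `](-2), 2[); last first.
  rewrite arcsine_pdf_out// mulr0 /semicircle_pdf; case: ifPn => // xJ.
  rewrite (_ : 4 - x ^+ 2 = 0) ?sqrtr0 ?mulr0//.
  move: xI xJ; rewrite !in_itv/= negb_and -!leNgt => + /andP[x1 x2].
  by move=> /orP[] x3; have [->|->] : x = 2 \/ x = -2; try ring; [right|left]; lra.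
rewrite arcsine_pdfE// /semicircle_pdf (subset_itv_oo_cc xI).
move: xI; rewrite in_itv/= => /andP[x1 x2].
have s0 : 0 < Num.sqrt (4 - x ^+ 2) by rewrite sqrtr_gt0; nra.
have s2 : Num.sqrt (4 - x ^+ 2) ^+ 2 = 4 - x ^+ 2 by rewrite sqr_sqrtr//; nra.
rewrite (_ : 2 - x ^+ 2 / 2 = Num.sqrt (4 - x ^+ 2) ^+ 2 / 2); last by rewrite s2; field.
by move: (Num.sqrt _) s0 (@pi R) (pi_gt0 R) => s s0 p p0; field; rewrite !lt0r_neq0.
Qed.

Lemma integrable_arcsine_poly k (q0 q2 q4 : R) :
  mu.-integrable setT (fun x : R => (x ^+ k * ((q4 * x ^+ 4 + q2 * x ^+ 2 + q0) * pdf x))%:E).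
Proof.
rewrite (_ : (fun x : R => _) = (fun x : R => q4%:E * (x ^+ (k + 4) * pdf x)%:E +
  q2%:E * (x ^+ (k + 2) * pdf x)%:E + q0%:E * (x ^+ k * pdf x)%:E)%E); last first.
  by apply/funext => x; rewrite -!EFinM -!EFinD !exprD; congr _%:E; ring.
by do 2? apply: integrableD => //; apply: integrableZl => //; exact: integrable_arcsine_exprn.
Qed.

Lemma integral_arcsine_poly k (q0 q2 q4 : R) :
  (\int[mu]_x (x ^+ k * ((q4 * x ^+ 4 + q2 * x ^+ 2 + q0) * pdf x))%:E =
    (q4 * arc R k.+4 + q2 * arc R k.+2 + q0 * arc R k)%:E)%E.
Proof.
have I m := integrable_arcsine_exprn R m.
have Z m (q : R) : mu.-integrable setT (fun x : R => q%:E * (x ^+ m * pdf x)%:E)%E.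
  by apply: integrableZl => //; exact: I.
have IZ m (q : R) : (\int[mu]_x (q%:E * (x ^+ m * pdf x)%:E) = (q * arc R m)%:E)%E.
  rewrite (integralZl measurableT (I m)).
  by rewrite EFinM; congr (_ * _)%E; exact: arcsine_moment.
under eq_integral.
  move=> x _; rewrite (_ : x ^+ k * _ = q4 * (x ^+ (k + 4) * pdf x) +
    q2 * (x ^+ (k + 2) * pdf x) + q0 * (x ^+ k * pdf x)); last by rewrite !exprD; ring.
  rewrite !EFinD (EFinM q4) (EFinM q2) (EFinM q0); over.
rewrite (integralD measurableT (integrableD measurableT (Z _ _) (Z _ _)) (Z _ _)).
rewrite (integralD measurableT (Z _ _) (Z _ _)).
by rewrite !EFinD -!IZ !addn2 addn4.
Qed.

Lemma semicircle_moment k : (\int[@semicircle R]_x (x ^+ k)%:E = (sc_series R k)%:E)%E.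
Proof.
have E : (EFin \o @semicircle_pdf R) = (fun x : R => (x ^+ 0 * ((0 * x ^+ 4 + - 2^-1 * x ^+ 2 + 2) * pdf x))%:E).
  by apply/funext => x /=; rewrite semicircle_pdfE; congr _%:E; ring.
have I : mu.-integrable setT (EFin \o @semicircle_pdf R) by rewrite E; exact: integrable_arcsine_poly.
transitivity (\int[density I (@semicircle_pdf_ge0 R)]_x (x ^+ k)%:E)%E.
  by apply: eq_measure_integral.
have F x : x ^+ k * semicircle_pdf x = x ^+ k * ((0 * x ^+ 4 + - 2^-1 * x ^+ 2 + 2) * pdf x).
  by rewrite semicircle_pdfE; ring.
rewrite integral_density.
- under eq_integral do rewrite F.
  by rewrite integral_arcsine_poly /sc_series; congr _%:E; ring.
- exact: exprn_measurable.
- by under eq_fun do rewrite F; exact: integrable_arcsine_poly.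
Qed.

Section correction_measure.
Context (r : nat) (sigma s2 alpha : R).
Local Notation nu := (nu r sigma s2 alpha).
Let k1 := alpha / sigma ^+ 4 - (2 + r%:R).
Let k2 := s2 / sigma ^+ 2 - 4 * (alpha / sigma ^+ 4) + 7 + 3 * r%:R.
Let k3 := 2 * (alpha / sigma ^+ 4 - s2 / sigma ^+ 2 - 1).
(** The density of the absolutely continuous part of nu; the arcsine term with coefficient - r/2 is
    merged into the constant coefficient. *)
Let g (x : R) := (k1 / 2 * x ^+ 4 + k2 / 2 * x ^+ 2 + (k3 - r%:R) / 2) * pdf x.
Let gp := (g^\+)%R.
Let gn := (g^\-)%R.
Let atom (k : nat) : R := if k is 0%N then 2 else -2.

Let mE k : measurable_fun setT (fun x : R => x ^+ k). Proof. exact: exprn_measurable. Qed.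

Let gI : mu.-integrable setT (EFin \o g).
Proof. exact: integrable_quartic_arcsine_pdf. Qed.

Let mg : measurable_fun setT g.
Proof. by apply/measurable_EFinP; exact: measurable_int gI. Qed.

Let xgI k : mu.-integrable setT (fun x : R => (x ^+ k * g x)%:E).
Proof. exact: integrable_arcsine_poly. Qed.

Let xI k (h : R -> R) : measurable_fun setT h -> (forall x, `|h x| <= `|g x|) ->
  mu.-integrable setT (fun x : R => (x ^+ k * h x)%:E).
Proof.
move=> mh hg; apply: le_integrable (xgI k) => //.
  by apply/measurable_EFinP; exact: measurable_funM.
by move=> x _; rewrite !abse_EFin lee_fin (normrM _ (h x)) (normrM _ (g x)) ler_wpM2l.
Qed.

Let gp_le x : `|gp x| <= `|g x|.
Proof. by rewrite /gp /funrpos /Num.max; case: ifP => // _; rewrite normr0. Qed.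

Let gn_le x : `|gn x| <= `|g x|.
Proof. by rewrite /gn /funrneg; case: (leP (- g x) 0) => _; rewrite ?normr0 ?normrN. Qed.

Let mgp : measurable_fun setT gp. Proof. exact: measurable_funrpos. Qed.

Let mgn : measurable_fun setT gn. Proof. exact: measurable_funrneg. Qed.

Let gpI : mu.-integrable setT (EFin \o gp).
Proof. by have := xI 0 mgp gp_le; under eq_fun do rewrite expr0 mul1r. Qed.

Let gnI : mu.-integrable setT (EFin \o gn).
Proof. by have := xI 0 mgn gn_le; under eq_fun do rewrite expr0 mul1r. Qed.

Let c : {nonneg R} := (r%:R / 4)%:nng.
Let mp : {measure set (measurableTypeR R) -> \bar R} := density gpI (@funrpos_ge0 _ _ g).
Let mn : {measure set (measurableTypeR R) -> \bar R} := density gnI (@funrneg_ge0 _ _ g).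
(** The atoms, of mass r/4 each, together with the positive part of [g]; subtracting the negative
    part [mn] gives nu. *)
Let m1 : {measure set (measurableTypeR R) -> \bar R} := measure_add (@dirac_sum _ (measurableTypeR R) R c atom 2) mp.

Let nu_formula A : measurable A ->
  (nu A = (r%:R / 4)%:E * (\d_((2 : R)%R : measurableTypeR R) A + \d_((- 2 : R)%R : measurableTypeR R) A) + \int[mu]_(x in A) (g x)%:E)%E.
Proof.
move=> mA.
have Ip : mu.-integrable A (EFin \o pdf) := integrableS measurableT mA (@subsetT _ _) (@integrable_arcsine_pdf R).
have Iq := integrableS measurableT mA (@subsetT _ _) (integrable_quartic_arcsine_pdf k1 k2 k3).
set d2 := (\d_((2 : R)%R : measurableTypeR R) A); set dN2 := (\d_((- 2 : R)%R : measurableTypeR R) A).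
pose X := (\int[mu]_(x in A) (pdf x)%:E)%E.
pose Y := (\int[mu]_(x in A) ((k1 * x ^+ 4 + k2 * x ^+ 2 + k3) * pdf x)%:E)%E.
have fX : X \is a fin_num by have := integrable_fin_num mA Ip.
have fY : Y \is a fin_num by have := integrable_fin_num mA Iq.
have -> : (\int[mu]_(x in A) (g x)%:E = (- (r%:R / 2))%:E * X + (1 / 2)%:E * Y)%E.
  rewrite /X /Y -(integralZl mA Ip) -(integralZl mA Iq) -(integralD mA (integrableZl mA _ Ip) (integrableZl mA _ Iq)).
  by apply: eq_integral => x _; rewrite /= -!EFinM -EFinD; congr _%:E; rewrite /g; field.
have -> : (nu A = (r%:R / 2)%:E * ((1 / 2)%:E * (d2 + dN2) - X) + (1 / 2)%:E * Y)%E by [].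
by rewrite -(fineK fX) -(fineK fY) /d2 /dN2 !diracE -!EFinM -!EFinD; congr _%:E; field.
Qed.

Let m1E A : (m1 A = (r%:R / 4)%:E * (\d_((2 : R)%R : measurableTypeR R) A +
  \d_((- 2 : R)%R : measurableTypeR R) A) + mp A)%E.
Proof.
transitivity (@dirac_sum _ (measurableTypeR R) R c atom 2 A + mp A)%E; first exact: measure_addE.
congr (_ + _)%E.
by rewrite /dirac_sum /mscale /= /mscale /= /msum !big_ord_recl big_ord0 adde0.
Qed.

Let nu_sub A : measurable A -> (nu A = m1 A - mn A)%E.
Proof.
move=> mA; rewrite nu_formula// m1E -addeA; congr (_ + _)%E.
rewrite integralE; congr (_ - _)%E; apply: eq_integral => x _.
  by rewrite funeposE -EFin_max.
by rewrite funenegE -EFin_max.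
Qed.

Let gpBgn x : gp x - gn x = g x.
Proof. by rewrite -[in RHS](funrposBneg g). Qed.

Let integrable_mn k : mn.-integrable setT (fun x : R => (x ^+ k)%:E).
Proof. exact: @integrable_density _ _ _ mu _ gnI (@funrneg_ge0 _ _ g) _ (mE k) (xI k mgn gn_le). Qed.

Let integrable_mp k : mp.-integrable setT (fun x : R => (x ^+ k)%:E).
Proof. exact: @integrable_density _ _ _ mu _ gpI (@funrpos_ge0 _ _ g) _ (mE k) (xI k mgp gp_le). Qed.

Let integrable_m1 k : m1.-integrable setT (fun x : R => (x ^+ k)%:E).
Proof.
have mxk : measurable_fun setT (fun x : measurableTypeR R => (x ^+ k)%:E) by apply/measurable_EFinP; exact: mE.
apply/integrableP; split => //.
have mxk' : measurable_fun setT (fun x : measurableTypeR R => `|(x ^+ k)%:E|)%E by exact: measurableT_comp.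
rewrite ge0_integral_measure_add//.
have /integrableP[_ h1] := @integrable_dirac_sum _ (measurableTypeR R) R c atom 2 _ (mE k).
have /integrableP[_ h2] := integrable_mp k.
exact: lte_add_pinfty.
Qed.

Lemma charge_integral_nu k : charge_integral nu (fun x => x ^+ k) =
  (correction (alpha / sigma ^+ 4) (s2 / sigma ^+ 2) r%:R k)%:E.
Proof.
have fin1 : fin_num_fun m1 by move=> A mA; rewrite m1E !diracE -EFinD -EFinM fin_numD fin_num_measure.
have fin2 : fin_num_fun mn by move=> A mA; rewrite fin_num_measure.
rewrite (charge_integral_sub fin1 fin2 nu_sub (integrable_m1 k) (integrable_mn k)).
have I1 := @integrable_dirac_sum _ (measurableTypeR R) R c atom 2 _ (mE k).
rewrite (integral_measure_add measurableT I1 (integrable_mp k)).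
rewrite integral_dirac_sum// integral_density; [|exact: mE|exact: xI mgp gp_le].
rewrite integral_density; [|exact: mE|exact: xI mgn gn_le].
rewrite -addeA -(integralB _ (xI k mgp gp_le) (xI k mgn gn_le))//.
under eq_integral do rewrite -EFinB -mulrBr gpBgn.
rewrite integral_arcsine_poly -EFinD; congr _%:E.
rewrite /correction /even_pow /k1 /k2 /k3 !big_ord_recl big_ord0.
move: (arc R _) (arc R _) (arc R _) => x y z /=.
by move: (alpha / _) (s2 / _) => u v; field.
Qed.

(** The atoms have mass r/2, and the arcsine moments of order 0, 2, 4 are 1, 2, 6. *)
Lemma nu_setT : nu setT = 0%E.
Proof.
rewrite nu_formula// !diracT.
have -> : (\int[mu]_x (g x)%:E = (k1 / 2 * arc R 4 + k2 / 2 * arc R 2 + (k3 - r%:R) / 2 * arc R 0)%:E)%E.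
  by rewrite -integral_arcsine_poly; apply: eq_integral => x _; rewrite expr0 mul1r.
rewrite (_ : (1 + 1)%E = (2 : R)%:E)// -EFinM -EFinD; congr _%:E; rewrite /k1 /k2 /k3 /=.
by move: (alpha / _) (s2 / _) => u v; field.
Qed.

End correction_measure.

End limiting_moments.

(** * Power sums of eigenvalues as traces *)

Section trace_of_powers.
Context (R : realType).
Local Notation C := R[i].

Lemma char_poly_similar n (P D : 'M[C]_n) : P \in unitmx ->
  char_poly (invmx P *m D *m P) = char_poly D.
Proof.
move=> uP; rewrite /char_poly.
have E : map_mx polyC (invmx P) *m map_mx polyC P = 1%:M :> 'M[{poly C}]_n.
  by rewrite -map_mxM mulVmx// map_mx1.
have -> : char_poly_mx (invmx P *m D *m P) =
    map_mx polyC (invmx P) *m char_poly_mx D *m map_mx polyC P.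
  by rewrite /char_poly_mx mulmxBr mulmxBl !map_mxM scalar_mxC -(mulmxA 'X%:M) E mulmx1.
by rewrite !det_mulmx mulrC mulrA -det_mulmx (mulmx1C E) det1 mul1r.
Qed.

(** Similar matrices have the same characteristic polynomial, so the list of its roots is a
    permutation of the diagonal. *)
Lemma sum_eigenvalues (G : C -> C) n (P : 'M[C]_n) (D : 'rV[C]_n) : P \in unitmx ->
  \sum_(k < n) G (eigenvalues (invmx P *m diag_mx D *m P))`_k = \sum_(k < n) G (D 0 k).
Proof.
move=> uP; rewrite /eigenvalues; set s := sval _.
have /= := svalP (closed_field_poly_normal (char_poly (invmx P *m diag_mx D *m P))).
rewrite -/s (monicP (char_poly_monic _)) scale1r char_poly_similar// char_poly_trig; last first.
  exact: diag_mx_is_trig.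
rewrite (eq_bigr (fun i => 'X - (D 0 i)%:P)); last by move=> i _; rewrite mxE eqxx mulr1n.
rewrite -(big_map (D 0) xpredT (fun x => 'X - x%:P)) => /prod_XsubC_eq.
rewrite perm_sym => pm.
have sz : size s = n by rewrite (perm_size pm) size_map -sum1_size sum_nat_const card_ord muln1.
rewrite -[RHS](big_map (D 0) xpredT G) -(perm_big _ pm)/= (big_nth 0) big_mkord sz.
by [].
Qed.

Lemma walk_diagonalized n (M : nat -> nat -> C) (P : 'M[C]_n) (D : 'rV[C]_n) k : P \in unitmx ->
  \matrix_(i < n, j < n) M i j = invmx P *m diag_mx D *m P ->
  \matrix_(i < n, j < n) walk M (iota 0 n) k i j =
    invmx P *m diag_mx (\row_j D 0 j ^+ k) *m P.
Proof.
move=> uP MD; elim: k => [|k IH].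
  rewrite (_ : \row_j D 0 j ^+ 0 = const_mx 1); last by apply/rowP => j; rewrite !mxE.
  rewrite diag_const_mx mulmx1 mulVmx//.
  by apply/matrixP => i j; rewrite !mxE.
transitivity ((\matrix_(i < n, j < n) M i j) *m (\matrix_(i < n, j < n) walk M (iota 0 n) k i j)).
  apply/matrixP => i j; rewrite !mxE /= -{1}(subn0 n) big_mkord; apply: eq_bigr => l _.
  by rewrite !mxE.
rewrite MD IH !mulmxA mulmxK// -[invmx P *m _ *m diag_mx _]mulmxA mulmx_diag; congr (_ *m diag_mx _ *m _).
by apply/rowP => j; rewrite !mxE exprS.
Qed.

(** Diagonalise by the spectral theorem and use cyclicity of the trace; the eigenvalues are real, so
    taking real parts changes nothing. *)
Lemma hermitian_eigenvalue_powers n (M : nat -> nat -> C) k :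
  (forall i j, M j i = ((M i j)^*)%C) ->
  \sum_(j < n) (complex.Re (eigenvalues (\matrix_(i < n, j < n) M i j))`_j) ^+ k =
  complex.Re (\sum_(u <- iota 0 n) walk M (iota 0 n) k u u).
Proof.
move=> hM; set A := \matrix_(i, j) M i j.
have hA : A \is hermsymmx.
  apply/is_hermitianmxP; rewrite expr0 scale1r; apply/matrixP => i j.
  by rewrite !mxE hM.
have uP := spectral_unit A.
have rD := hermitian_spectral_diag_real hA.
have /orthomx_spectralP AE := hermitian_normalmx hA.
move: uP rD AE; set P := spectralmx A; set D := spectral_diag A => uP rD AE.
have ReD j : (complex.Re (D 0 j))%:C%C = D 0 j.
  have /CrealP := mxOverP rD 0 j.
  by case: (D 0 j) => a b [] /= b0; rewrite (_ : b = 0)//; move: b0; lra.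
have -> : \sum_(u <- iota 0 n) walk M (iota 0 n) k u u =
    \tr (\matrix_(i < n, j < n) walk M (iota 0 n) k i j).
  by rewrite -{1}(subn0 n) big_mkord; apply: eq_bigr => u _; rewrite mxE.
rewrite (walk_diagonalized k uP AE) mxtrace_mulC mulmxA mulmxV// mul1mx mxtrace_diag.
rewrite raddf_sum.
under [RHS]eq_bigr do rewrite mxE -ReD -rmorphXn /=.
rewrite AE.
have := @sum_eigenvalues (fun z => (complex.Re z ^+ k)%:C%C) n P D uP.
by rewrite -!rmorph_sum => -[].
Qed.

End trace_of_powers.

(** * From the trace expansion to the theorem *)

Section finish.
Context d (T : measurableType d) (R : realType) (P : probability T R).
Local Notation C := R[i].
Local Notation Ec := (complex_expectation P).

Lemma mul_conj_normc (z : C) : z * (z^*)%C = (Normc.normc z ^+ 2)%:C%C.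
Proof. by rewrite -nsqE nsq_normc. Qed.

Lemma Ec_real (f : T -> R) : Ec (fun w => (f w)%:C%C) = (fine 'E_P[f])%:C%C.
Proof. by rewrite complex_expectationE unlock /Rintegral /= integral0. Qed.

(** The probabilistic side works with series over [R[i]], the analytic side over [R]; this lemma and
    the next two match them. *)
Lemma arc_complex k : arc C k = (arc R k)%:C%C.
Proof.
elim/ltn_ind: k => -[//|[//|k IH]] /=.
by rewrite IH// !rmorphM fmorphV !rmorph_nat.
Qed.

Lemma sc_series_complex k : sc_series C k = (sc_series R k)%:C%C.
Proof. by rewrite /sc_series !arc_complex rmorphB !rmorphM !fmorphV !rmorph_nat. Qed.

Lemma correction_complex (a b : R) r k :
  correction a%:C%C b%:C%C r%:R k = (correction a b r%:R k)%:C%C.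
Proof.
rewrite /correction /even_pow !arc_complex.
by rewrite !(rmorph_nat, rmorphD, rmorphB, rmorphM, rmorphN, rmorphXn, fmorphV, rmorph1).
Qed.

Lemma mean_moment_tau (W : nat -> nat -> T -> C) (sigma : R) k n :
  independent_centered_entries P W -> (forall i j w, W j i w = ((W i j w)^*)%C) -> (0 < n)%N ->
  mean_moment P sigma W k n = (complex.Re (Ec (tau W sigma n (iota 0 n) k)))%:E.
Proof.
move=> entW hermW n0; pose t := tau W sigma n (iota 0 n) k.
have E w : \int[spectral_measure (wigner_matrix sigma W n w)]_x (x ^+ k) = complex.Re (t w).
  have -> : spectral_measure (wigner_matrix sigma W n w) =
      @dirac_sum _ (measurableTypeR R) R (n%:R^-1)%:nng
        (fun k => complex.Re (eigenvalues (wigner_matrix sigma W n w))`_k) n by [].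
  rewrite /Rintegral integral_dirac_sum/=; last exact: exprn_measurable.
  have := @hermitian_eigenvalue_powers R n (fun i j => scaled W sigma n i j w) k.
  rewrite /t /tau -[wigner_matrix _ _ _ _]/(\matrix_(i, j) scaled W sigma n i j w) => ->.
    have -> : n%:R^-1 = (n%:R^-1)%:C%C :> C by rewrite fmorphV rmorph_nat.
    by rewrite ReM /= mul0r subr0.
  by move=> i j; rewrite /scaled hermW; case: (W i j w) => a b; apply: complex_ext => /=; ring.
have [tI _] : cintegrable P t by apply: (alg_cintegrable entW hermW); exact: alg_tau.
rewrite /mean_moment; under eq_fun do rewrite E.
rewrite /complex_expectation /= fineK// unlock.
exact: integrable_fin_num tI.
Qed.

(** The hypothesis says that [e n] is O(n^(-3/2)). *)
Lemma littleo_inv (e : nat -> R) (K : R) : (forall n, (0 < n)%N -> e n ^+ 2 * n%:R ^+ 3 <= K) ->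
  e =o_\oo (fun n : nat => n%:R^-1 : R).
Proof.
move=> HK; apply/eqoP => eps eps0.
(* Beyond this threshold [K] is at most [eps ^+ 2] times [n], which is the required bound after
   squaring. *)
have [m Hm] : exists m : nat, K / eps ^+ 2 < m%:R.
  by exists (Num.bound `|K / eps ^+ 2|); apply: le_lt_trans (ler_norm _) (archi_boundP _).
near=> n.
have n0 : (0 < n)%N by near: n; exact: nbhs_infty_gt.
have mn : (m <= n)%N by near: n; exact: nbhs_infty_ge.
have N0 : 0 < n%:R :> R by rewrite ltr0n.
have Kn : K <= eps ^+ 2 * n%:R.
  rewrite -ler_pdivrMl ?exprn_gt0// mulrC (le_trans (ltW Hm))// ler_nat//.
rewrite normfV (ger0_norm (ltW N0)) ler_pdivlMr//.
rewrite -(@ler_pXn2r _ 2)// ?nnegrE ?mulr_ge0 ?(ltW eps0) ?(ltW N0)//.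
rewrite exprMn real_normK ?num_real// -(ler_pM2r N0) -mulrA -exprSr.
exact: le_trans (HK _ n0) Kn.
Unshelve. all: by end_near. Qed.

(** Common form of the real and complex cases: Hermitian entries, with r multiplying the mean of the
    square of an off-diagonal entry. *)
Lemma hermitian_expansion (W : nat -> nat -> T -> C) (sigma s2 alpha : R) (r k : nat) :
  independent_centered_entries P W -> (forall i j w, W j i w = ((W i j w)^*)%C) -> 0 < sigma ->
  (forall i j, i != j -> Ec (fun w => W i j w * W j i w) = (sigma ^+ 2)%:C%C) ->
  (r * r)%N = r ->
  (forall i j, i != j -> Ec (fun w => W i j w * W i j w) = r%:R * (sigma ^+ 2)%:C%C) ->
  (forall i j, i != j -> Ec (fun w => (W i j w * W j i w) ^+ 2) = alpha%:C%C) ->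
  (r = 1%N -> forall i j w, W j i w = W i j w) ->
  (forall i, Ec (fun w => W i i w * W i i w) = s2%:C%C) ->
  exists2 e : nat -> R, e =o_\oo (fun n : nat => n%:R^-1 : R) &
    forall n, (0 < n)%N -> (mean_moment P sigma W k n =
      \int[@semicircle R]_x (x ^+ k : R)%R%:E +
      (n%:R^-1)%R%:E * charge_integral (nu r sigma s2 alpha) (fun x => x ^+ k)%R + (e n)%:E)%E.
Proof.
move=> entW hermW sigma_gt0 varW r_sqr sqW fourthW symW diagW.
pose a : R := alpha / sigma ^+ 4; pose b : R := s2 / sigma ^+ 2.
pose m n := complex.Re (Ec (tau W sigma n (iota 0 n) k)).
exists (fun n => m n - sc_series R k - n%:R^-1 * correction a b r%:R k).
  have [K HK] := mean_tau_bound entW hermW sigma_gt0 varW r_sqr sqW fourthW symW diagW k.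
  apply: (@littleo_inv _ K) => n n0; apply: le_trans (HK n n0); rewrite ler_wpM2r ?exprn_ge0//.
  rewrite /kurt /diagvar sc_series_complex correction_complex -/a -/b.
  have -> : n%:R^-1 = (n%:R^-1)%:C%C :> C by rewrite fmorphV rmorph_nat.
  rewrite -rmorphM /nsq /m; case: (Ec _) => x y /=.
  by rewrite lerDl sqr_ge0.
move=> n n0; rewrite (mean_moment_tau _ _ entW hermW n0) semicircle_moment charge_integral_nu.
by rewrite -EFinM -!EFinD; congr _%:E; rewrite -/a -/b /m; ring.
Qed.

End finish.

Unset Implicit Arguments.
Set Strict Implicit.

Theorem mainTheorem1 (d : measure_display) (T : measurableType d)
    (R : realType) (P : probability T R) (r : nat) (sigma s2 alpha : R)
    (W : nat -> nat -> T -> R[i])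
    (sigma_gt0 : 0 < sigma) (s2_ge0 : 0 <= s2)
    (W_case : (r = 1%N /\ real_case P sigma s2 alpha W) \/
              (r = 0%N /\ complex_case P sigma s2 alpha W)) :
  nu r sigma s2 alpha setT = 0%E /\
  forall k : nat,
    exists2 e : nat -> R,
      e =o_\oo (fun n : nat => n%:R^-1 : R) &
      forall n : nat, (0 < n)%N ->
        mean_moment P sigma W k n =
        (\int[@semicircle R]_x (x ^+ k : R)%R%:E +
         (n%:R^-1)%R%:E * charge_integral (nu r sigma s2 alpha) (fun x => x ^+ k)%R +
         (e n)%:E)%E.
Proof.
split=> [|k]; first exact: nu_setT.
case: W_case => -[-> H].
(* In the real case conjugation is trivial, so symmetry is Hermitian symmetry and the squared
   modulus is the square. *)
- have conjW i j w : ((W i j w)^*)%C = W i j w.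
    by have := real_valued H i j w; case: (W i j w) => a b /= ->; rewrite oppr0.
  have symW := real_symmetric H.
  apply: hermitian_expansion => //.
  + exact: real_entries H.
  + by move=> i j w; rewrite conjW symW.
  + move=> i j ij; rewrite -(real_variance H ij); congr (complex_expectation P _).
    by apply/funext => w; rewrite symW expr2.
  + by move=> i j ij; rewrite mul1r -(real_variance H ij).
  + move=> i j ij; rewrite -(real_fourth_moment H ij); congr (complex_expectation P _).
    by apply/funext => w; rewrite symW -expr2 -exprM.
  + by move=> i; rewrite -(real_diag_variance H i).
(* In the complex case the product of opposite entries is the squared modulus, which converts the
   absolute moments of the hypotheses. *)
- have hermW := complex_hermitian H.
  apply: hermitian_expansion => //.
  + exact: complex_entries H.
  + move=> i j ij; under eq_fun do rewrite (hermW i j) mul_conj_normc.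
    by rewrite Ec_real -/(abs_moment P 2 (W i j)) (complex_variance H ij).
  + by move=> i j ij; rewrite mul0r -(complex_square H ij).
  + move=> i j ij; under eq_fun do rewrite (hermW i j) mul_conj_normc -rmorphXn/= -exprM.
    by rewrite Ec_real -/(abs_moment P 4 (W i j)) (complex_fourth_moment H ij).
  + move=> i; under eq_fun do rewrite {2}(hermW i i) mul_conj_normc.
    by rewrite Ec_real -/(abs_moment P 2 (W i i)) (complex_diag_variance H).
Qed.
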